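(* Let $r\in\{\omega,\infty\}$. Consider $C^r$ differential systems of the form $$\dot x = Ax+f(x),\qquad x\in\mathbb R^n, \qquad (\ast)$$ where $n$ is a positive integer, $A$ is a real $n\times n$ matrix and $f$ is an $\mathbb R^n$-valued $C^r$ function defined in a neighborhood of the origin whose Taylor expansion at the origin has no constant and no linear terms. Suppose that the eigenvalues $\lambda_1,\ldots,\lambda_n\in\mathbb C$ of $A$ (counted with multiplicity) satisfy $$\lambda_1=0\quad\text{and}\quad \sum_{j=2}^n m_j\lambda_j\neq 0\ \text{ for all } m_2,\ldots,m_n\in\mathbb Z_+ \text{ with } \sum_{j=2}^n m_j\ge 1. \qquad (\ast\ast)$$ (a) If system $(\ast)$ has a $C^r$ first integral (non-flat in the case $r=\infty$) in a neighborhood of the origin, then there exists a curve passing through the origin which consists entirely of singular points of system $(\ast)$. (b) If system $(\ast)$ has a curve consisting entirely of singular points and containing the origin in its interior, the following statements hold. (b$_1$) System $(\ast)$ always has a formal first integral at the origin. (b$_2$) There exist analytic differential systems of the form $(\ast)$, satisfying $(\ast\ast)$ and having a curve consisting of singular points and containing the origin in its interior, which have no analytic first integral in any neighborhood of the origin.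
   Context: $\mathbb Z_+$ is the set of nonnegative integers; $C^\omega$ means real analytic. A singular point of $(\ast)$ is a point $p$ with $Ap+f(p)=0$. A $C^r$ first integral in a neighborhood of the origin is a non-constant $C^r$ real function $H$, defined in some neighborhood of $0\in\mathbb R^n$ and normalized by $H(0)=0$, such that $\langle\nabla H(x),\,Ax+f(x)\rangle\equiv 0$ there, where $\nabla H$ is the gradient and $\langle\cdot,\cdot\rangle$ the inner product; an analytic first integral is the case $r=\omega$. A $C^\infty$ function is non-flat if its Taylor expansion at the origin does not identically vanish. A formal first integral is a nonzero formal power series $H(x)=\sum_{\ell=1}^\infty H_\ell(x)$, with $H_\ell$ a homogeneous polynomial of degree $\ell$, such that $\langle\nabla H(x),\,Ax+f(x)\rangle\equiv0$ as a formal power series, where $\nabla H=\sum_{\ell\ge1}\nabla H_\ell$ and $f$ is replaced by its Taylor series at the origin. A curve passing through the origin (equivalently, containing the origin in its interior) means the image of a continuous injective map $\gamma:(-\varepsilon,\varepsilon)\to\mathbb R^n$, for some $\varepsilon>0$, with $\gamma(0)=0$. *)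

(* Defs.v *)
From HB Require Import structures.
From mathcomp Require Import all_boot all_order all_algebra.
(* The notations of mpoly are incompatible with those of mathcomp-analysis. *)
From mathcomp Require Import -(notations) mpoly.
From mathcomp Require Import complex.
From mathcomp Require Import all_classical all_reals all_analysis.

Set Implicit Arguments.
Unset Strict Implicit.
Unset Printing Implicit Defensive.

Import Order.TTheory GRing.Theory Num.Theory.
Import numFieldNormedType.Exports.

Local Open Scope classical_set_scope.
Local Open Scope ring_scope.

Variant regularity := Comega | Cinfty.

Section Regularity.
Variables (R : realType) (n : nat).
Implicit Types (U : set 'cV[R]_n) (g : 'cV[R]_n -> R) (m : multinom n).

Definition partial (i : 'I_n) g : 'cV[R]_n -> R :=
  fun x => 'D_(delta_mx i 0) g x.

Definition iter_partial (s : seq 'I_n) g : 'cV[R]_n -> R := foldr partial g s.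

Definition gradient g (x : 'cV[R]_n) : 'cV[R]_n := \col_i partial i g x.

Definition inner (u v : 'cV[R]_n) : R := \sum_(i < n) u i 0 * v i 0.

(* In the next two definitions U is meant to be open. *)
Definition smooth_on U g : Prop :=
  forall (s : seq 'I_n) x, U x ->
    {for x, continuous (iter_partial s g)} /\
    forall i, derivable (iter_partial s g) x (delta_mx i 0).

Definition monomial m (h : 'cV[R]_n) : R := \prod_(i < n) h i 0 ^+ m i.

(* A power series in several variables, absolutely convergent at h; its sum is
   computed by grouping the terms by degree. *)
Definition power_series_cvg (c : multinom n -> R) (h : 'cV[R]_n) (v : R) :=
  cvgn (series (fun d =>
    \sum_(m : bmultinom n d.+1 | mdeg m == d) `|c m * monomial m h|)) /\
  series (fun d =>
    \sum_(m : bmultinom n d.+1 | mdeg m == d) c m * monomial m h) @ \oo --> v.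

Definition analytic_on U g : Prop :=
  forall p, U p -> exists (c : multinom n -> R) (rho : R), 0 < rho /\
    forall h : 'cV[R]_n, `|h| < rho -> power_series_cvg c h (g (p + h)).

Definition Cr_on (r : regularity) U g : Prop :=
  match r with
  | Comega => analytic_on U g
  | Cinfty => smooth_on U g
  end.

Definition taylor_coef g m : R :=
  iter_partial (flatten [seq nseq (m i) i | i <- enum 'I_n]) g 0
  / \prod_(i < n) (m i)`!%:R.

Definition nonflat g : Prop := exists m, taylor_coef g m != 0.

Definition taylor_part (d : nat) g : mpoly n R :=
  \sum_(m : bmultinom n d.+1 | mdeg m == d) taylor_coef g m *: mpolyX R m.

End Regularity.

Section Systems.
Variables (R : realType) (n : nat).
Implicit Types (A : 'M[R]_n) (f : 'cV[R]_n -> 'cV[R]_n) (U V : set 'cV[R]_n).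

(* f is a total function, of which only the values on V are meaningful. *)
Definition system (r : regularity) A f V : Prop :=
  [/\ open V, V 0, forall i, Cr_on r V (fun x => f x i 0)
    & forall i (m : multinom n),
        (mdeg m <= 1)%N -> taylor_coef (fun x => f x i 0) m = 0].

Definition vector_field A f (x : 'cV[R]_n) : 'cV[R]_n := A *m x + f x.

Definition singular_point A f V (p : 'cV[R]_n) : Prop :=
  V p /\ vector_field A f p = 0.

Definition has_singular_curve A f V : Prop :=
  exists (eps : R) (gamma : R -> 'cV[R]_n),
    [/\ 0 < eps,
        {in `]- eps, eps[, continuous gamma},
        {in `]- eps, eps[ &, injective gamma},
        gamma 0 = 0
      & {in `]- eps, eps[, forall t, singular_point A f V (gamma t)}].

(* The domain U is required to be connected: otherwise a function vanishing
   near 0 could count as non-constant because of a component of U away from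
   0. *)
Definition first_integral_on (r : regularity) A f V U (H : 'cV[R]_n -> R) :
    Prop :=
  [/\ [/\ open U, connected U, U 0 & U `<=` V],
      Cr_on r U H,
      H 0 = 0,
      exists x y, [/\ U x, U y & H x != H y]
    & forall x, U x -> inner (gradient H x) (vector_field A f x) = 0].

(* Homogeneous part of degree d of the i-th component of the Taylor series
   of A x + f x. *)
Definition field_part A f (d : nat) (i : 'I_n) : mpoly n R :=
  (if d == 1%N then \sum_(j < n) A i j *: mpolyX R (mnm1 j) else 0)
  + taylor_part d (fun x => f x i 0).

(* H l is the homogeneous part of degree l of the series; the last clause is
   the vanishing of the homogeneous part of each degree d of
   <grad H, A x + f>. *)
Definition formal_first_integral A f (H : nat -> mpoly n R) : Prop :=
  [/\ H 0%N = 0,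
      forall l, H l \is ishomog1 l mdeg,
      exists l, H l != 0
    & forall d, \sum_(l < d.+2) \sum_(i < n)
        mderiv i (H l) * field_part A f (d.+1 - l) i = 0].

End Systems.

Definition spectrum_condition (R : realType) (n : nat) (A : 'M[R]_n.+1) :
    Prop :=
  exists lambda : 'I_n.+1 -> complex R,
    [/\ char_poly (map_mx (real_complex R) A) =
          \prod_(j < n.+1) ('X - (lambda j)%:P),
        lambda ord0 = 0
      & forall m : 'I_n.+1 -> nat,
          (1 <= \sum_(j < n.+1 | j != ord0) m j)%N ->
          \sum_(j < n.+1 | j != ord0) (m j)%:R * lambda j != 0].

(* Main.v *)
Require Import Defs.
From HB Require Import structures.
From mathcomp Require Import all_boot all_order all_algebra.
From mathcomp Require Import all_classical all_reals all_analysis.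
From mathcomp Require Import -(notations) mpoly.
From mathcomp Require Import complex.
From mathcomp Require Import ring lra zify.

(** Let v and l span the right and left kernels of A. On forms of degree d the
    operator G |-> <grad G, A x> has kernel spanned by l^d and range the forms
    vanishing at v, because its eigenvalues are the nonnegative combinations of
    d eigenvalues of A.

    (a) Let K invert A on the kernel of l. The equation x = t v - K f(x) defines
    by contraction a Lipschitz curve tangent to v along which the field is a
    multiple of v. The lowest homogeneous part of a first integral H is a
    multiple of l^k, so the derivative of H in the direction v is nonzero on
    this curve away from 0, and the multiple must be zero.

    (b1) Starting from H_1 = l, the parts H_d are found recursively; the
    obstruction at degree d is the value at v of a form Q of degree d. Singular
    points p accumulating at 0 are tangent to v, and the derivative along the
    field of H_1 + ... + H_(d-1), which vanishes at p, is Q(p) + O(|p|^(d+1));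
    hence Q(v) = 0.

    (b2) The example is s' = s w, y' = y w, z' = -(sqrt 2 + x) z w, x' = s with
    w = 1 - y - z, whose singular set contains the x-axis. At a point x0 of the
    axis where sqrt 2 + x0 = P/Q is rational, a resonance forces the derivative
    in x of any analytic first integral to vanish, whereas this derivative is
    nonzero on the axis near 0, except at 0. *)

Set Implicit Arguments.
Unset Strict Implicit.
Unset Printing Implicit Defensive.
Import Order.TTheory GRing.Theory Num.Theory.
Import numFieldNormedType.Exports.
Local Open Scope classical_set_scope.
Local Open Scope ring_scope.

(** * Matrices with a simple zero eigenvalue *)

(** Applied to an m concentrated at one index, the spectral condition makes 0 a simple eigenvalue,
    so that l v can be normalized to 1. A need not be diagonalizable; the spectrum of the Lie
    operator is therefore found from the commutator rule: the derivative of an eigenform along an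
    eigenvector of A is zero or an eigenform of lower degree, its eigenvalue lowered by that of the
    vector.

    In (a) the equation of the curve is a Lyapunov-Schmidt reduction: it solves the singular point
    equation except for the component along v, and the first integral settles that one.

    In (b2) x acts as a parameter. The linear part at a point of the axis has the eigenvalues 1, 1,
    -(sqrt 2 + x) and 0: nonresonant at the origin since sqrt 2 is irrational, but resonant at
    points accumulating there. A resonance alone is no obstruction: the coupling x' = s feeds the
    x-derivative of the integral into the terms with a factor s, and w is chosen because 1/w is the
    sum of the powers of y + z, whose coefficients are all positive, so that the resonant monomial
    is reached without cancellation. *)

Lemma char_poly_dvd_Xsqr (F : fieldType) (n : nat) (A : 'M[F]_n.+1) :
  (\rank A < n)%N -> 'X^2 %| char_poly A.
Proof.
case: n A => // n A rA.
set r := \rank A in rA.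
pose L : 'M[{poly F}]_n.+2 := map_mx polyC (col_ebase A).
pose U : 'M[{poly F}]_n.+2 := map_mx polyC (row_ebase A).
pose L' : 'M[{poly F}]_n.+2 := map_mx polyC (invmx (col_ebase A)).
pose U' : 'M[{poly F}]_n.+2 := map_mx polyC (invmx (row_ebase A)).
have LL' : L *m L' = 1%:M.
  by rewrite -map_mxM mulmxV ?col_ebase_unit // map_mx1.
have UU' : U' *m U = 1%:M.
  by rewrite -map_mxM mulVmx ?row_ebase_unit // map_mx1.
(* X - A equals L (X L^-1 U^-1 - pid) U, and [D] takes a factor X out of each row of the middle
   matrix beyond the rank; there are at least two such rows. *)
pose D : 'M[{poly F}]_n.+2 := diag_mx (\row_i (if (i < r)%N then 1 else 'X)).
pose W : 'M[{poly F}]_n.+2 := \matrix_(i, j)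
   (if (i < r)%N then 'X * (L' *m U') i j - (i == j)%:R else (L' *m U') i j).
have defD : D *m W = 'X *: (L' *m U') - map_mx polyC (pid_mx r).
  apply/matrixP => i j; rewrite mul_diag_mx mxE !mxE.
  rewrite -/(i == j); case: ifP => ir; rewrite ?andbT ?andbF ?mul1r ?subr0 //.
    by rewrite polyC_natr.
have -> : char_poly A = \det (L *m (D *m W) *m U).
  rewrite defD mulmxBr mulmxBl -scalemxAr -scalemxAl mulmxA LL' mul1mx UU'.
  by rewrite -!map_mxM mulmx_ebase scalemx1.
rewrite !det_mulmx det_diag !big_ord_recr /= !mxE /=.
rewrite ltnNge -ltnS rA ltnNge (ltnW rA) /=.
apply/dvdpP; set p := \prod_(i < n) _.
exists (\det L * p * \det W * \det U); rewrite expr2; ring.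
Qed.

(** Up to the factor q(0), q(A) is the spectral projection onto the kernel of A. That kernel is a
    line, since corank two would force X^2 into the characteristic polynomial, so q(A) has rank one
    and factors as a column times a row. The last identity writes every vector as a multiple of v
    plus an element of the range of A with an explicit preimage. *)
Lemma kernel_splitting (F : fieldType) (n : nat) (A : 'M[F]_n.+1)
    (q : {poly F}) :
  char_poly A = 'X * q -> q.[0] != 0 ->
  exists (v : 'cV[F]_n.+1) (l : 'rV[F]_n.+1) (S : 'M[F]_n.+1),
    [/\ A *m v = 0, l *m A = 0, l *m v = 1%:M & 1%:M - v *m l = A *m S].
Proof.
move=> defA q0.
pose B := horner_mx A q.
have AB : A *m B = 0.
  have := Cayley_Hamilton A; rewrite defA rmorphM /= horner_mx_X.
  by rewrite mulmxE.
have BA : B *m A = 0.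
  have := Cayley_Hamilton A; rewrite defA mulrC rmorphM /= horner_mx_X.
  by rewrite mulmxE.
(* Hence q(A) = A s(A) + q(0), which is where the witness [S] = - s(A) / q(0) comes from. *)
have [s defq] : exists s, q = 'X * s + q.[0]%:P.
  exists (q %/ 'X); rewrite mulrC {1}(divp_eq q 'X); congr (_ + _).
  by rewrite -['X]subr0 modp_XsubC.
have defB : B = A *m horner_mx A s + q.[0]%:M.
  by rewrite /B {1}defq rmorphD rmorphM /= horner_mx_X horner_mx_C mulmxE.
have nA : ~~ (A \in unitmx).
  rewrite unitmxE unitfE negbK.
  have := char_poly_det A; rewrite defA coefXM /= => /esym/eqP.
  by rewrite mulf_eq0 signr_eq0.
have B0 : B != 0.
  apply: contra nA => /eqP B0; have := defB; rewrite B0 => /esym/eqP.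
  rewrite addr_eq0 => /eqP AS.
  suff /mulmx1_unit[] : A *m (- q.[0]^-1 *: horner_mx A s) = 1%:M by [].
  rewrite -scalemxAr AS scalerN scaleNr opprK -scalemx1 scalerA mulVf //.
  by rewrite scale1r.
have rA : \rank A = n.
  apply/eqP; rewrite eqn_leq; apply/andP; split; last first.
    rewrite leqNgt; apply/negP => /char_poly_dvd_Xsqr; rewrite defA expr2.
    rewrite dvdp_mul2l ?polyX_eq0 // -['X]subr0 dvdp_XsubCl => /rootP.
    by apply/eqP.
  rewrite -ltnS ltn_neqAle rank_leq_row andbT.
  by apply: contra nA => rk; rewrite -row_free_unit.
pose l := nz_row B.
have l0 : l != 0 by rewrite nz_row_eq0.
have lB : (l <= B)%MS by exact: nz_row_sub.
have Bl : (B <= l)%MS.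
  have /eqmxP : (l == B)%MS; last by move=> ->.
  rewrite -(mxrank_leqif_eq lB) eqn_leq mxrankS //=.
  have : (B <= kermx A)%MS by apply/sub_kermxP.
  move/mxrankS; rewrite mxrank_ker rA subSnn => rB.
  by apply: (leq_trans rB); rewrite lt0n mxrank_eq0.
have [u defu] : exists u, B = u *m l by exact/submxP.
have lA : l *m A = 0.
  by have /submxP[D ->] := lB; rewrite -mulmxA BA mulmx0.
have fl : row_free l.
  by rewrite -row_leq_rank lt0n mxrank_eq0.
have Au : A *m u = 0.
  by apply: (row_free_inj fl); rewrite mul0mx -mulmxA -defu.
have lu : l *m u = q.[0]%:M.
  have BB : B *m B = q.[0] *: B.
    have sB : horner_mx A s *m B = B *m horner_mx A s.
      by rewrite mulmxE /B (comm_horner_mx2 A s q).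
    rewrite {1}defB mulmxDl -mulmxA sB mulmxA AB mul0mx add0r.
    by rewrite mul_scalar_mx.
  move: BB; rewrite defu => /eqP; rewrite -subr_eq0.
  rewrite -mulmxA [l *m (_ *m _)]mulmxA [l *m u]mx11_scalar mul_scalar_mx.
  rewrite -scalemxAr -scalerBl -defu scaler_eq0 (negPf B0) orbF subr_eq0.
  by move=> /eqP ->.
exists (q.[0]^-1 *: u), l, (- q.[0]^-1 *: horner_mx A s); split => //.
- by rewrite -scalemxAr Au scaler0.
- by rewrite -scalemxAr lu -scalemx1 scalerA mulVf // scale1r.
- rewrite -scalemxAl -defu defB scalerDr -[q.[0]%:M]scalemx1 scalerA mulVf //.
  by rewrite scale1r opprD addrCA subrr addr0 -scalemxAr scaleNr.
Qed.

(** * The Lie operator of a linear vector field *)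

Section LinearVectorField.
Variables (K : numFieldType) (n : nat).
Implicit Types (A : 'M[K]_n) (w : 'cV[K]_n) (G : mpoly n K).

Definition lin_form A (i : 'I_n) : mpoly n K :=
  \sum_(j < n) A i j *: mpolyX K (mnm1 j).

Definition Lie A G : mpoly n K := \sum_(i < n) mderiv i G * lin_form A i.

Definition dirder w G : mpoly n K := \sum_(i < n) w i 0 *: mderiv i G.

Lemma dhomog_coefP (d : nat) G :
  reflect (forall m, mcoeff m G != 0 -> mdeg m = d) (G \is ishomog1 d mdeg).
Proof.
apply: (iffP (dhomogP _ _ _)) => h m; first by rewrite -mcoeff_msupp => /h.
by rewrite mcoeff_msupp => /h.
Qed.

Lemma dhomog_mderiv (d : nat) (i : 'I_n) G :
  G \is ishomog1 d mdeg -> mderiv i G \is ishomog1 d.-1 mdeg.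
Proof.
move=> /dhomog_coefP hG; apply/dhomog_coefP => m.
rewrite mcoeff_mderiv mulrn_eq0 /= => /hG <-.
by rewrite mdegD mdeg1 addn1.
Qed.

Lemma dhomog_dirder (d : nat) w G :
  G \is ishomog1 d mdeg -> dirder w G \is ishomog1 d.-1 mdeg.
Proof.
by move=> hG; apply: rpred_sum => i _; apply/rpredZ/dhomog_mderiv.
Qed.

Lemma dhomog_lin_form A (i : 'I_n) : lin_form A i \is ishomog1 1 mdeg.
Proof.
by apply: rpred_sum => j _; apply/rpredZ; rewrite dhomogX; apply/eqP/mdeg1.
Qed.

Lemma mderiv_dhomog0 (i : 'I_n) G : G \is ishomog1 0 mdeg -> mderiv i G = 0.
Proof.
move=> /dhomog_coefP hG; apply/mpolyP => m; rewrite mcoeff_mderiv mcoeff0.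
apply/eqP; rewrite mulrn_eq0 /=; apply/contraT => /hG.
by rewrite mdegD mdeg1 addn1.
Qed.

Lemma dhomog_eq0 (d : nat) G : G \is ishomog1 d.+1 mdeg ->
  (forall i, mderiv i G = 0) -> G = 0.
Proof.
move=> /dhomog_coefP hG dG; apply/mpolyP => m; rewrite mcoeff0.
apply/eqP/contraT => Gm; have := hG _ Gm => dm.
have [i mi] : exists i, (0 < m i)%N.
  apply/existsP; apply: contraT; rewrite negb_exists => /forallP m0.
  by move: dm; rewrite mdegE big1 // => i _; apply/eqP; rewrite -leqn0 leqNgt.
have := congr1 (mcoeff (mnm_sub m (mnm1 i))) (dG i).
rewrite mcoeff_mderiv mcoeff0 submK; last by rewrite lep1mP -lt0n.
by move=> /eqP; rewrite mulrn_eq0 /= (negPf Gm).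
Qed.

Lemma dhomog_Lie (d : nat) A G :
  G \is ishomog1 d mdeg -> Lie A G \is ishomog1 d mdeg.
Proof.
case: d => [|d] hG.
  rewrite /Lie big1 ?rpred0 // => i _.
  by rewrite (mderiv_dhomog0 _ hG) mul0r.
apply: rpred_sum => i _; rewrite -addn1; apply: dhomogM.
  exact: (dhomog_mderiv i hG).
exact: dhomog_lin_form.
Qed.

Lemma mderiv_lin_form A (i k : 'I_n) : mderiv k (lin_form A i) = (A i k)%:A.
Proof.
rewrite /lin_form linear_sum /= (bigD1 k) //= big1 ?addr0 => [|j jk].
  rewrite mderivZ mderivX mnmE eqxx scale1r.
  by rewrite (_ : mnm_sub _ _ = mnm0) ?mpolyX0 //; apply/mnmP => l; rewrite mnmBE subnn mnm0E.
by rewrite mderivZ mderivX mnmE (negPf jk) scale0r scaler0.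
Qed.

Lemma Lie_is_linear A : linear (Lie A).
Proof.
move=> c p q; rewrite /Lie scaler_sumr -big_split /=; apply: eq_bigr => i _.
by rewrite mderivD mderivZ mulrDl scalerAl.
Qed.
HB.instance Definition _ A := GRing.isLinear.Build K _ _ _ _ (Lie_is_linear A).

Lemma dirder_is_linear w : linear (dirder w).
Proof.
move=> c p q; rewrite /dirder scaler_sumr -big_split /=; apply: eq_bigr => i _.
by rewrite mderivD mderivZ scalerDr !scalerA mulrC.
Qed.
HB.instance Definition _ w :=
  GRing.isLinear.Build K _ _ _ _ (dirder_is_linear w).

Lemma dirderDl w1 w2 G : dirder (w1 + w2) G = dirder w1 G + dirder w2 G.
Proof.
rewrite /dirder -big_split /=; apply: eq_bigr => i _.
by rewrite mxE scalerDl.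
Qed.

Lemma dirderZl c w G : dirder (c *: w) G = c *: dirder w G.
Proof.
rewrite /dirder scaler_sumr; apply: eq_bigr => i _.
by rewrite mxE scalerA.
Qed.

Lemma dirder_delta (i : 'I_n) G : dirder (delta_mx i 0) G = mderiv i G.
Proof.
rewrite /dirder (bigD1 i) //= big1 ?addr0 => [|j ji].
  by rewrite mxE !eqxx scale1r.
by rewrite mxE (negPf ji) scale0r.
Qed.

Lemma mderiv_dirder (i : 'I_n) w G :
  mderiv i (dirder w G) = dirder w (mderiv i G).
Proof.
rewrite /dirder linear_sum /=; apply: eq_bigr => j _.
by rewrite mderivZ mderiv_comm.
Qed.

Lemma dirder_comm w1 w2 G :
  dirder w1 (dirder w2 G) = dirder w2 (dirder w1 G).
Proof.
rewrite {1 4}/dirder linear_sum; apply: eq_bigr => i _ /=.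
by rewrite mderiv_dirder linearZ.
Qed.

(** The commutator of the constant field w with the linear field A x is the constant field A w. *)
Lemma dirder_Lie A w G :
  dirder w (Lie A G) = Lie A (dirder w G) + dirder (A *m w) G.
Proof.
have -> : Lie A (dirder w G) = \sum_(i < n) dirder w (mderiv i G) * lin_form A i.
  by apply: eq_bigr => i _; rewrite mderiv_dirder.
rewrite [dirder (_ *m _) _]/dirder -big_split {1}/Lie linear_sum /=.
apply: eq_bigr => i _.
have -> : (A *m w) i 0 *: mderiv i G =
          \sum_(k < n) w k 0 *: (mderiv i G * mderiv k (lin_form A i)).
  rewrite mxE scaler_suml; apply: eq_bigr => k _.
  by rewrite mderiv_lin_form -scalerAr mulr1 scalerA mulrC.
rewrite /dirder [X in _ = X + _]mulr_suml -big_split /=; apply: eq_bigr => k _.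
by rewrite mderivM scalerDr scalerAl.
Qed.

End LinearVectorField.

(** * Eigenvalues of the Lie operator on forms *)

Section Eigenvalues.
Variables (K : numFieldType) (n k : nat) (A : 'M[K]_n.+1) (lam : 'I_k -> K).
Implicit Types (w : 'cV[K]_n.+1) (G : mpoly n.+1 K).

(* The directions w with dirder w G = 0 form a subspace; multiplying by the
   factors of an annihilating polynomial one after the other, a direction
   enters it at some point. *)
Lemma dirder_eigenvector (r : seq 'I_k) w G :
  dirder w G != 0 ->
  dirder (horner_mx A (\prod_(j <- r) ('X - (lam j)%:P)) *m w) G = 0 ->
  exists2 j, j \in r &
    exists2 w', dirder w' G != 0 & dirder (A *m w') G = lam j *: dirder w' G.
Proof.
elim: r => [|j r IH] w0.
  by rewrite big_nil rmorph1 mul1mx => /eqP; rewrite (negPf w0).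
rewrite big_cons rmorphM /= -mulmxE -mulmxA.
set w1 := _ *m w in IH *.
have [w10 _|w10] := eqVneq (dirder w1 G) 0.
  have [i ri hi] := IH w0 w10.
  by exists i => //; rewrite inE ri orbT.
rewrite rmorphB /= horner_mx_X horner_mx_C mulmxBl mul_scalar_mx.
rewrite -scaleN1r dirderDl dirderZl dirderZl scaleN1r => /eqP.
rewrite subr_eq0 => /eqP h; exists j; first by rewrite mem_head.
by exists w1.
Qed.

(** Induction on the degree. Some derivative of G is nonzero, so there is a direction w that behaves
    under G like an eigenvector of A for some lam j; by the commutator rule [dirder w G] is an
    eigenform of degree d with the eigenvalue mu - lam j. *)
Lemma Lie_eigenvalue (d : nat) G (mu : K) :
  horner_mx A (\prod_(j < k) ('X - (lam j)%:P)) = 0 ->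
  G \is ishomog1 d mdeg -> G != 0 -> Lie A G = mu *: G ->
  exists m : 'I_k -> nat, mu = \sum_(j < k) (m j)%:R * lam j.
Proof.
move=> A0; elim: d G mu => [|d IH] G mu hG G0 LG.
  exists (fun=> 0%N); rewrite big1 => [|j _]; last by rewrite mul0r.
  move: LG; rewrite /Lie big1 => [/esym/eqP|i _].
    by rewrite scaler_eq0 (negPf G0) orbF => /eqP.
  by rewrite (mderiv_dhomog0 _ hG) mul0r.
have [i Gi] : exists i, mderiv i G != 0.
  apply/existsP; apply: contraT; rewrite negb_exists => /forallP h.
  by move: G0; rewrite (dhomog_eq0 hG) ?eqxx // => i; apply/eqP/negPn.
have [j _ [w wG Aw]] := @dirder_eigenvector (index_enum 'I_k) (delta_mx i 0) G
  ltac:(by rewrite dirder_delta) ltac:(by rewrite A0 mul0mx -(scale0r 0)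
    dirderZl scale0r).
have := congr1 (dirder w) LG; rewrite dirder_Lie linearZ /= Aw => LwG.
have [||m defm] := IH (dirder w G) (mu - lam j) _ wG.
- exact: (dhomog_dirder w hG).
- by rewrite scalerBl -LwG addrK.
exists (fun i => (i == j) + m i)%N.
rewrite (eq_bigr (fun i => (i == j)%:R * lam i + (m i)%:R * lam i)).
  rewrite big_split /= -defm (bigD1 j) //= eqxx mul1r big1 ?addr0 => [|i' ij].
    by rewrite addrC subrK.
  by rewrite (negPf ij) mul0r.
by move=> i' _; rewrite natrD mulrDl.
Qed.

End Eigenvalues.

Section ScalarExtension.
Variables (K L : numFieldType) (iota : {rmorphism K -> L}) (n : nat).
Implicit Types (A : 'M[K]_n) (w : 'cV[K]_n) (G : mpoly n K).

Lemma map_mpoly_mderiv (i : 'I_n) G :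
  map_mpoly iota (mderiv i G) = mderiv i (map_mpoly iota G).
Proof.
apply/mpolyP => m.
by rewrite mcoeff_map_mpoly !mcoeff_mderiv mcoeff_map_mpoly raddfMn.
Qed.

Lemma map_mpoly_scale (c : K) G :
  map_mpoly iota (c *: G) = iota c *: map_mpoly iota G.
Proof.
apply/mpolyP => m.
by rewrite mcoeff_map_mpoly !mcoeffZ mcoeff_map_mpoly /= rmorphM.
Qed.

Lemma map_mpoly_dirder w G :
  map_mpoly iota (dirder w G) = dirder (map_mx iota w) (map_mpoly iota G).
Proof.
rewrite /dirder rmorph_sum /=; apply: eq_bigr => i _.
by rewrite map_mpoly_scale map_mpoly_mderiv mxE.
Qed.

Lemma map_mpoly_Lie A G :
  map_mpoly iota (Lie A G) = Lie (map_mx iota A) (map_mpoly iota G).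
Proof.
rewrite /Lie rmorph_sum /=; apply: eq_bigr => i _.
rewrite rmorphM /= map_mpoly_mderiv; congr (_ * _).
rewrite /lin_form rmorph_sum /=; apply: eq_bigr => j _.
rewrite map_mpoly_scale mxE; congr (_ *: _).
by apply/mpolyP => m; rewrite mcoeff_map_mpoly !mcoeffX /= rmorph_nat.
Qed.

Lemma map_mpoly_eq0 G : map_mpoly iota G = 0 -> G = 0.
Proof.
move=> G0; apply/mpolyP => m; rewrite mcoeff0.
have := congr1 (mcoeff m) G0; rewrite mcoeff_map_mpoly mcoeff0 /=.
by move/eqP; rewrite fmorph_eq0 => /eqP.
Qed.

End ScalarExtension.

(** * Consequences of the spectral condition *)

Section Spectrum.
Variables (R : realType) (n : nat) (A : 'M[R]_n.+1).
Implicit Types (G : mpoly n.+1 R).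
Local Notation iota := (real_complex R : {rmorphism R -> complex R}).
Hypothesis spA : spectrum_condition A.

(** The condition with m concentrated at j gives lam j <> 0, so 0 is a simple root. The cofactor q
    is real because the root 0 is, although it splits only over the complex numbers. *)
Lemma spectrum_factor : exists (lam : 'I_n.+1 -> complex R) (q : {poly R}),
  [/\ char_poly A = 'X * q, q.[0] != 0,
      map_poly iota q = \prod_(j < n.+1 | j != ord0) ('X - (lam j)%:P),
      lam ord0 = 0 /\
      char_poly (map_mx iota A) = \prod_(j < n.+1) ('X - (lam j)%:P)
    & forall m : 'I_n.+1 -> nat,
        (1 <= \sum_(j < n.+1 | j != ord0) m j)%N ->
        \sum_(j < n.+1 | j != ord0) (m j)%:R * lam j != 0].
Proof.
have [lam [pA lam0 res]] := spA.
have pA' : map_poly iota (char_poly A) =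
    'X * \prod_(j < n.+1 | j != ord0) ('X - (lam j)%:P).
  by rewrite map_char_poly pA (bigD1 ord0) //= lam0 subr0.
have : root (char_poly A) 0.
  rewrite -(fmorph_root iota) pA' rmorph0 rootM; apply/orP; left.
  by rewrite rootE hornerX.
move/factor_theorem => [q]; rewrite subr0 mulrC => defq.
have mq : map_poly iota q = \prod_(j < n.+1 | j != ord0) ('X - (lam j)%:P).
  move: pA'; rewrite defq rmorphM /= map_polyX; apply: mulfI.
  by rewrite polyX_eq0.
exists lam, q; split => //.
rewrite -(fmorph_eq0 iota) -horner_map /= mq horner_prod rmorph0.
apply/prodf_neq0 => j j0; rewrite !hornerE oppr_eq0.
have := res (fun i => i == j : nat).
rewrite (bigD1 j) //= eqxx => /(_ isT).
rewrite (bigD1 j) //= eqxx mul1r big1 ?addr0 // => i /andP[_ /negPf ->].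
by rewrite mul0r.
Qed.

Lemma spectrum_splitting :
  exists (v : 'cV[R]_n.+1) (l : 'rV[R]_n.+1) (S : 'M[R]_n.+1),
    [/\ A *m v = 0, l *m A = 0, l *m v = 1%:M & 1%:M - v *m l = A *m S].
Proof.
by have [lam [q [defA q0 _ _ _]]] := spectrum_factor; exact: (kernel_splitting defA q0).
Qed.

(** A form in the kernel is constant along the range of A. Otherwise, because q(A) A = 0, the
    factors of q alone lead from A u to a direction w with a nonzero derivative and an eigenvalue
    lam j, j <> 0. Then [dirder w G] has the Lie eigenvalue - lam j, which is also a nonnegative
    combination of the eigenvalues; adding lam j yields a forbidden resonance. *)
Lemma Lie_kernel_range (d : nat) G (u : 'cV[R]_n.+1) :
  G \is ishomog1 d mdeg -> Lie A G = 0 -> dirder (A *m u) G = 0.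
Proof.
have [lam [q [defA q0 mq [lam0 pA] res]]] := spectrum_factor.
move=> hG LG; apply: (map_mpoly_eq0 (iota := iota)); rewrite map_mpoly_dirder.
set GC := map_mpoly iota G; set AC := map_mx iota A.
have hGC : GC \is ishomog1 d mdeg.
  apply/dhomog_coefP => m; rewrite mcoeff_map_mpoly /= fmorph_eq0.
  by move/dhomog_coefP: hG => hG /hG.
have LGC : Lie AC GC = 0 by rewrite -map_mpoly_Lie LG rmorph0.
apply/eqP; apply: contraT => w0.
pose r := [seq j <- index_enum 'I_n.+1 | j != ord0].
have [] := @dirder_eigenvector _ n n.+1 AC lam r _ _ w0.
  rewrite big_filter -mq /AC -map_horner_mx -map_mxM mulmxA.
  have -> : horner_mx A q *m A = 0.
    have := Cayley_Hamilton A; rewrite defA mulrC rmorphM /= horner_mx_X.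
    by rewrite mulmxE.
  by rewrite mul0mx map_mx0 -(scale0r 0) dirderZl scale0r.
move=> j; rewrite mem_filter => /andP[j0 _] [w wG Aw].
have := congr1 (dirder w) LGC; rewrite dirder_Lie linear0 Aw => /eqP.
rewrite addr_eq0 -scaleNr => /eqP LwG.
have AC0 : horner_mx AC (\prod_(j < n.+1) ('X - (lam j)%:P)) = 0.
  by rewrite -pA Cayley_Hamilton.
have [m] := Lie_eigenvalue AC0 (dhomog_dirder w hGC) wG LwG.
move=> /eqP; rewrite eq_sym -subr_eq0 opprK => /eqP hm.
have := res (fun i => (i == j) + m i)%N.
rewrite (bigD1 j) //= eqxx /= => /(_ isT).
rewrite (eq_bigr (fun i => (i == j)%:R * lam i + (m i)%:R * lam i)); last first.
  by move=> i _; rewrite natrD mulrDl.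
rewrite big_split /= (bigD1 j) //= eqxx mul1r big1 ?addr0 => [|i /andP[_ /negPf ->]]; last first.
  by rewrite mul0r.
rewrite -[X in _ + X]add0r -[X in _ + (X + _)](mulr0 (m ord0)%:R) -{1}lam0.
have -> : (m ord0)%:R * lam ord0 + \sum_(i < n.+1 | i != ord0) (m i)%:R * lam i = \sum_(i < n.+1) (m i)%:R * lam i.
  by rewrite [RHS](bigD1 ord0).
by rewrite addrC hm eqxx.
Qed.

End Spectrum.

Section PolynomialEvaluation.
Variables (K : numFieldType) (n : nat).
Implicit Types (G p q : mpoly n K) (x : 'cV[K]_n).

Definition peval p x : K := meval (fun i => x i 0) p.

Lemma pevalD p q x : peval (p + q) x = peval p x + peval q x.
Proof. exact: mevalD. Qed.

Lemma pevalZ c p x : peval (c *: p) x = c * peval p x.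
Proof. exact: mevalZ. Qed.

Lemma pevalM p q x : peval (p * q) x = peval p x * peval q x.
Proof. exact: mevalM. Qed.

Lemma peval_sum (I : Type) (r : seq I) (P : pred I) (F : I -> mpoly n K) x :
  peval (\sum_(i <- r | P i) F i) x = \sum_(i <- r | P i) peval (F i) x.
Proof. exact: (raddf_sum (meval (fun i => x i 0))). Qed.

Lemma peval0 x : peval 0 x = 0.
Proof. exact: meval0. Qed.

Lemma pevalXU (i : 'I_n) x : peval (mpolyX K (mnm1 i)) x = x i 0.
Proof. exact: mevalXU. Qed.

Lemma peval_lin_form (A : 'M[K]_n) (i : 'I_n) x :
  peval (lin_form A i) x = (A *m x) i 0.
Proof.
by rewrite mxE peval_sum; apply: eq_bigr => j _; rewrite pevalZ pevalXU.
Qed.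

Lemma peval_dirder w G x :
  peval (dirder w G) x = \sum_(i < n) w i 0 * peval (mderiv i G) x.
Proof. by rewrite peval_sum; apply: eq_bigr => i _; rewrite pevalZ. Qed.

Lemma peval_Lie (A : 'M[K]_n) G x :
  peval (Lie A G) x = peval (dirder (A *m x) G) x.
Proof.
rewrite peval_sum peval_dirder; apply: eq_bigr => i _.
by rewrite pevalM peval_lin_form mulrC.
Qed.

Lemma peval_homog (d : nat) G (t : K) x :
  G \is ishomog1 d mdeg -> peval G (t *: x) = t ^+ d * peval G x.
Proof.
move=> /dhomogP hG; rewrite /peval !mevalE mulr_sumr.
apply: eq_big_seq => m /hG <-; rewrite mulrCA; congr (_ * _).
rewrite (eq_bigr (fun i => t ^+ m i * x i 0 ^+ m i)) => [|i _].
  by rewrite big_split /= mdegE expr_sum.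
by rewrite mxE exprMn.
Qed.

Lemma euler_homog (d : nat) G :
  G \is ishomog1 d mdeg ->
  \sum_(i < n) mpolyX K (mnm1 i) * mderiv i G = d%:R *: G.
Proof.
move=> /dhomogP hG; rewrite {2}[G]mpolyE scaler_sumr.
rewrite (eq_bigr (fun i => \sum_(m <- msupp G)
   (mcoeff m G * (m i)%:R) *: mpolyX K m)); last first.
  move=> i _; rewrite {1}[G]mpolyE linear_sum mulr_sumr; apply: eq_bigr => m _.
  rewrite linearZ /= mderivX scalerA -scalerAr -mpolyXD.
  have [->|mi] := eqVneq (m i) 0%N; first by rewrite mulr0 !scale0r.
  by congr (_ *: mpolyX K _); rewrite -[RHS](@submK _ (mnm1 i)) ?lep1mP // addmC.
rewrite exchange_big /=; apply: eq_big_seq => m /hG <-.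
by rewrite -scaler_suml -mulr_sumr -natr_sum -mdegE scalerA mulrC.
Qed.

Lemma peval_euler (d : nat) G x :
  G \is ishomog1 d mdeg -> peval (dirder x G) x = d%:R * peval G x.
Proof.
move=> /euler_homog/(congr1 (fun p => peval p x)); rewrite pevalZ peval_sum => <-.
rewrite peval_dirder; apply: eq_bigr => i _.
by rewrite pevalM pevalXU.
Qed.

Lemma dhomog0_peval_eq0 G x :
  G \is ishomog1 0 mdeg -> peval G x = 0 -> G = 0.
Proof.
move=> /dhomog_coefP hG.
have -> : G = mpolyC n (mcoeff mnm0 G).
  apply/mpolyP => m; rewrite mcoeffC; case: eqVneq => [<-|m0].
    by rewrite mulr1.
  rewrite mulr0; apply/eqP; apply: contraT => /hG/eqP.
  by rewrite mdeg_eq0 (negPf m0).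
by rewrite /peval mevalC => ->; rewrite mpolyC0.
Qed.

Lemma peval_Lie_ker (A : 'M[K]_n) G x : A *m x = 0 -> peval (Lie A G) x = 0.
Proof.
by move=> Ax; rewrite peval_Lie Ax /dirder big1 ?peval0 // => i _; rewrite mxE scale0r.
Qed.

End PolynomialEvaluation.

(** * Solving the homological equation on forms *)

Section SolvingLie.
Variables (R : realType) (n : nat) (A : 'M[R]_n.+1).
Variables (v : 'cV[R]_n.+1) (l : 'rV[R]_n.+1) (S : 'M[R]_n.+1).
Hypothesis spA : spectrum_condition A.
Hypothesis Av : A *m v = 0.
Hypothesis lv : l *m v = 1%:M.
Hypothesis vlAS : 1%:M - v *m l = A *m S.
Implicit Types (G Q : mpoly n.+1 R).

(** G is constant along the range of A, so only its derivative along v matters. That derivative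
    satisfies the same hypotheses in degree d - 1, its value at v being d G(v) by Euler's
    identity. *)
Lemma Lie_eq0 (d : nat) G :
  G \is ishomog1 d mdeg -> Lie A G = 0 -> peval G v = 0 -> G = 0.
Proof.
move=> hG LG.
have {LG} : forall u, dirder (A *m u) G = 0.
  by move=> u; exact: (Lie_kernel_range spA u hG LG).
elim: d G hG => [|d IH] G hG AG Gv; first exact: (dhomog0_peval_eq0 hG Gv).
have vG : dirder v G = 0.
  apply: IH; first exact: (dhomog_dirder v hG).
    by move=> u; rewrite dirder_comm AG linear0.
  by rewrite (peval_euler _ hG) Gv mulr0.
apply: (dhomog_eq0 hG) => i; rewrite -dirder_delta.
set w := delta_mx i 0.
have -> : w = A *m (S *m w) + v *m (l *m w).
  by rewrite !mulmxA -mulmxDl -vlAS subrK mul1mx.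
by rewrite dirderDl AG add0r [l *m _]mx11_scalar mul_mx_scalar dirderZl vG scaler0.
Qed.

Definition lpow (d : nat) : mpoly n.+1 R :=
  (\sum_(j < n.+1) l 0 j *: mpolyX R (mnm1 j)) ^+ d.

Lemma dhomog_lpow (d : nat) : lpow d \is ishomog1 d mdeg.
Proof.
rewrite /lpow -[d in ishomog1 d]mul1n; apply: dhomogMn.
apply: rpred_sum => j _; apply: rpredZ; rewrite dhomogX; exact/eqP/mdeg1.
Qed.

Lemma peval_lpow (d : nat) x : peval (lpow d) x = ((l *m x) 0 0) ^+ d.
Proof.
rewrite /peval rmorphXn /=; congr (_ ^+ d).
rewrite -/(peval _ x) peval_sum mxE; apply: eq_bigr => j _.
by rewrite pevalZ pevalXU.
Qed.

(** Adding the rank one term G(v) l^d to the Lie operator makes it injective, hence bijective on the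
    finite-dimensional space of forms. As A v = 0, Lie derivatives vanish at v; so the preimage G of
    Q has G(v) = Q(v) = 0 and the added term disappears. *)
Lemma Lie_solve (d : nat) Q :
  Q \is ishomog1 d mdeg -> peval Q v = 0 ->
  exists2 G, G \is ishomog1 d mdeg & Lie A G = Q.
Proof.
move=> hQ Qv.
pose V := dhomog n.+1 R d.
have hT (G : V) :
    Lie A (mpoly_of_dhomog G) + peval (mpoly_of_dhomog G) v *: lpow d
    \is ishomog1 d mdeg.
  apply: rpredD; first exact/dhomog_Lie/dhomog_is_dhomog.
  exact/rpredZ/dhomog_lpow.
pose T (G : V) : V := DHomog (hT G).
have linT : linear T.
  move=> c p q; apply: val_inj; rewrite /= !linearP /= pevalD pevalZ.
  by rewrite scalerDl !scalerDr !scalerA addrACA.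
pose Tl := GRing.isLinear.Build R V V *:%R T linT.
pose T' : {linear V -> V} := HB.pack T Tl.
have lv1 : peval (lpow d) v = 1.
  by rewrite peval_lpow lv mxE eqxx expr1n.
have Tv (G : V) : T G = 0 -> peval (mpoly_of_dhomog G) v = 0.
  move=> /(congr1 (@mpoly_of_dhomog _ _ _))/(congr1 (fun p => peval p v)) /=.
  by rewrite pevalD pevalZ lv1 mulr1 peval_Lie_ker // add0r peval0.
have kT : lker (linfun T') == 0%VS.
  apply/lker0P => p q; rewrite !lfunE /= => /eqP; rewrite -subr_eq0 => /eqP pq.
  have : T (p - q) = 0 by rewrite -[T]/(T' : _ -> _) linearB.
  move=> TG; apply/eqP; rewrite -subr_eq0; apply/eqP/val_inj => /=.
  have Gv := Tv _ TG; apply: (@Lie_eq0 d) => //.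
    exact: (dhomog_is_dhomog (p - q)).
  by have := congr1 (@mpoly_of_dhomog _ _ _) TG; rewrite /= Gv scale0r addr0.
have fT : limg (linfun T') = fullv.
  apply/eqP; rewrite -dimv_leqif_eq ?subvf //.
  by rewrite limg_dim_eq // (eqP kT) capv0.
have /memv_imgP[G _ defQ] : DHomog hQ \in limg (linfun T') by rewrite fT memvf.
exists (mpoly_of_dhomog G); first exact: dhomog_is_dhomog.
move: defQ; rewrite lfunE /= => /(congr1 (@mpoly_of_dhomog _ _ _)) /= defQ.
move: Qv; rewrite {1}defQ pevalD pevalZ lv1 mulr1 peval_Lie_ker // add0r => Gv.
by rewrite defQ Gv scale0r addr0.
Qed.

End SolvingLie.

(** * Differential calculus *)

Section Norms.
Variables (R : realType) (n : nat).
Implicit Types (x y : 'cV[R]_n).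

Lemma coord_le_norm x (i : 'I_n) : `|x i 0| <= `|x|.
Proof.
have -> : `|x| = mx_norm x by [].
rewrite mx_normrE.
exact: (le_bigmax_cond _ (fun ij : 'I_n * 'I_1 => `|x ij.1 ij.2|) (j := (i, 0))).
Qed.

Lemma norm_le_coord x (r : R) :
  0 <= r -> (forall i, `|x i 0| <= r) -> `|x| <= r.
Proof.
move=> r0 h; have -> : `|x| = mx_norm x by [].
rewrite mx_normrE.
by apply/bigmax_leP; split => // -[i j] _; rewrite /= (ord1 j).
Qed.

Lemma norm_delta_le (i : 'I_n) : `|delta_mx i 0 : 'cV[R]_n| <= 1.
Proof.
apply: norm_le_coord => // j; rewrite mxE andbT.
by case: eqP => _; rewrite ?normr1 ?normr0.
Qed.

End Norms.

Section MeanValue.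
Variables (R : realType) (n : nat).
Implicit Types (g : 'cV[R]_n -> R) (x y v : 'cV[R]_n).

Lemma is_derive_line g x v (t : R) : derivable g (x + t *: v) v ->
  is_derive t 1 (fun s => g (x + s *: v)) ('D_v g (x + t *: v)).
Proof.
move=> dg.
have E : (fun h : R => h^-1 *: (g (x + (h *: 1 + t) *: v) - g (x + t *: v))) =
         (fun h : R => h^-1 *: (g (h *: v + (x + t *: v)) - g (x + t *: v))).
  apply/funext => h; congr (_ *: (g _ - _)).
  by rewrite scalerDl [h *: 1]mulr1 addrCA.
split; first by rewrite /derivable /= E.
by rewrite /derive /= E.
Qed.

Lemma line_MVT g x v (a : R) :
  (forall t, t \in `[Num.min 0 a, Num.max 0 a] -> derivable g (x + t *: v) v) ->
  exists2 t, t \in `[Num.min 0 a, Num.max 0 a] &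
    g (x + a *: v) - g x = a * 'D_v g (x + t *: v).
Proof.
move=> dg; pose f (s : R) : R := g (x + s *: v).
pose df (t : R) : R := 'D_v g (x + t *: v).
have mvt (b c : R) : b <= c ->
    (forall t : R, t \in `[b, c] -> derivable g (x + t *: v) v) ->
    exists2 t, t \in `[b, c] & f c - f b = df t * (c - b).
  move=> bc dbc.
  have der t : t \in `[b, c] -> is_derive t 1 f (df t).
    by move=> /dbc; exact: is_derive_line.
  have der' t : t \in `]b, c[ -> is_derive t 1 f (df t).
    by move=> tbc; apply: der; exact: subset_itv_oo_cc tbc.
  have := MVT_segment bc der'; apply.
  by apply: derivable_within_continuous => t /der [].
move: dg; have [a0|/ltW a0] := leP 0 a => dg.
  have [t ht] := mvt _ _ a0 dg.
  by rewrite /f scale0r addr0 subr0 mulrC => E; exists t.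
have [t ht] := mvt _ _ a0 dg.
rewrite /f scale0r addr0 sub0r => E.
by exists t; rewrite // -opprB E mulrN opprK mulrC.
Qed.

(** Balls of the sup norm are boxes: replacing the coordinates of y by those of x one at a time
    never leaves the ball, and each replacement is an instance of the mean value theorem along an
    axis. Only partial derivatives are involved. *)
Lemma box_lipschitz g (r K : R) x y :
  (forall z i, `|z| <= r ->
     derivable g z (delta_mx i 0) /\ `|partial i g z| <= K) ->
  `|x| <= r -> `|y| <= r -> `|g x - g y| <= n%:R * K * `|x - y|.
Proof.
move=> dg xr yr.
have r0 : 0 <= r by exact: le_trans xr.
pose z k : 'cV[R]_n := \col_i (if (i < k)%N then x i 0 else y i 0).
have z0 : z 0%N = y by apply/matrixP => i j; rewrite mxE (ord1 j).
have zn : z n = x by apply/matrixP => i j; rewrite mxE ltn_ord (ord1 j).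
have zS (k : 'I_n) : z k.+1 = z k + (x k 0 - y k 0) *: delta_mx k 0.
  apply/matrixP => i j; rewrite !mxE (ord1 j) andbT ltnS leq_eqVlt -val_eqE.
  by case: eqVneq => [/val_inj ->|_] /=; rewrite ?ltnn ?mulr1 ?mulr0 ?addr0 // addrC subrK.
have zr (k : 'I_n) (t : R) :
    t \in `[Num.min 0 (x k 0 - y k 0), Num.max 0 (x k 0 - y k 0)] ->
    `|z k + t *: delta_mx k 0| <= r.
  move=> ht; apply: norm_le_coord => // i.
  have xi := le_trans (coord_le_norm x i) xr.
  have yi := le_trans (coord_le_norm y i) yr.
  rewrite !mxE andbT; have [ik|ik] := eqVneq i k; last first.
    by rewrite mulr0 addr0; case: ifP.
  move: ht xi yi; rewrite ik ltnn mulr1 in_itv /= ge_min le_max !ler_norml.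
  by move=> /andP[/orP[] ? /orP[] ?] /andP[? ?] /andP[? ?]; apply/andP; split; lra.
have -> : g x - g y = \sum_(k < n) (g (z k.+1) - g (z k)).
  by rewrite -(big_mkord xpredT (fun k => g (z k.+1) - g (z k))) telescope_sumr // zn z0.
apply: (le_trans (ler_norm_sum _ _ _)).
rewrite -mulrA mulr_natl -[X in _ *+ X]card_ord -sumr_const; apply: ler_sum => k _.
have [|t ht] := @line_MVT g (z k) (delta_mx k 0) (x k 0 - y k 0).
  by move=> t ht; apply: (dg _ _ _).1; exact: zr.
rewrite -zS => ->; rewrite normrM mulrC; apply: ler_pM => //.
  by apply: (dg _ _ _).2; exact: zr.
by have := coord_le_norm (x - y) k; rewrite !mxE.
Qed.
End MeanValue.

Lemma mpoly_ring_ind (K : nzRingType) (n : nat) (P : mpoly n K -> Prop) :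
  (forall c, P (mpolyC n c)) -> (forall i, P (mpolyX K (mnm1 i))) ->
  (forall p q, P p -> P q -> P (p + q)) ->
  (forall p q, P p -> P q -> P (p * q)) -> forall p, P p.
Proof.
move=> PC PX PD PM p; have P1 : P 1 by rewrite -mpolyC1; exact: PC.
have P0 : P 0 by rewrite -mpolyC0; exact: PC.
rewrite [p]mpolyE; apply: (big_ind P) => // m _.
rewrite -mul_mpolyC; apply: (PM) => //.
have PXn i : P (mpolyX K (mnm1 i) ^+ m i).
  by elim: (m i) => [|k IH]; rewrite ?expr0 // exprS; apply: PM.
by rewrite mpolyXE_id; elim/big_ind: _.
Qed.

(** * Polynomials as smooth functions *)

Section PevalCalculus.
Variables (R : realType) (n : nat).
Implicit Types (p : mpoly n R) (x : 'cV[R]_n).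

Lemma is_derive_peval p x (i : 'I_n) :
  is_derive x (delta_mx i 0) (peval p) (peval (mderiv i p) x).
Proof.
elim/mpoly_ring_ind: p.
- move=> c; rewrite mderivC peval0.
  have -> : peval (mpolyC n c) = cst c by apply/funext => y; rewrite /peval mevalC.
  exact: is_derive_cst.
- move=> j; have -> : peval (mpolyX R (mnm1 j)) = fun y => y j 0.
    by apply/funext => y; rewrite pevalXU.
  rewrite mderivX mnmE pevalZ.
  have -> : (j == i)%:R * peval (mpolyX R (mnm_sub (mnm1 j) (mnm1 i))) x =
            (delta_mx i 0 : 'cV[R]_n) j 0.
    rewrite mxE andbT; case: eqVneq => [->|_]; last by rewrite mul0r.
    rewrite (_ : mnm_sub _ _ = mnm0) ?mpolyX0 ?/peval ?meval1 ?mulr1 //.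
    by apply/mnmP => k; rewrite mnmBE subnn mnm0E.
  have E : \forall h \near 0^', h^-1 *: ((h *: (delta_mx i 0 : 'cV[R]_n) + x) j 0 - x j 0)
        = (delta_mx i 0 : 'cV[R]_n) j 0.
    near=> h; rewrite !mxE addrK [_ *: _]mulrA mulVf ?mul1r //.
    by near: h; exact: nbhs_dnbhs_neq.
  have C := @cvg_near_cst _ _ ((delta_mx i 0 : 'cV[R]_n) j 0 : R) _ _ _ E.
  have {}C := C ltac:(exact _).
  split; first by apply/cvg_ex; eexists; exact: C.
  by rewrite /derive; apply: cvg_lim.
- move=> p q dp dq; rewrite mderivD pevalD.
  have -> : peval (p + q) = peval p + peval q.
    by apply/funext => y; rewrite pevalD.
  exact: is_deriveD.
- move=> p q dp dq; rewrite mderivM pevalD !pevalM.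
  have -> : peval (p * q) = peval p * peval q.
    by apply/funext => y; rewrite pevalM.
  have D := is_deriveM dp dq.
  by apply: (is_derive_eq D); rewrite addrC; congr (_ + _); exact: mulrC.
Unshelve. all: by end_near.
Qed.

Lemma continuous_peval p : continuous (peval p).
Proof.
elim/mpoly_ring_ind: p.
- move=> c; have -> : peval (mpolyC n c) = cst c by apply/funext => y; rewrite /peval mevalC.
  exact: cst_continuous.
- move=> j; have -> : peval (mpolyX R (mnm1 j)) = fun y => y j 0.
    by apply/funext => y; rewrite pevalXU.
  exact: coord_continuous.
- move=> p q cp cq; have -> : peval (p + q) = peval p \+ peval q.
    by apply/funext => y; rewrite pevalD.
  by move=> x; apply: continuousD; [exact: cp|exact: cq].
- move=> p q cp cq; have -> : peval (p * q) = peval p \* peval q.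
    by apply/funext => y; rewrite pevalM.
  by move=> x; apply: continuousM; [exact: cp|exact: cq].
Qed.

Lemma derivable_peval p x (i : 'I_n) : derivable (peval p) x (delta_mx i 0).
Proof. by have [] := is_derive_peval p x i. Qed.

Lemma partial_peval (i : 'I_n) p : partial i (peval p) = peval (mderiv i p).
Proof.
by apply/funext => x; rewrite /partial; have := is_derive_peval p x i => -[].
Qed.

Lemma iter_partial_peval (s : seq 'I_n) p :
  iter_partial s (peval p) = peval (foldr (@mderiv n R) p s).
Proof. by elim: s => //= i s ->; exact: partial_peval. Qed.

Lemma smooth_on_peval (U : set 'cV[R]_n) p : smooth_on U (peval p).
Proof.
move=> s x _; rewrite iter_partial_peval; split; first exact: continuous_peval.
by move=> i; exact: derivable_peval.
Qed.

Lemma peval_at0 p : peval p 0 = mcoeff mnm0 p.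
Proof.
elim/mpoly_ring_ind: p => [c|i|p q IHp IHq|p q IHp IHq].
- by rewrite /peval mevalC mcoeffC eqxx mulr1.
- by rewrite pevalXU mxE mcoeffX mnm1_eq0.
- by rewrite pevalD mcoeffD IHp IHq.
- by rewrite pevalM IHp IHq (rmorphM (mcoeff mnm0)).
Qed.

Lemma taylor_coef_peval p (m : multinom n) :
  taylor_coef (peval p) m = mcoeff m p.
Proof.
rewrite /taylor_coef iter_partial_peval -mderivm_foldr peval_at0.
rewrite mcoeff_mderivm addm0 -mulr_natr (natr_prod R).
rewrite (eq_bigr (fun i => (m i)`!%:R)) => [|i _]; last by rewrite ffactnn.
rewrite mulfK //; apply/prodf_neq0 => i _.
by rewrite pnatr_eq0 -lt0n fact_gt0.
Qed.

End PevalCalculus.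

(** * Smooth functions and the symmetry of partial derivatives *)

Section SmoothFunctions.
Variables (R : realType) (n : nat).
Implicit Types (f g : 'cV[R]_n -> R) (x y c v : 'cV[R]_n) (U : set 'cV[R]_n).
Implicit Types (i j : 'I_n) (s t : seq 'I_n).

Lemma shift_quotient g c x v :
  (fun h : R => h^-1 *: (g (h *: v + x + c) - g (x + c))) =
  (fun h : R => h^-1 *: (g (h *: v + (x + c)) - g (x + c))).
Proof. by apply/funext => h; rewrite addrA. Qed.

Lemma derive_shift g c x v : 'D_v (fun y => g (y + c)) x = 'D_v g (x + c).
Proof. by rewrite /derive /= shift_quotient. Qed.

Lemma derivable_shift g c x v :
  derivable g (x + c) v -> derivable (fun y => g (y + c)) x v.
Proof. by rewrite /derivable /= shift_quotient. Qed.

Lemma derivable_near_eq f g x v :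
  (\forall y \near x, f y = g y) -> derivable f x v -> derivable g x v.
Proof.
move=> fg df; have D := near_eq_is_derive fg (DeriveDef df erefl).
by case: D.
Qed.

Lemma iter_partial_eq U f g s : open U -> (forall x, U x -> f x = g x) ->
  forall x, U x -> iter_partial s f x = iter_partial s g x.
Proof.
move=> oU fg; elim: s => //= i s IH x Ux.
apply: near_eq_derive; near=> y; apply: IH.
by near: y; exact: open_nbhs_nbhs.
Unshelve. all: by end_near.
Qed.

Lemma smooth_on_derivable U g x i :
  smooth_on U g -> U x -> derivable g x (delta_mx i 0).
Proof. by move=> /(_ [::]) sg /sg [_]; exact. Qed.

Lemma smooth_on_continuous U g x :
  smooth_on U g -> U x -> {for x, continuous g}.
Proof. by move=> /(_ [::]) sg /sg []. Qed.

Lemma smooth_on_partial U g i : smooth_on U g -> smooth_on U (partial i g).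
Proof.
move=> sg s x Ux; have := sg (rcons s i) x Ux.
by rewrite /iter_partial foldr_rcons.
Qed.

Lemma smooth_on_iter_partial U g s :
  smooth_on U g -> smooth_on U (iter_partial s g).
Proof. by move=> sg; elim: s => [|i s IH]; [exact: sg|exact: smooth_on_partial]. Qed.

Lemma iter_partialB U f g s : open U -> smooth_on U f -> smooth_on U g ->
  forall x, U x ->
    iter_partial s (fun y => f y - g y) x = iter_partial s f x - iter_partial s g x.
Proof.
move=> oU sf sg; elim: s => //= i s IH x Ux.
rewrite /partial; transitivity ('D_(delta_mx i 0) (iter_partial s f - iter_partial s g) x).
  apply: near_eq_derive; near=> y; apply: IH.
  by near: y; exact: open_nbhs_nbhs.
by rewrite deriveB //; [have [_] := sf s x Ux|have [_] := sg s x Ux]; exact.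
Unshelve. all: by end_near.
Qed.

Lemma smooth_onB U f g : open U -> smooth_on U f -> smooth_on U g ->
  smooth_on U (fun y => f y - g y).
Proof.
move=> oU sf sg s x Ux.
have E : \forall y \near x, (iter_partial s f - iter_partial s g) y =
    iter_partial s (fun y => f y - g y) y.
  near=> y; rewrite (iter_partialB _ oU sf sg) //.
  by near: y; exact: open_nbhs_nbhs.
have [cf df] := sf s x Ux; have [cg dg] := sg s x Ux.
split; last by move=> i; apply: (derivable_near_eq E); exact: derivableB.
have C : (iter_partial s f \- iter_partial s g) y @[y --> x] -->
    (iter_partial s f \- iter_partial s g) x by exact: (cvgB cf cg).
rewrite /prop_for /continuous_at (iter_partialB _ oU sf sg) //.
exact: cvg_trans (near_eq_cvg E) C.
Unshelve. all: by end_near.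
Qed.

(** The second difference over a square of side h: the mean value theorem along i, applied to the
    increment of g along j, and then along j, applied to [partial i g]. *)
Lemma schwarz_point g x (h : R) i j :
  0 <= h ->
  (forall y, `|y - x| <= h *+ 2 -> derivable g y (delta_mx i 0) /\
     derivable (partial i g) y (delta_mx j 0)) ->
  exists2 y, `|y - x| <= h *+ 2 &
    g (x + h *: delta_mx i 0 + h *: delta_mx j 0) - g (x + h *: delta_mx i 0)
      - g (x + h *: delta_mx j 0) + g x
    = h * (h * partial j (partial i g) y).
Proof.
move=> h0 dg.
have hh : (Num.min 0 h = 0) * (Num.max 0 h = h) by rewrite (min_idPl h0) (max_idPr h0).
have near_x (a b : R) : a \in `[0, h] -> b \in `[0, h] ->
    `|x + a *: delta_mx i 0 + b *: delta_mx j 0 - x| <= h *+ 2.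
  rewrite !in_itv /= => /andP[a0 ah] /andP[b0 bh].
  have -> : x + a *: delta_mx i 0 + b *: delta_mx j 0 - x =
      a *: delta_mx i 0 + b *: delta_mx j 0 by rewrite addrAC [x + _]addrC addrK.
  rewrite mulr2n; apply: (le_trans (ler_normD _ _)).
  by apply: lerD; rewrite normrZ ger0_norm // -[leRHS]mulr1; apply: ler_pM => //;
    exact: norm_delta_le.
have h00 : 0 \in `[0, h] by rewrite in_itv /= lexx.
have hhh : h \in `[0, h] by rewrite in_itv /= lexx andbT.
pose G y := g (y + h *: delta_mx j 0) - g y.
have dG a : a \in `[0, h] -> is_derive (x + a *: delta_mx i 0) (delta_mx i 0) G
   (partial i g (x + a *: delta_mx i 0 + h *: delta_mx j 0) -
    partial i g (x + a *: delta_mx i 0)).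
  move=> ha; have d1 := (dg _ (near_x _ _ ha hhh)).1.
  have d2 := (dg _ (near_x _ _ ha h00)).1.
  rewrite scale0r addr0 in d2.
  apply: is_deriveB; last exact: (DeriveDef d2 erefl).
  exact: (DeriveDef (derivable_shift d1) (derive_shift _ _ _ _)).
have [|a] := @line_MVT R n G x (delta_mx i 0) h; rewrite !hh.
  by move=> a /dG [].
move=> ha; have [_ ->] := dG _ ha.
have [|b] := @line_MVT R n (partial i g) (x + a *: delta_mx i 0) (delta_mx j 0) h; rewrite !hh.
  by move=> b hb; exact: (dg _ (near_x _ _ ha hb)).2.
move=> hb -> E; exists (x + a *: delta_mx i 0 + b *: delta_mx j 0).
  exact: near_x.
transitivity (G (x + h *: delta_mx i 0) - G x); last by rewrite E.
by rewrite /G opprB addrA addrAC.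
Qed.

Lemma close_eq (h e a b c d : R) : 0 < h -> h * (h * c) = h * (h * d) ->
  `|a - c| <= e / 2 -> `|b - d| <= e / 2 -> `|a - b| <= e.
Proof.
move=> h0 /(mulfI (lt0r_neq0 h0))/(mulfI (lt0r_neq0 h0)) ->.
rewrite !ler_norml => /andP[? ?] /andP[? ?]; apply/andP; split; lra.
Qed.

(** The second difference is symmetric in i and j, so the two mixed derivatives agree at two points
    close to x, and both are continuous at x. *)
Lemma schwarz U g x i j : open U -> smooth_on U g -> U x ->
  partial i (partial j g) x = partial j (partial i g) x.
Proof.
move=> oU sg Ux; apply/eqP; rewrite -subr_eq0 -normr_le0; apply/ler_addgt0Pl => e e0.
rewrite addr0.
have cij := (smooth_on_partial i (smooth_on_partial j sg)).
have cji := (smooth_on_partial j (smooth_on_partial i sg)).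
have e2 : 0 < e / 2 by rewrite divr_gt0.
have Cij : \forall y \near x, `|partial i (partial j g) x - partial i (partial j g) y| <= e / 2.
  exact: (@cvgr_dist_le _ _ _ _ _ _ _ (smooth_on_continuous cij Ux) _ e2).
have Cji : \forall y \near x, `|partial j (partial i g) x - partial j (partial i g) y| <= e / 2.
  exact: (@cvgr_dist_le _ _ _ _ _ _ _ (smooth_on_continuous cji Ux) _ e2).
have CU : \forall y \near x, U y by exact: open_nbhs_nbhs.
have /nbhs_ballP [r r0 hr] : \forall y \near x, [/\ U y,
   `|partial i (partial j g) x - partial i (partial j g) y| <= e / 2 &
   `|partial j (partial i g) x - partial j (partial i g) y| <= e / 2].
  by apply: filterS3 CU Cij Cji => y; split.
(* The points given by [schwarz_point] are within 2 h of x, hence inside the open ball of radius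
   r. *)
pose h := r / 3.
have h0 : 0 < h by rewrite divr_gt0.
have hin y : `|y - x| <= h *+ 2 -> [/\ U y,
   `|partial i (partial j g) x - partial i (partial j g) y| <= e / 2 &
   `|partial j (partial i g) x - partial j (partial i g) y| <= e / 2].
  move=> yx; apply: hr; rewrite -ball_normE /ball_ /= distrC.
  by apply: (le_lt_trans yx); rewrite /h; move: r0 => /=; lra.
have [|y1 /hin [_ h1 _] E1] := @schwarz_point g x h j i (ltW h0).
  move=> y /hin [Uy _ _]; split; first exact: (@smooth_on_derivable U _ y _ sg Uy).
  exact: (@smooth_on_derivable U _ y _ (smooth_on_partial _ sg) Uy).
have [|y2 /hin [_ _ h2] E2] := @schwarz_point g x h i j (ltW h0).
  move=> y /hin [Uy _ _]; split; first exact: (@smooth_on_derivable U _ y _ sg Uy).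
  exact: (@smooth_on_derivable U _ y _ (smooth_on_partial _ sg) Uy).
have E0 : g (x + h *: delta_mx j 0 + h *: delta_mx i 0)
      - g (x + h *: delta_mx j 0) - g (x + h *: delta_mx i 0) + g x =
    g (x + h *: delta_mx i 0 + h *: delta_mx j 0)
      - g (x + h *: delta_mx i 0) - g (x + h *: delta_mx j 0) + g x.
  have -> : x + h *: delta_mx j 0 + h *: delta_mx i 0 =
      x + h *: delta_mx i 0 + h *: delta_mx j 0 by exact: addrAC.
  by congr (_ + g x); exact: addrAC.
exact: (close_eq h0 (etrans (esym E1) (etrans E0 E2)) h1 h2).
Unshelve. all: by end_near.
Qed.

Lemma iter_partial_rot U g s t i x : open U -> smooth_on U g -> U x ->
  iter_partial (s ++ i :: t) g x = iter_partial (i :: s ++ t) g x.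
Proof.
move=> oU sg; elim: s x => [|j s IH] x Ux //=.
rewrite (schwarz i j oU (smooth_on_iter_partial _ sg) Ux).
exact: (@iter_partial_eq U _ _ [:: j] oU IH).
Qed.

Lemma iter_partial_perm U g s t x : open U -> smooth_on U g -> U x ->
  perm_eq s t -> iter_partial s g x = iter_partial t g x.
Proof.
move=> oU sg; elim: s t x => [|i s IH] t x Ux st.
  by move: st => /perm_size/esym/size0nil ->.
have it : i \in t by rewrite -(perm_mem st) mem_head.
case/splitPr: it st => t1 t2.
rewrite perm_sym -[i :: t2]cat1s perm_catCA /= perm_cons perm_sym => st.
rewrite (iter_partial_rot _ _ _ oU sg Ux).
by apply: (@iter_partial_eq U _ _ [:: i] oU) => // y Uy; exact: IH.
Qed.

Lemma count_flatten_nseq (a : pred 'I_n) (m : 'I_n -> nat) :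
  count a (flatten [seq nseq (m i) i | i <- enum 'I_n]) = (\sum_(i < n) m i * a i)%N.
Proof.
rewrite -[RHS]big_enum /=; elim: (enum 'I_n) => [|j r IH]; first by rewrite big_nil.
by rewrite big_cons /= count_cat count_nseq IH mulnC.
Qed.

Lemma taylor_coef_partial U g i (m : multinom n) : open U -> U 0 -> smooth_on U g ->
  taylor_coef (partial i g) m =
  (m i).+1%:R * taylor_coef g (mnm_add m (mnm1 i)).
Proof.
move=> oU U0 sg; rewrite /taylor_coef.
set s := flatten _; set t := flatten _.
have -> : iter_partial s (partial i g) 0 = iter_partial t g 0.
  have -> : iter_partial s (partial i g) = iter_partial (rcons s i) g.
    by rewrite /iter_partial foldr_rcons.
  apply: (iter_partial_perm oU sg U0); apply/permP => a.
  rewrite -cats1 count_cat /= /s /t !count_flatten_nseq addn0.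
  rewrite [RHS](eq_bigr (fun j => m j * a j + (i == j) * a j)%N); last first.
    by move=> j _; rewrite mnmDE mnm1E mulnDl.
  rewrite big_split /= [X in (_ = _ + X)%N](bigD1 i) //= eqxx mul1n.
  by rewrite [X in (_ = _ + (_ + X))%N]big1 ?addn0 // => j ji; rewrite eq_sym (negPf ji).
rewrite (bigD1 i) //= [in RHS](bigD1 i) //= mnmDE mnm1E eqxx addn1 factS natrM.
have E : \prod_(j < n | j != i) ((mnm_add m (mnm1 i)) j)`!%:R =
    \prod_(j < n | j != i) (m j)`!%:R :> R.
  by apply: eq_bigr => j ji; rewrite mnmDE mnm1E eq_sym (negPf ji) addn0.
rewrite E mulrCA -!mulrA !invfM; congr (_ * _).
by rewrite mulVKf // pnatr_eq0.
Qed.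

End SmoothFunctions.

(** * Taylor expansions *)

Section HomogeneousParts.
Variables (K : numFieldType) (n : nat).
Implicit Types (c : multinom n -> K) (m : multinom n).

(** Convertible to [taylor_part d g] when c is [taylor_coef g], so that Taylor polynomials and
    partial sums of power series share the same lemmas. *)
Definition hpart c (d : nat) : mpoly n K :=
  \sum_(m : bmultinom n d.+1 | mdeg m == d) c m *: mpolyX K m.

Lemma mcoeff_hpart c d m :
  mcoeff m (hpart c d) = if mdeg m == d then c m else 0.
Proof.
rewrite /hpart linear_sum /=; case: ifP => md.
  have mb : (mdeg m < d.+1)%N by rewrite (eqP md).
  rewrite (bigD1 (BMultinom mb)) //= mcoeffZ mcoeffX eqxx mulr1 big1 ?addr0 //.
  move=> b /andP[_ bm]; rewrite mcoeffZ mcoeffX.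
  case: eqVneq => [E|_]; last by rewrite mulr0.
  by case/negP: bm; apply/eqP/val_inj.
rewrite big1 // => b bd; rewrite mcoeffZ mcoeffX.
by case: eqVneq => [E|_]; [rewrite -E bd in md|rewrite mulr0].
Qed.

Lemma dhomog_hpart c d : hpart c d \is ishomog1 d mdeg.
Proof.
by apply/dhomog_coefP => m; rewrite mcoeff_hpart; case: (eqVneq (mdeg m) d) => [//|_]; rewrite eqxx.
Qed.

Lemma mcoeff_sum_hpart c (N : nat) m :
  mcoeff m (\sum_(d < N.+1) hpart c d) = if (mdeg m <= N)%N then c m else 0.
Proof.
rewrite linear_sum /=; case: leqP => mN.
  rewrite (bigD1 (Ordinal (mN : (mdeg m < N.+1)%N))) //= mcoeff_hpart eqxx.
  rewrite big1 ?addr0 // => d /eqP dm; rewrite mcoeff_hpart.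
  by case: eqP => // E; case: dm; apply/val_inj.
rewrite big1 // => d _; rewrite mcoeff_hpart.
by case: eqP => // E; move: (ltn_ord d); rewrite -E ltnS leqNgt mN.
Qed.

End HomogeneousParts.

(** * Orders of vanishing at the origin *)

Section BigOh.
Variables (R : realType) (n : nat).
Implicit Types (f g : 'cV[R]_n -> R) (x y : 'cV[R]_n) (p : mpoly n R).

Definition Oh (k : nat) g : Prop :=
  exists C e : R, [/\ 0 <= C, 0 < e & forall x, `|x| < e -> `|g x| <= C * `|x| ^+ k].

Lemma Oh_ext k f g (e : R) : 0 < e -> (forall x, `|x| < e -> f x = g x) ->
  Oh k f -> Oh k g.
Proof.
move=> e0 fg [C [r [C0 r0 hf]]]; exists C, (Num.min r e); split => //.
  by rewrite lt_min r0.
by move=> x; rewrite lt_min => /andP[xr xe]; rewrite -fg // hf.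
Qed.

Lemma Oh_eq k f g : f =1 g -> Oh k f -> Oh k g.
Proof. by move=> fg; apply: (Oh_ext ltr01) => x _. Qed.

Lemma OhD k f g : Oh k f -> Oh k g -> Oh k (fun x => f x + g x).
Proof.
move=> [C [r [C0 r0 hf]]] [D [e [D0 e0 hg]]].
exists (C + D), (Num.min r e); split; [exact: addr_ge0|by rewrite lt_min r0|].
move=> x; rewrite lt_min => /andP[xr xe]; rewrite mulrDl.
by apply: (le_trans (ler_normD _ _)); apply: lerD; [exact: hf|exact: hg].
Qed.

Lemma OhM k l f g : Oh k f -> Oh l g -> Oh (k + l) (fun x => f x * g x).
Proof.
move=> [C [r [C0 r0 hf]]] [D [e [D0 e0 hg]]].
exists (C * D), (Num.min r e); split; [exact: mulr_ge0|by rewrite lt_min r0|].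
move=> x; rewrite lt_min => /andP[xr xe]; rewrite normrM exprD mulrACA.
by apply: ler_pM => //; [exact: hf|exact: hg].
Qed.

Lemma Oh_le k l g : (k <= l)%N -> Oh l g -> Oh k g.
Proof.
move=> kl [C [r [C0 r0 hf]]]; exists C, (Num.min r 1); split => //.
  by rewrite lt_min r0 ltr01.
move=> x; rewrite lt_min => /andP[xr x1]; apply: (le_trans (hf _ xr)).
by apply: ler_wpM2l => //; apply: ler_wiXn2l => //; exact: ltW.
Qed.

Lemma Oh_cst (c : R) : Oh 0 (fun=> c).
Proof. by exists `|c|, 1; split => // x _; rewrite expr0 mulr1. Qed.

Lemma Oh0 k : Oh k (fun=> 0).
Proof. by exists 0, 1; split => // x _; rewrite normr0 mul0r. Qed.

Lemma OhZ k (c : R) g : Oh k g -> Oh k (fun x => c * g x).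
Proof. by move=> /(OhM (Oh_cst c)); rewrite add0n. Qed.

Lemma OhN k g : Oh k g -> Oh k (fun x => - g x).
Proof. by move=> /(OhZ (-1)); apply: Oh_eq => x; rewrite mulN1r. Qed.

Lemma OhB k f g : Oh k f -> Oh k g -> Oh k (fun x => f x - g x).
Proof. by move=> hf /OhN; exact: OhD. Qed.

Lemma Oh_sum k (I : Type) (r : seq I) (P : pred I) (F : I -> 'cV[R]_n -> R) :
  (forall i, P i -> Oh k (F i)) -> Oh k (fun x => \sum_(i <- r | P i) F i x).
Proof.
move=> hF; elim: r => [|i r IH].
  by apply: Oh_eq (Oh0 k) => x; rewrite big_nil.
have [Pi|Pi] := boolP (P i).
  by apply: Oh_eq (OhD (hF i Pi) IH) => x; rewrite big_cons Pi.
by apply: Oh_eq IH => x; rewrite big_cons (negPf Pi).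
Qed.

Lemma norm_monomial_le x (m : multinom n) : `|monomial m x| <= `|x| ^+ mdeg m.
Proof.
rewrite /monomial normr_prod mdegE expr_sum; apply: ler_prod => i _.
by rewrite normr_ge0 normrX; apply: lerXn2r; rewrite ?nnegrE // coord_le_norm.
Qed.

Lemma peval_sumE p x : peval p x = \sum_(m <- msupp p) mcoeff m p * monomial m x.
Proof. by rewrite /peval mevalE. Qed.

Lemma Oh_peval p (d : nat) :
  (forall m, (mdeg m < d)%N -> mcoeff m p = 0) -> Oh d (peval p).
Proof.
move=> p0; apply: (@Oh_eq _ (fun x => \sum_(m <- msupp p | m \in msupp p)
    mcoeff m p * monomial m x)) => [x|].
  by rewrite peval_sumE -big_seq.
apply: Oh_sum => m; rewrite mcoeff_msupp => pm; apply: OhZ.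
apply: (@Oh_le _ (mdeg m)); first by rewrite leqNgt; apply: contra pm => /p0 ->.
by exists 1, 1; split => // x _; rewrite mul1r norm_monomial_le.
Qed.

Lemma Oh_homog p (d : nat) : p \is ishomog1 d mdeg -> Oh d (peval p).
Proof.
move=> /dhomog_coefP hp; apply: Oh_peval => m md; apply/eqP.
by apply: contraTT md => /hp ->; rewrite ltnn.
Qed.

Lemma Oh_continuous g : {for 0, continuous g} -> Oh 0 g.
Proof.
move=> cg; have /nbhs_ballP [r r0 hr] :
    \forall x \near (0 : 'cV[R]_n), `|g 0 - g x| <= 1.
  exact: (@cvgr_dist_le _ _ _ _ _ _ _ cg _ (ltr01 : 0 < (1 : R))).
exists (1 + `|g 0|), r; split => //.
move=> x xr; rewrite expr0 mulr1.
have : `|g 0 - g x| <= 1.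
  by apply: (hr x); rewrite -ball_normE /ball_ /= sub0r normrN.
move=> h; rewrite -lerBlDr; apply: le_trans h.
by rewrite distrC; exact: lerB_dist.
Qed.

Lemma le0_small (a D r : R) :
  0 < r -> (forall t, 0 < t -> t < r -> a <= D * t) -> a <= 0.
Proof.
move=> r0 h; rewrite leNgt; apply/negP => a0.
have D0 : 0 < `|D| + 1 by rewrite ltr_wpDl.
pose t := Num.min (r / 2) (a / (`|D| + 1) / 2).
have t0 : 0 < t by rewrite lt_min !divr_gt0.
have tr : t < r by apply: (@le_lt_trans _ _ (r / 2)); [rewrite ge_min lexx|lra].
have ta : t <= a / (`|D| + 1) / 2 by rewrite ge_min lexx orbT.
have := h t t0 tr; rewrite leNgt => /negP; apply.
apply: (@le_lt_trans _ _ ((`|D| + 1) * t)).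
  by apply: ler_wpM2r; [exact: ltW|apply: (le_trans (ler_norm D)); rewrite lerDl].
apply: (@le_lt_trans _ _ (a / 2)); last by lra.
by rewrite mulrC -ler_pdivlMr // mulrAC.
Qed.

(** On the ray through x the form is t^d p(x) and the bound is a multiple of t^(d+1); dividing by
    t^d and letting t tend to 0 leaves p(x) = 0. *)
Lemma peval_homog_Oh_eq0 p (d : nat) :
  p \is ishomog1 d mdeg -> Oh d.+1 (peval p) -> p = 0.
Proof.
move=> hp [C [e [C0 e0 hO]]].
have p0 x : peval p x = 0.
  have e1 : 0 < e / (`|x| + 1) by rewrite divr_gt0 // ltr_wpDl.
  apply/eqP; rewrite -normr_le0.
  apply: (le0_small (D := C * `|x| ^+ d.+1) e1) => t t0 te.
  have := hO (t *: x); rewrite (peval_homog _ _ hp) normrZ normrM normrX.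
  rewrite (gtr0_norm t0) => h; rewrite -(ler_pM2l (exprn_gt0 d t0)).
  have tx : t * `|x| < e.
    move: te; rewrite ltr_pdivlMr ?ltr_wpDl //; apply: le_lt_trans.
    by rewrite mulrDr lerDl mulr1 ltW.
  rewrite (le_trans (h tx)) // exprMn [t ^+ d.+1]exprS.
  by rewrite le_eqVlt; apply/orP; left; apply/eqP; ring.
(* A polynomial is recovered from its values, as its coefficients are the Taylor coefficients at
   0. *)
apply/mpolyP => m; rewrite -taylor_coef_peval.
have -> : peval p = peval 0 by apply/funext => x; rewrite p0 peval0.
by rewrite taylor_coef_peval.
Qed.

(** This converts estimates into formal identities. Once the coefficients below degree d vanish, p
    minus its part of degree d is O(|x|^(d+1)), hence so is that part. *)
Lemma peval_Oh_coef p (N : nat) : Oh N.+1 (peval p) ->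
  forall m, (mdeg m <= N)%N -> mcoeff m p = 0.
Proof.
move=> hO m; have [k] := ubnP (mdeg m); elim: k m => // k IH m.
rewrite ltnS => mk mN; set d := mdeg m in mk mN.
have hd : Oh d.+1 (peval (hpart (fun m => mcoeff m p) d)).
  have : Oh d.+1 (peval (p - hpart (fun m => mcoeff m p) d)).
    apply: Oh_peval => m' md'; rewrite mcoeffB mcoeff_hpart.
    case: eqVneq => [_|md]; first by rewrite subrr.
    have ltd : (mdeg m' < d)%N by rewrite ltn_neqAle md.
    rewrite subr0; apply: IH; first exact: leq_trans ltd mk.
    exact: leq_trans (ltnW ltd) mN.
  move=> h1; have h2 : Oh d.+1 (peval p) by exact: Oh_le hO.
  by apply: Oh_eq (OhB h2 h1) => x; rewrite /peval mevalB opprB addrC subrK.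
have := congr1 (mcoeff m) (peval_homog_Oh_eq0 (dhomog_hpart _ _) hd).
by rewrite mcoeff_hpart eqxx mcoeff0.
Qed.

End BigOh.

Section Taylor.
Variables (R : realType) (n : nat).
Implicit Types (f g : 'cV[R]_n -> R) (x y : 'cV[R]_n) (p : mpoly n R).
Implicit Types (U : set 'cV[R]_n).

Lemma open_ball0 U : open U -> U 0 -> exists2 e, 0 < e & forall x, `|x| < e -> U x.
Proof.
move=> oU U0; have /nbhs_ballP [e e0 he] : nbhs (0 : 'cV[R]_n) U by exact: open_nbhs_nbhs.
exists e => // x xe; apply: he.
by rewrite -ball_normE /ball_ /= sub0r normrN.
Qed.

(** Induction on k: the partial derivatives are O(|x|^k) with a common constant, and comparing x
    with 0 inside the ball of radius |x| gains one power. *)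
Lemma flat_Oh U g (k : nat) : open U -> U 0 -> smooth_on U g ->
  (forall s : seq 'I_n, (size s < k)%N -> iter_partial s g 0 = 0) -> Oh k g.
Proof.
move=> oU U0; elim: k g => [|k IH] g sg g0.
  by apply: Oh_continuous; exact: (smooth_on_continuous sg U0).
have dO i : Oh k (partial i g).
  apply: IH; first exact: smooth_on_partial.
  move=> s sk; have := g0 (rcons s i); rewrite size_rcons ltnS => /(_ sk).
  by rewrite /iter_partial foldr_rcons.
have [C [e [C0 e0 hC]]] : Oh k (fun x => \sum_(i < n) `|partial i g x|).
  apply: Oh_sum => i _; have [C [e [C0 e0 h]]] := dO i.
  by exists C, e; split => // x /h; rewrite normr_id.
have [r r0 hr] := open_ball0 oU U0.
exists (n%:R * C), (Num.min e r); split; first exact: mulr_ge0.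
  by rewrite lt_min e0.
move=> x; rewrite lt_min => /andP[xe xr].
have := @box_lipschitz R n g `|x| (C * `|x| ^+ k) x 0.
rewrite (g0 [::] isT : g 0 = 0) !subr0 exprSr !mulrA normr0; apply => //.
move=> z i zx; split.
  by apply: (@smooth_on_derivable _ _ U g z i sg); apply: hr; exact: le_lt_trans xr.
apply: (@le_trans _ _ (\sum_(i < n) `|partial i g z|)).
  by rewrite (bigD1 i) //= lerDl sumr_ge0.
apply: (le_trans (ler_norm _)); apply: (le_trans (hC _ (le_lt_trans zx xe))).
by apply: ler_wpM2l => //; apply: lerXn2r; rewrite ?nnegrE.
Qed.

Lemma taylor_coef_sub U f g (m : multinom n) : open U -> U 0 ->
  smooth_on U f -> smooth_on U g ->
  taylor_coef (fun x => f x - g x) m = taylor_coef f m - taylor_coef g m.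
Proof.
by move=> oU U0 sf sg; rewrite /taylor_coef (iter_partialB _ oU sf sg) // mulrBl.
Qed.

(** Taylor coefficients differentiate in one fixed order of the variables; by symmetry, any sequence
    of derivations reduces to the multinomial that counts its indices. *)
Lemma iter_partial_taylor_coef U g (s : seq 'I_n) :
  open U -> U 0 -> smooth_on U g ->
  exists2 m : multinom n, mdeg m = size s &
    (taylor_coef g m = 0 -> iter_partial s g 0 = 0).
Proof.
move=> oU U0 sg; pose m : multinom n := Multinom [tuple count_mem i s | i < n].
have mE i : m i = count_mem i s by rewrite mnmE.
have st : perm_eq s (flatten [seq nseq (m i) i | i <- enum 'I_n]).
  apply/permP => a; rewrite count_flatten_nseq.
  rewrite (eq_bigr (fun i => count_mem i s * a i)%N) => [|i _]; last by rewrite mE.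
  elim: s {m mE} => [|j s IH] /=; first by rewrite big1.
  rewrite (eq_bigr (fun i => (j == i) * a i + count_mem i s * a i)%N); last first.
    by move=> i _; rewrite mulnDl.
  rewrite big_split /= -IH (bigD1 j) //= eqxx mul1n big1 ?addn0 // => i ij.
  by rewrite eq_sym (negPf ij).
exists m.
  rewrite (perm_size st) size_flatten /shape -map_comp sumnE big_map big_enum /=.
  by rewrite mdegE; apply: eq_bigr => i _; rewrite size_nseq.
rewrite /taylor_coef (iter_partial_perm oU sg U0 st) => /eqP.
rewrite mulf_eq0 invr_eq0 => /orP[/eqP //|].
rewrite prodf_seq_eq0 => /hasP[i _ /=].
by rewrite pnatr_eq0 eqn0Ngt fact_gt0.
Qed.

(** Subtracting the Taylor polynomial kills all derivatives at 0 up to order N, so no remainder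
    formula is needed beyond [flat_Oh]. *)
Lemma taylor_Oh U g (N : nat) : open U -> U 0 -> smooth_on U g ->
  Oh N.+1 (fun x => g x - peval (\sum_(d < N.+1) taylor_part d g) x).
Proof.
move=> oU U0 sg; set p := \sum_(d < _) _.
have sp := @smooth_on_peval R n U p.
have sgp := smooth_onB oU sg sp.
apply: (flat_Oh oU U0 sgp) => s sN.
have [m ms] := iter_partial_taylor_coef s oU U0 sgp; apply.
rewrite (taylor_coef_sub _ oU U0 sg sp).
rewrite taylor_coef_peval (mcoeff_sum_hpart (taylor_coef g)) ms.
by rewrite -ltnS sN subrr.
Qed.

End Taylor.

(** * Power series *)

Section GeometricBounds.
Variable R : realType.
Implicit Types (a : nat -> R) (q r : R).

(** For nonnegative a this expresses a radius of convergence of at least rho, in a form that passes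
    easily to termwise derivatives. *)
Definition geom_bounded a (rho : R) : Prop :=
  forall r, 0 < r -> r < rho -> exists B, forall d, a d * r ^+ d <= B.

Lemma sum_geom_le q (N : nat) : 0 <= q -> q < 1 ->
  \sum_(d < N) q ^+ d <= (1 - q)^-1.
Proof.
move=> q0 q1; rewrite -[leRHS]div1r ler_pdivlMr ?subr_gt0 //.
have -> : (\sum_(d < N) q ^+ d) * (1 - q) = 1 - q ^+ N.
  elim: N => [|N IH]; first by rewrite big_ord0 mul0r expr0 subrr.
  by rewrite big_ord_recr /= mulrDl IH exprS; ring.
by rewrite lerBlDr lerDl exprn_ge0.
Qed.

(** Each of the first d + 1 powers of q is at least q^d. *)
Lemma mulr_geom_le q (d : nat) : 0 <= q -> q < 1 ->
  d.+1%:R * q ^+ d <= (1 - q)^-1.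
Proof.
move=> q0 q1; apply: le_trans (sum_geom_le d.+1 q0 q1).
rewrite mulr_natl -[X in _ *+ X]card_ord -sumr_const; apply: ler_sum => k _.
by apply: ler_wiXn2l => //; [exact: ltW|rewrite -ltnS ltn_ord].
Qed.

Lemma mid_radius r rho : 0 <= r -> r < rho ->
  exists r1, [/\ 0 < r1, r1 < rho, 0 <= r / r1 & r / r1 < 1].
Proof.
move=> r0 rr; have h : 0 < (r + rho) / 2 by lra.
exists ((r + rho) / 2); split => //; first by lra.
  by rewrite divr_ge0 // ltW.
by rewrite ltr_pdivrMr // mul1r; lra.
Qed.

Lemma geom_bounded_sum a rho r : (forall d, 0 <= a d) -> geom_bounded a rho ->
  0 <= r -> r < rho ->
  exists2 L, 0 <= L & forall N, \sum_(d < N) a d * r ^+ d <= L.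
Proof.
move=> a0 ab r0 rr; have [r1 [r10 r1r q0 q1]] := mid_radius r0 rr.
have [B hB] := ab r1 r10 r1r.
have B0 : 0 <= B by apply: le_trans (hB 0%N); apply: mulr_ge0 => //; exact/exprn_ge0/ltW.
exists (B * (1 - r / r1)^-1) => [|N].
  by rewrite mulr_ge0 // invr_ge0 subr_ge0 ltW.
apply: (@le_trans _ _ (B * \sum_(d < N) (r / r1) ^+ d)); last first.
  by apply: ler_wpM2l => //; exact: sum_geom_le.
rewrite mulr_sumr; apply: ler_sum => d _.
have -> : a d * r ^+ d = a d * r1 ^+ d * (r / r1) ^+ d.
  by rewrite exprMn exprVn mulrACA divff ?mulr1 ?expf_neq0 // ?gt_eqF // mulr1.
by apply: ler_wpM2r => //; exact: exprn_ge0.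
Qed.

(** The factor d + 1 is absorbed by the ratio r / r1 for an intermediate radius r1. *)
Lemma geom_bounded_deriv a b rho : (forall d, 0 <= a d) -> geom_bounded a rho ->
  (forall d, b d <= d.+1%:R * a d.+1) -> geom_bounded b rho.
Proof.
move=> a0 ab ba r r0 rr; have [r1 [r10 r1r q0 q1]] := mid_radius (ltW r0) rr.
have [B hB] := ab r1 r10 r1r.
have B0 : 0 <= B by apply: le_trans (hB 0%N); apply: mulr_ge0 => //; exact/exprn_ge0/ltW.
exists (B / r1 * (1 - r / r1)^-1) => d.
apply: (@le_trans _ _ (d.+1%:R * a d.+1 * r ^+ d)).
  by apply: ler_wpM2r; [exact/exprn_ge0/ltW|exact: ba].
have -> : d.+1%:R * a d.+1 * r ^+ d =
    (a d.+1 * r1 ^+ d.+1 / r1) * (d.+1%:R * (r / r1) ^+ d).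
  have r1d : r1 ^+ d != 0 by rewrite expf_neq0 // gt_eqF.
  rewrite exprMn exprVn exprS; field.
  by rewrite r1d gt_eqF.
apply: ler_pM.
- by apply: divr_ge0; [apply: mulr_ge0 => //; exact/exprn_ge0/ltW|exact: ltW].
- by rewrite mulr_ge0 // exprn_ge0.
- by apply: ler_wpM2r => //; rewrite invr_ge0 ltW.
- exact: mulr_geom_le.
Qed.

End GeometricBounds.

Section PowerSeries.
Variables (R : realType) (n : nat).
Implicit Types (c : multinom n -> R) (h x : 'cV[R]_n) (m : multinom n).

Lemma peval_hpart c d h : peval (hpart c d) h =
  \sum_(m : bmultinom n d.+1 | mdeg m == d) c m * monomial m h.
Proof.
rewrite /hpart peval_sum; apply: eq_bigr => m _.
by rewrite pevalZ /peval mevalX.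
Qed.

(** Written as the value of a form at the all-ones vector, and not directly as a sum of absolute
    values, so that Euler's identity applies to it. *)
Definition anorm c (d : nat) : R := peval (hpart (fun m => `|c m|) d) (const_mx 1).

Definition dcoef (i : 'I_n) c (m : multinom n) : R :=
  (m i).+1%:R * c (mnm_add m (mnm1 i)).

Lemma monomial_const m (r : R) : monomial m (const_mx r) = r ^+ mdeg m.
Proof.
by rewrite /monomial mdegE expr_sum; apply: eq_bigr => i _; rewrite mxE.
Qed.

Lemma anormE c d : anorm c d =
  \sum_(m : bmultinom n d.+1 | mdeg m == d) `|c m|.
Proof.
rewrite /anorm peval_hpart; apply: eq_bigr => m _.
by rewrite monomial_const expr1n mulr1.
Qed.

Lemma anorm_ge0 c d : 0 <= anorm c d.
Proof. by rewrite anormE sumr_ge0. Qed.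

Lemma abs_terms_le c d h :
  \sum_(m : bmultinom n d.+1 | mdeg m == d) `|c m * monomial m h|
  <= anorm c d * `|h| ^+ d.
Proof.
rewrite anormE mulr_suml; apply: ler_sum => m /eqP md.
by rewrite normrM; apply: ler_wpM2l => //; rewrite -{2}md; exact: norm_monomial_le.
Qed.

Lemma peval_hpart_le c d h : `|peval (hpart c d) h| <= anorm c d * `|h| ^+ d.
Proof.
rewrite peval_hpart; apply: le_trans (abs_terms_le c d h).
exact: ler_norm_sum.
Qed.

Lemma mderiv_hpart (i : 'I_n) c d :
  mderiv i (hpart c d.+1) = hpart (dcoef i c) d.
Proof.
apply/mpolyP => m; rewrite mcoeff_mderiv !mcoeff_hpart mdegD mdeg1 addn1 eqSS.
by case: ifP => _; rewrite ?mul0rn // /dcoef mulr_natl.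
Qed.

Lemma mderiv_sum_hpart (i : 'I_n) c (N : nat) :
  mderiv i (\sum_(d < N.+1) hpart c d) = \sum_(d < N) hpart (dcoef i c) d.
Proof.
rewrite linear_sum big_ord_recl /= (mderiv_dhomog0 _ (dhomog_hpart c 0)) add0r.
by apply: eq_bigr => d _; rewrite mderiv_hpart.
Qed.

(** By Euler's identity at the all-ones vector, the right side is the sum over all variables of the
    norms of the termwise derivatives. *)
Lemma anorm_dcoef_le (i : 'I_n) c d :
  anorm (dcoef i c) d <= d.+1%:R * anorm c d.+1.
Proof.
rewrite {2}/anorm -(peval_euler _ (dhomog_hpart _ _)) peval_dirder.
have E j : peval (mderiv j (hpart (fun m => `|c m|) d.+1)) (const_mx 1) =
    anorm (dcoef j c) d.
  rewrite mderiv_hpart /anorm; congr (peval _ _).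
  apply/mpolyP => m; rewrite !mcoeff_hpart; case: ifP => // _.
  by rewrite /dcoef normrM ger0_norm.
rewrite (bigD1 i) //= E mxE mul1r lerDl; apply: sumr_ge0 => j _.
by rewrite E mxE mul1r anorm_ge0.
Qed.

Lemma geom_bounded_dcoef (i : 'I_n) c rho :
  geom_bounded (anorm c) rho -> geom_bounded (anorm (dcoef i c)) rho.
Proof.
move=> cb; apply: (geom_bounded_deriv (anorm_ge0 c) cb) => d.
exact: anorm_dcoef_le.
Qed.

(** At the vector with all entries r every monomial of degree d takes the value r^d, so absolute
    convergence at this single point bounds all terms. *)
Lemma power_series_geom_bounded c (rho : R) (v : 'cV[R]_n -> R) :
  (forall h, `|h| < rho -> power_series_cvg c h (v h)) ->
  geom_bounded (anorm c) rho.
Proof.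
move=> cv r r0 rr; have hr : `|const_mx r : 'cV[R]_n| < rho.
  apply: le_lt_trans rr; apply: norm_le_coord; first exact: ltW.
  by move=> i; rewrite mxE gtr0_norm.
have [/cvg_series_bounded/bounded_fun_has_ubound [B hB] _] := cv _ hr.
exists B => d; apply: hB; exists d => //.
rewrite anormE mulr_suml; apply: eq_bigr => m /eqP md.
by rewrite monomial_const md normrM [`|r ^+ d|]ger0_norm // exprn_ge0 // ltW.
Qed.

Lemma power_series_cvg_exists c (rho : R) h :
  geom_bounded (anorm c) rho -> `|h| < rho -> exists v, power_series_cvg c h v.
Proof.
move=> cb hr; have [L L0 hL] := geom_bounded_sum (anorm_ge0 c) cb (normr_ge0 h) hr.
have C : cvgn (series (fun d =>
    \sum_(m : bmultinom n d.+1 | mdeg m == d) `|c m * monomial m h|)).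
  apply: nondecreasing_is_cvgn.
    by apply/nondecreasing_seqP => N; rewrite seriesSr lerDl sumr_ge0.
  exists L => _ [N _ <-]; apply: le_trans (hL N).
  rewrite /series /= big_mkord; apply: ler_sum => d _; exact: abs_terms_le.
have D : cvgn (series (fun d =>
    \sum_(m : bmultinom n d.+1 | mdeg m == d) c m * monomial m h)).
  apply: normed_cvg; apply: series_le_cvg C => [d|d|d] //=; first exact: sumr_ge0.
  exact: ler_norm_sum.
by exists (limn (series (fun d =>
    \sum_(m : bmultinom n d.+1 | mdeg m == d) c m * monomial m h))); split.
Qed.

Lemma partial_sumE c h N :
  series (fun d => \sum_(m : bmultinom n d.+1 | mdeg m == d) c m * monomial m h) N
  = peval (\sum_(d < N) hpart c d) h.
Proof.
rewrite /series /= big_mkord peval_sum; apply: eq_bigr => d _.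
by rewrite peval_hpart.
Qed.

Lemma partial_sum_le c (rho r : R) :
  geom_bounded (anorm c) rho -> 0 <= r -> r < rho ->
  exists2 L, 0 <= L &
    forall N h, `|h| <= r -> `|peval (\sum_(d < N) hpart c d) h| <= L.
Proof.
move=> cb r0 rr; have [L L0 hL] := geom_bounded_sum (anorm_ge0 c) cb r0 rr.
exists L => // N h hr; apply: le_trans (hL N); rewrite peval_sum.
apply: (le_trans (ler_norm_sum _ _ _)); apply: ler_sum => d _.
apply: (le_trans (peval_hpart_le c d h)).
by apply: ler_wpM2l; [exact: anorm_ge0|apply: lerXn2r; rewrite ?nnegrE].
Qed.

Lemma le_of_partial_sums (u : nat -> R) (v B : R) :
  u @ \oo --> v -> (forall N, u N.+1 <= B) -> v <= B.
Proof.
move=> uv uB; have -> : v = limn u by apply/esym/cvg_lim.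
apply: limr_le; first by apply/cvg_ex; exists v.
by near=> N; have /prednK <- : (0 < N)%N by near: N; exact: nbhs_infty_gt.
Unshelve. all: by end_near.
Qed.

Lemma quotient_sub (t v y z : R) : t != 0 ->
  v - t^-1 * (y - z) = - (t^-1 * (y - z - t * v)).
Proof. by move=> t0; field. Qed.

Section Sum.
Variables (c : multinom n -> R) (rho : R) (G : 'cV[R]_n -> R).
Hypothesis rho0 : 0 < rho.
Hypothesis cG : forall h, `|h| < rho -> power_series_cvg c h (G h).

Let cb : geom_bounded (anorm c) rho := power_series_geom_bounded cG.

Let S (N : nat) : mpoly n R := \sum_(d < N) hpart c d.

Lemma cvg_S h : `|h| < rho -> (fun N => peval (S N) h) @ \oo --> G h.
Proof.
move=> /cG [_]; apply: cvg_trans; apply: near_eq_cvg; near=> N.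
by rewrite partial_sumE.
Unshelve. all: by end_near.
Qed.

(** The partial sums have partial derivatives bounded uniformly in N, hence a common Lipschitz
    constant, which survives in the limit. *)
Lemma sum_lipschitz r : 0 <= r -> r < rho -> exists2 L, 0 <= L &
  forall h k, `|h| <= r -> `|k| <= r -> `|G h - G k| <= L * `|h - k|.
Proof.
move=> r0 rr.
have /choice [L hL] : forall i, exists L : R, 0 <= L /\
    forall N h, `|h| <= r -> `|partial i (peval (S N.+1)) h| <= L.
  move=> i; have [L L0 hL] := partial_sum_le (geom_bounded_dcoef i cb) r0 rr.
  exists L; split=> // N h hr; rewrite partial_peval mderiv_sum_hpart; exact: hL.
have L0 i : 0 <= L i by have [] := hL i.
exists (n%:R * \sum_i L i) => [|h k hr kr]; first by rewrite mulr_ge0 ?sumr_ge0.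
have hrr := le_lt_trans hr rr; have krr := le_lt_trans kr rr.
apply: (@le_of_partial_sums (fun N => `|peval (S N) h - peval (S N) k|)).
  by apply: cvg_norm; apply: cvgB; exact: cvg_S.
move=> N; apply: (@box_lipschitz _ _ _ r) => // z i zr; split.
  exact: derivable_peval.
apply: (le_trans ((hL i).2 N z zr)); rewrite (bigD1 i) //= lerDl.
by rewrite sumr_ge0.
Qed.

Lemma sum_continuous h : `|h| < rho -> {for h, continuous G}.
Proof.
move=> hr; pose r := (`|h| + rho) / 2.
have [L L0 hL] := @sum_lipschitz r ltac:(by rewrite /r; have := normr_ge0 h; lra)
  ltac:(by rewrite /r; lra).
suff C : G @ h --> G h by exact: C.
apply/(@cvgrPdist_le _ _ _ _ (nbhs_filter h)) => e e0; have L1 : 0 < L + 1 by lra.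
have close (d : R) : 0 < d -> \forall k \near h, `|h - k| <= d.
  by move=> d0; apply/nbhs_ballP; exists d => // k; rewrite -ball_normE => /ltW.
have C1 : \forall k \near h, `|h - k| <= (rho - `|h|) / 2 by apply: close; lra.
have C2 : \forall k \near h, `|h - k| <= e / (L + 1).
  by apply: close; exact: divr_gt0.
apply: filterS2 C1 C2 => k h1 h2.
have kr : `|k| <= r.
  rewrite -[k](subrK h); apply: (le_trans (ler_normD _ _)).
  by rewrite distrC /r; lra.
apply: (le_trans (hL h k _ kr)); first by rewrite /r; lra.
move: h2; rewrite ler_pdivlMr // mulrC; apply: le_trans.
by apply: ler_wpM2r => //; lra.
Qed.

(** Two applications of the mean value theorem to the partial sums bound the first order error by L
    t^2, where L bounds all their second derivatives along i on a ball. The bound does not depend on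
    N and passes to the limit, which gives the derivative of G. *)
Lemma sum_partial i h : `|h| < rho ->
  derivable G h (delta_mx i 0) /\ power_series_cvg (dcoef i c) h (partial i G h).
Proof.
move=> hr.
have cb1 := geom_bounded_dcoef i cb; have cb2 := geom_bounded_dcoef i cb1.
have [v hv] := power_series_cvg_exists cb1 hr.
pose r := (`|h| + rho) / 2.
have r0 : 0 <= r by rewrite /r; have := normr_ge0 h; lra.
have rr : r < rho by rewrite /r; lra.
have [L L0 hL] := partial_sum_le cb2 r0 rr.
have line_r (t : R) : `|t| <= (rho - `|h|) / 2 -> `|h + t *: delta_mx i 0| <= r.
  move=> ht; apply: (le_trans (ler_normD _ _)); rewrite normrZ.
  have : `|t| * `|delta_mx i 0 : 'cV[R]_n| <= (rho - `|h|) / 2.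
    rewrite -[leRHS]mulr1; apply: ler_pM => //; exact: norm_delta_le.
  by rewrite /r; lra.
have sub_itv (t s : R) : s \in `[Num.min 0 t, Num.max 0 t] -> `|s| <= `|t|.
  rewrite in_itv /= ge_min le_max; case: (ler0P t) => t0; case: (ler0P s) => s0;
  move=> /andP[/orP[] ? /orP[] ?]; lra.
have key (t : R) : `|t| <= (rho - `|h|) / 2 ->
    `|G (h + t *: delta_mx i 0) - G h - t * v| <= L * `|t| ^+ 2.
  move=> ht.
  apply: (@le_of_partial_sums (fun N => `|peval (S N) (h + t *: delta_mx i 0)
     - peval (S N) h - t * peval (mderiv i (S N)) h|)).
    apply: cvg_norm; apply: cvgB.
      by apply: cvgB; apply: cvg_S => //; exact: le_lt_trans (line_r _ ht) rr.
    apply: cvgM; first exact: cvg_cst.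
    (* Differentiation lowers the degree: the derivative of the partial sum of index N + 1 is the
       partial sum of index N of the derived series. *)
    rewrite -(cvg_shiftS (fun N => peval (mderiv i (S N)) h)) /=.
    have [_] := hv; apply: cvg_trans; apply: near_eq_cvg; near=> N.
    by rewrite partial_sumE mderiv_sum_hpart.
  move=> N.
  have [|a ha ->] := @line_MVT _ _ (peval (S N.+1)) h (delta_mx i 0) t.
    by move=> s _; exact: derivable_peval.
  rewrite -/(partial i (peval (S N.+1)) _) partial_peval -mulrBr normrM.
  have [|b hb ->] := @line_MVT _ _ (peval (mderiv i (S N.+1))) h (delta_mx i 0) a.
    by move=> s _; exact: derivable_peval.
  rewrite -/(partial i (peval (mderiv i (S N.+1))) _) partial_peval.
  have at_ := sub_itv _ _ ha; have ba := sub_itv _ _ hb.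
  have -> : L * `|t| ^+ 2 = `|t| * (`|t| * L) by ring.
  rewrite normrM; apply: ler_wpM2l => //; apply: ler_pM => //.
  rewrite mderiv_sum_hpart; case: N => [|N].
    by rewrite big_ord0 linear0 peval0 normr0.
  rewrite mderiv_sum_hpart; apply: hL; apply: line_r.
  exact: le_trans (le_trans ba at_) ht.
have C : (fun t : R => t^-1 *: (G (t *: delta_mx i 0 + h) - G h)) @ 0^' --> v.
  apply/cvgrPdist_le => e e0; have L1 : 0 < L + 1 by lra.
  have eL : 0 < e / (L + 1) by exact: divr_gt0.
  near=> t.
  have t0 : t != 0 by near: t; exact: nbhs_dnbhs_neq.
  have ht : `|t| <= (rho - `|h|) / 2 by near: t; apply: dnbhs0_le; lra.
  have hte : `|t| <= e / (L + 1) by near: t; exact: dnbhs0_le.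
  have nt : 0 < `|t| by rewrite normr_gt0.
  have E : v - t^-1 *: (G (t *: delta_mx i 0 + h) - G h) =
      - (t^-1 * (G (h + t *: delta_mx i 0) - G h - t * v)).
    rewrite [t *: _ + h]addrC; exact: quotient_sub.
  rewrite E normrN normrM normfV -(ler_pM2l nt) mulVKf ?gt_eqF //.
  apply: (le_trans (key t ht)); rewrite expr2 mulrCA; apply: ler_wpM2l => //.
  move: hte; rewrite ler_pdivlMr // mulrC; apply: le_trans.
  by apply: ler_wpM2r => //; lra.
split; first by apply/cvg_ex; exists v.
have -> : partial i G h = v by apply: cvg_lim.
exact: hv.
Unshelve. all: by end_near.
Qed.

End Sum.
End PowerSeries.

(** * Analytic functions and the identity theorem *)

Section Analytic.
Variables (R : realType) (n : nat).
Implicit Types (U : set 'cV[R]_n) (g : 'cV[R]_n -> R) (p h : 'cV[R]_n).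

Lemma iter_partial_shift (s : seq 'I_n) g p :
  iter_partial s (fun h => g (p + h)) = (fun h => iter_partial s g (p + h)).
Proof.
elim: s => //= i s ->; apply/funext => h; rewrite /partial.
rewrite (_ : (fun h => _ (p + h)) = (fun h => iter_partial s g (h + p))).
  by rewrite derive_shift addrC.
by apply/funext => k; rewrite addrC.
Qed.

Lemma analytic_on_partial U g (i : 'I_n) :
  analytic_on U g -> analytic_on U (partial i g).
Proof.
move=> ag p /ag [c [rho [rho0 cg]]]; exists (dcoef i c), rho; split => // h hr.
have [_] := sum_partial cg i hr.
by have /(congr1 (fun f => f h)) /= -> := iter_partial_shift [:: i] g p.
Qed.

Lemma analytic_on_iter_partial U g (s : seq 'I_n) :
  analytic_on U g -> analytic_on U (iter_partial s g).
Proof. by move=> ag; elim: s => [|i s IH]; [exact: ag|exact: analytic_on_partial]. Qed.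

Lemma analytic_on_derivable U g p (i : 'I_n) :
  analytic_on U g -> U p -> derivable g p (delta_mx i 0).
Proof.
move=> ag /ag [c [rho [rho0 cg]]].
have n0 : `|0 : 'cV[R]_n| < rho by rewrite normr0.
have [dg _] := sum_partial cg i n0.
have dg' : derivable (fun h => g (p + h)) (p - p) (delta_mx i 0) by rewrite subrr.
have -> : g = (fun y => (fun h => g (p + h)) (y + - p)).
  by apply/funext => y; rewrite addrC subrK.
exact: (@derivable_shift R n (fun h => g (p + h)) (- p) p (delta_mx i 0) dg').
Qed.

Lemma analytic_on_continuous U g p :
  analytic_on U g -> U p -> {for p, continuous g}.
Proof.
move=> ag /ag [c [rho [rho0 cg]]].
have n0 : `|0 : 'cV[R]_n| < rho by rewrite normr0.
have cG := sum_continuous cg n0.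
have -> : g = (fun h => g (p + h)) \o (fun y => y - p).
  by apply/funext => y /=; rewrite addrC subrK.
apply: continuous_comp; last by rewrite subrr.
suff : (fun y : 'cV[R]_n => y - p) @ p --> p - p by [].
exact: (cvgB cvg_id (cvg_cst p)).
Qed.

Lemma analytic_on_smooth U g : analytic_on U g -> smooth_on U g.
Proof.
move=> ag s x Ux; have ags := analytic_on_iter_partial s ag.
split; first exact: analytic_on_continuous ags Ux.
by move=> i; exact: (@analytic_on_derivable U _ x i ags Ux).
Qed.

Lemma Cr_on_smooth (r : regularity) U g : Cr_on r U g -> smooth_on U g.
Proof. by case: r => //; exact: analytic_on_smooth. Qed.

Lemma power_series_at0 (c : multinom n -> R) (v : R) :
  power_series_cvg c 0 v -> v = c mnm0.
Proof.
case=> _ cv; apply: (cvg_unique _ cv) => //=.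
apply: cvg_near_cst; near=> N.
have /prednK <- : (0 < N)%N by near: N; exact: nbhs_infty_gt.
by rewrite partial_sumE peval_at0 mcoeff_sum_hpart mdeg0.
Unshelve. all: by end_near.
Qed.

(** Up to a nonzero integer factor, a coefficient of positive degree is a coefficient of lower
    degree in the series of some partial derivative, which is flat as well. *)
Lemma power_series_flat (c : multinom n -> R) (rho : R) g : 0 < rho ->
  (forall h, `|h| < rho -> power_series_cvg c h (g h)) ->
  (forall s : seq 'I_n, iter_partial s g 0 = 0) -> forall m, c m = 0.
Proof.
move=> rho0 cg g0 m; have [k] := ubnP (mdeg m).
elim: k m c g cg g0 => // k IH m c g cg g0 mk.
have [->|m0] := eqVneq m mnm0.
  by rewrite -(power_series_at0 (cg 0 _)) ?normr0 //; exact: (g0 [::]).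
have [i mi] : exists i, (0 < m i)%N.
  apply/existsP; apply: contraT; rewrite negb_exists => /forallP mi.
  case/eqP: m0; apply/mnmP => i; rewrite mnm0E; apply/eqP.
  by rewrite -leqn0 leqNgt.
have mE : m = mnm_add (mnm_sub m (mnm1 i)) (mnm1 i) by rewrite submK // lep1mP -lt0n.
have cg1 h : `|h| < rho -> power_series_cvg (dcoef i c) h (partial i g h).
  by move=> /(sum_partial cg i) [].
have g1 (s : seq 'I_n) : iter_partial s (partial i g) 0 = 0.
  by have := g0 (rcons s i); rewrite /iter_partial foldr_rcons.
have := IH (mnm_sub m (mnm1 i)) _ _ cg1 g1; rewrite /dcoef -mE.
have -> : (mdeg (mnm_sub m (mnm1 i)) < k)%N.
  by rewrite -ltnS (leq_trans _ mk) // ltnS mE !mdegD mdeg1 addn1 mE addmK.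
by move=> /(_ isT)/eqP; rewrite mulf_eq0 pnatr_eq0 /= => /eqP.
Qed.

Lemma power_series_eq0 (c : multinom n -> R) h v :
  (forall m, c m = 0) -> power_series_cvg c h v -> v = 0.
Proof.
move=> c0 [_ cv]; apply: (cvg_unique _ cv) => //=.
apply: cvg_near_cst; near=> N; rewrite partial_sumE peval_sum big1 // => d _.
rewrite (_ : hpart c d = 0) ?peval0 //; apply/mpolyP => m.
by rewrite mcoeff_hpart c0 mcoeff0; case: ifP.
Unshelve. all: by end_near.
Qed.

Lemma iter_partial0 (s : seq 'I_n) : iter_partial s (fun=> 0) = (fun=> 0 : R).
Proof.
have -> : (fun=> 0) = peval (0 : mpoly n R) by apply/funext => x; rewrite peval0.
rewrite iter_partial_peval; congr peval.
by elim: s => //= i s ->; rewrite linear0.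
Qed.

(** The set [Z] of points of U where all derivatives vanish is open in U by the local expansions and
    closed in U by continuity of the derivatives. *)
Lemma analytic_identity U g : open U -> connected U -> analytic_on U g -> U 0 ->
  (forall s : seq 'I_n, iter_partial s g 0 = 0) -> forall x, U x -> g x = 0.
Proof.
move=> oU cU ag U0 g0.
pose Z := [set p | U p /\ forall s : seq 'I_n, iter_partial s g p = 0].
suff ZU : Z = U by move=> x; rewrite -ZU => -[_ /(_ [::])].
apply: cU; first by exists 0.
- exists (interior [set q | g q = 0]); first exact: open_interior.
  apply/seteqP; split => p [Up pz]; split => //.
    have [c [rho [rho0 cg]]] := ag p Up.
    have c0 : forall m, c m = 0.
      apply: (power_series_flat rho0 cg) => s.
      by rewrite iter_partial_shift addr0.
    apply/nbhs_ballP; exists rho => //= q; rewrite -ball_normE /ball_ /= distrC => qr.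
    by have := power_series_eq0 c0 (cg _ qr); rewrite addrC subrK.
  move=> s; have /= oI := @open_interior _ [set q | g q = 0].
  rewrite (iter_partial_eq (g := fun=> 0) s oI) ?iter_partial0 //.
  by move=> x /interior_subset.
- exists (closure Z); first exact: closed_closure.
  apply/seteqP; split => p; first by move=> pz; split; [case: pz|exact: subset_closure].
  move=> [Up cp]; split => // s; have cs := analytic_on_continuous (analytic_on_iter_partial s ag) Up.
  apply/eqP; rewrite -normr_le0; apply/ler_addgt0Pr => e e0; rewrite add0r.
  have C : \forall q \near p, `|iter_partial s g p - iter_partial s g q| <= e.
    exact: (@cvgr_dist_le _ _ _ _ _ _ _ cs _ e0).
  by have [q [[_ qz]]] := cp _ C; rewrite /= qz subr0.
Qed.

(** In the analytic case, a flat H would vanish on its connected domain, against nonconstancy. This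
    lets both regularities be treated as smooth and non-flat. *)
Lemma Cr_nonflat (r : regularity) U g : open U -> connected U -> U 0 -> Cr_on r U g ->
  g 0 = 0 -> (exists x y, [/\ U x, U y & g x != g y]) -> (r = Cinfty -> nonflat g) ->
  nonflat g.
Proof.
case: r => /= oU cU U0 ag g0 [x [y [Ux Uy gxy]]] nf; last exact: nf.
apply: contrapT => fl; have g0s (s : seq 'I_n) : iter_partial s g 0 = 0.
  have [m _] := iter_partial_taylor_coef s oU U0 (analytic_on_smooth ag); apply.
  by apply/eqP; apply: contraT => gm; case: fl; exists m.
have z := analytic_identity oU cU ag U0 g0s.
by move: gxy; rewrite !z // eqxx.
Qed.

End Analytic.

(** * Expansion of the vector field *)

Section FieldExpansion.
Variables (R : realType) (n : nat) (r : regularity) (A : 'M[R]_n).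
Variables (f : 'cV[R]_n -> 'cV[R]_n) (V : set 'cV[R]_n).
Hypothesis sys : system r A f V.
Implicit Types (x y : 'cV[R]_n).
Local Notation fc i := (fun x => f x i 0).

Lemma system_open : open V. Proof. by case: sys. Qed.
Lemma system_0 : V 0. Proof. by case: sys. Qed.

Lemma system_smooth (i : 'I_n) : smooth_on V (fc i).
Proof. by case: sys => _ _ h _; exact: Cr_on_smooth (h i). Qed.

Lemma system_iter_partial0 (i : 'I_n) (s : seq 'I_n) :
  (size s <= 1)%N -> iter_partial s (fc i) 0 = 0.
Proof.
move=> s1; have [m ms] := iter_partial_taylor_coef s system_open system_0 (system_smooth i).
by apply; case: sys => _ _ _; apply; rewrite ms.
Qed.

Lemma system_Oh2 (i : 'I_n) : Oh 2 (fc i).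
Proof.
apply: (flat_Oh system_open system_0 (system_smooth i)) => s s2.
exact: system_iter_partial0.
Qed.

Lemma system_partial_Oh1 (i j : 'I_n) : Oh 1 (partial j (fc i)).
Proof.
apply: (flat_Oh system_open system_0 (smooth_on_partial j (system_smooth i))).
by case=> // _; exact: (@system_iter_partial0 i [:: j]).
Qed.

Lemma system_at0 : f 0 = 0.
Proof.
apply/matrixP => i j; rewrite (ord1 j) mxE.
exact: (@system_iter_partial0 i [::]).
Qed.

Lemma dhomog_field_part (d : nat) (i : 'I_n) :
  field_part A f d i \is ishomog1 d mdeg.
Proof.
apply: rpredD; last exact: dhomog_hpart.
by case: eqP => [->|_]; [exact: dhomog_lin_form|exact: rpred0].
Qed.

Lemma field_part0 (i : 'I_n) : field_part A f 0 i = 0.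
Proof.
rewrite /field_part /= add0r; apply/mpolyP => m.
rewrite (mcoeff_hpart (taylor_coef (fc i))) mcoeff0; case: eqP => // m0.
by case: sys => _ _ _; apply; rewrite m0.
Qed.

Lemma field_part1 (i : 'I_n) : field_part A f 1 i = lin_form A i.
Proof.
rewrite /field_part /=; rewrite (_ : taylor_part 1 _ = 0) ?addr0 //; apply/mpolyP => m.
rewrite (mcoeff_hpart (taylor_coef (fc i))) mcoeff0; case: eqP => // m0.
by case: sys => _ _ _; apply; rewrite m0.
Qed.

Lemma field_Oh (N : nat) (i : 'I_n) :
  Oh N.+2 (fun x => vector_field A f x i 0 -
    peval (\sum_(e < N.+2) field_part A f e i) x).
Proof.
apply: Oh_eq (taylor_Oh N.+1 system_open system_0 (system_smooth i)) => x.
rewrite /vector_field mxE -peval_lin_form.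
rewrite [peval (\sum_(e < N.+2) field_part A f e i) x]peval_sum.
rewrite [peval (\sum_(e < N.+2) taylor_part e _) x]peval_sum.
have -> : \sum_(e < N.+2) peval (field_part A f e i) x =
    peval (lin_form A i) x + \sum_(e < N.+2) peval (taylor_part e (fc i)) x.
  rewrite (eq_bigr (fun e : 'I_N.+2 => (if e == 1%N :> nat then peval (lin_form A i) x else 0)
     + peval (taylor_part e (fc i)) x)) => [|e _]; last first.
    by rewrite /field_part pevalD; case: ifP => _; rewrite ?peval0.
  rewrite big_split /=; congr (_ + _).
  rewrite !big_ord_recl /= add0r big1 ?addr0 // => e _.
by rewrite opprD addrACA subrr add0r.
Qed.

Lemma field_lin_Oh2 (i : 'I_n) :
  Oh 2 (fun x => vector_field A f x i 0 - peval (lin_form A i) x).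
Proof.
apply: Oh_eq (system_Oh2 i) => x.
by rewrite /vector_field mxE peval_lin_form addrAC subrr add0r.
Qed.

End FieldExpansion.

(** * Nonvanishing at points tangent to a direction *)

Section Directional.
Variables (R : realType) (n : nat).
Implicit Types (x v : 'cV[R]_n) (p : mpoly n R).

Lemma peval_bounded p (r : R) : 0 <= r ->
  exists2 K, 0 <= K & forall x, `|x| <= r -> `|peval p x| <= K.
Proof.
move=> r0; exists (\sum_(m <- msupp p) `|mcoeff m p| * r ^+ mdeg m) => [|x xr].
  by apply: sumr_ge0 => m _; rewrite mulr_ge0 ?exprn_ge0.
rewrite peval_sumE; apply: (le_trans (ler_norm_sum _ _ _)).
apply: ler_sum => m _; rewrite normrM; apply: ler_wpM2l => //.
by apply: (le_trans (norm_monomial_le x m)); apply: lerXn2r; rewrite ?nnegrE.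
Qed.

Lemma peval_lipschitz p (r : R) : 0 <= r -> exists2 L, 0 <= L &
  forall x y, `|x| <= r -> `|y| <= r -> `|peval p x - peval p y| <= L * `|x - y|.
Proof.
move=> r0; have /choice [K hK] : forall i, exists K : R, 0 <= K /\
    forall x, `|x| <= r -> `|peval (mderiv i p) x| <= K.
  by move=> i; have [K K0 hK] := peval_bounded (mderiv i p) r0; exists K.
have K0 i : 0 <= K i by have [] := hK i.
exists (n%:R * \sum_i K i) => [|x y xr yr]; first by rewrite mulr_ge0 ?sumr_ge0.
apply: (box_lipschitz (r := r)) => // z i zr; split; first exact: derivable_peval.
rewrite partial_peval; apply: (le_trans ((hK i).2 z zr)).
by rewrite (bigD1 i) //= lerDl sumr_ge0.
Qed.

(** Scaled to norm one, x is at distance at most C |x| from some s v with |s| bounded below. There p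
    is s^k p(v) up to O(|x|), and at this scale the difference of phi and p is O(|x|) too. *)
Lemma directional_neq0 p (k : nat) v (C : R) (phi : 'cV[R]_n -> R) :
  p \is ishomog1 k mdeg -> peval p v != 0 -> 0 <= C ->
  Oh k.+1 (fun x => phi x - peval p x) ->
  exists2 e, 0 < e & forall x t, x != 0 -> `|x| < e ->
    `|x - t *: v| <= C * `|x| ^+ 2 -> phi x != 0.
Proof.
move=> hp pv C0 [C1 [e1 [C10 e10 hphi]]].
have [L L0 hL] := peval_lipschitz p (ler0n R 2).
(* A lower bound for |s|: once C |x| <= 1/2, the unit vector y being close to s v forces |s| |v| >=
   1/2. *)
pose s0 := (2 * (`|v| + 1))^-1.
have v1 : 0 < `|v| + 1 by rewrite ltr_wpDl.
have s00 : 0 < s0 by rewrite invr_gt0 mulr_gt0.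
have D0 : 0 < L * C + C1 + 1 by rewrite ltr_wpDl // addr_ge0 // mulr_ge0.
have d0 : 0 < s0 ^+ k * `|peval p v| / (L * C + C1 + 1).
  by rewrite divr_gt0 // mulr_gt0 ?exprn_gt0 // normr_gt0.
(* The second bound ensures C |x| <= 1/2; the third keeps the total error (L C + C1) |x| below s0^k
   |p(v)|. *)
exists (Num.min e1 (Num.min (2 * (C + 1))^-1
    (s0 ^+ k * `|peval p v| / (L * C + C1 + 1)))).
  by rewrite !lt_min e10 d0 invr_gt0 mulr_gt0 // ltr_wpDl.
move=> x t x0; rewrite !lt_min => /andP[xe1 /andP[xe2 xe3]] xt.
have nx : 0 < `|x| by rewrite normr_gt0.
pose y := `|x|^-1 *: x; pose s := `|x|^-1 * t.
have xy : x = `|x| *: y by rewrite scalerA mulfV ?scale1r // gt_eqF.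
have ny : `|y| = 1 by rewrite normrZ normfV normr_id mulVf // gt_eqF.
have ysv : `|y - s *: v| <= C * `|x|.
  rewrite -scalerA -scalerBr normrZ normfV normr_id.
  by rewrite -(ler_pM2l nx) mulVKf ?gt_eqF // mulrCA -expr2.
have Cx : C * `|x| <= 2^-1.
  move: xe2; rewrite -[_^-1]div1r ltr_pdivlMr ?mulr_gt0 ?ltr_wpDl //.
  by move=> h; have : 0 <= `|x| by []; nra.
have sv2 : `|s *: v| <= 2.
  rewrite -[s *: v](subrK y); apply: (le_trans (ler_normD _ _)).
  by rewrite ny distrC; lra.
have sv1 : 2^-1 <= `|s| * `|v|.
  rewrite -normrZ; have := ler_normD (y - s *: v) (s *: v).
  by rewrite subrK ny; lra.
have ss : s0 <= `|s|.
  rewrite /s0 invfM -ler_pdivlMr ?invr_gt0 // invrK.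
  by apply: (le_trans sv1); apply: ler_wpM2l => //; lra.
apply/eqP => phi0; have := hphi x xe1; rewrite phi0 sub0r normrN => hx.
have hy : `|peval p y| <= C1 * `|x|.
  move: hx; rewrite {1}xy (peval_homog _ _ hp) normrM normrX normr_id exprSr.
  by rewrite mulrCA ler_pM2l // exprn_gt0.
have hs : `|s| ^+ k * `|peval p v| <= (L * C + C1) * `|x|.
  rewrite -normrX -normrM -(peval_homog _ _ hp).
  rewrite -[peval p _](subrK (peval p y)); apply: (le_trans (ler_normD _ _)).
  rewrite mulrDl; apply: lerD => //; rewrite distrC -mulrA.
  apply: (le_trans (hL y (s *: v) _ _)) => //; first by rewrite ny ler1n.
  exact: ler_wpM2l.
have : s0 ^+ k * `|peval p v| <= (L * C + C1) * `|x|.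
  apply: le_trans hs; apply: ler_wpM2r => //.
  by apply: lerXn2r; rewrite ?nnegrE // ltW.
move: xe3; rewrite ltr_pdivlMr // => h1 h2.
by have := lt_le_trans h1 h2; rewrite mulrC ltr_pM2r //; lra.
Qed.

End Directional.

(** * The formal first integral *)

Section Splitting.
Variables (R : realType) (n : nat) (A : 'M[R]_n.+1).
Variables (v : 'cV[R]_n.+1) (l : 'rV[R]_n.+1) (S : 'M[R]_n.+1).
Hypotheses (Av : A *m v = 0) (lA : l *m A = 0) (lv : l *m v = 1%:M).
Hypothesis vlAS : 1%:M - v *m l = A *m S.

(** [S] inverts A on the right only modulo v. Projecting its values along v onto the kernel of l,
    and adding the identity on v, gives the inverse of A + v l. *)
Definition bordered_inv : 'M[R]_n.+1 := (1%:M - v *m l) *m S + v *m l.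

Lemma vlvl : v *m l *m (v *m l) = v *m l.
Proof. by rewrite -mulmxA [l *m _]mulmxA lv mul1mx. Qed.

Lemma mul_bordered_inv : bordered_inv *m (A + v *m l) = 1%:M.
Proof.
suff /mulmx1C : (A + v *m l) *m bordered_inv = 1%:M by [].
have AE : A *m (v *m l) = 0 by rewrite mulmxA Av mul0mx.
have EP : v *m l *m (1%:M - v *m l) = 0 by rewrite mulmxBr mulmx1 vlvl subrr.
have AP : A *m (1%:M - v *m l) = A by rewrite mulmxBr mulmx1 AE subr0.
move: vlAS AE EP AP vlvl; rewrite /bordered_inv; set E := v *m l.
set P := 1%:M - E => PAS AE EP AP EE.
by rewrite mulmxDl !mulmxDr EE AE addr0 !mulmxA AP EP mul0mx add0r -PAS subrK.
Qed.

Lemma bordered_inv_v : bordered_inv *m v = v.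
Proof.
have {1}-> : v = (A + v *m l) *m v.
  by rewrite mulmxDl Av add0r -mulmxA lv mulmx1.
by rewrite mulmxA mul_bordered_inv mul1mx.
Qed.

Lemma l_bordered_inv : l *m bordered_inv = l.
Proof.
have {1}-> : l = l *m (A + v *m l).
  by rewrite mulmxDr lA add0r mulmxA lv mul1mx.
by rewrite -mulmxA (mulmx1C mul_bordered_inv) mulmx1.
Qed.

(** With w = f x, which is of second order, this makes singular points tangent to v at the
    origin. *)
Lemma singular_decomposition (x w : 'cV[R]_n.+1) : A *m x + w = 0 ->
  x - (l *m x) 0 0 *: v = - (bordered_inv *m w).
Proof.
move=> /eqP; rewrite addr_eq0 => /eqP Ax.
have xE : x = bordered_inv *m ((A + v *m l) *m x).
  by rewrite mulmxA mul_bordered_inv mul1mx.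
have MxE : (A + v *m l) *m x = - w + (l *m x) 0 0 *: v.
  by rewrite mulmxDl Ax -mulmxA {1}[l *m x]mx11_scalar mul_mx_scalar.
by rewrite {1}xE MxE mulmxDr -scalemxAr bordered_inv_v addrK mulmxN.
Qed.

Lemma Lie_lpow1 : Lie A (lpow l 1) = 0.
Proof.
rewrite /Lie /lpow expr1.
have -> : \sum_(i < n.+1) mderiv i (\sum_(j < n.+1) l 0 j *: mpolyX R (mnm1 j))
    * lin_form A i = \sum_(i < n.+1) l 0 i *: lin_form A i.
  apply: eq_bigr => i _.
  have -> : \sum_(j < n.+1) l 0 j *: mpolyX R (mnm1 j) =
      lin_form (\matrix_(_, j) l 0 j) i by apply: eq_bigr => j _; rewrite mxE.
  by rewrite mderiv_lin_form mxE -scalerAl mul1r.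
rewrite /lin_form; under eq_bigr => i _ do rewrite scaler_sumr.
rewrite exchange_big big1 // => j _ /=.
under eq_bigr => i _ do rewrite scalerA.
rewrite -scaler_suml; have /matrixP /(_ 0 j) := lA; rewrite !mxE => ->.
by rewrite scale0r.
Qed.

End Splitting.

Lemma mulmx_Oh (R : realType) (n : nat) (B : 'M[R]_n) (f : 'cV[R]_n -> 'cV[R]_n) (k : nat) :
  (forall i, Oh k (fun x => f x i 0)) ->
  exists C e : R, [/\ 0 <= C, 0 < e & forall x, `|x| < e -> `|B *m f x| <= C * `|x| ^+ k].
Proof.
move=> fO; have [C [e [C0 e0 hC]]] : Oh k (fun x => \sum_(i < n) `|(B *m f x) i 0|).
  apply: Oh_sum => i _.
  have [C [e [C0 e0 h]]] : Oh k (fun x => \sum_(j < n) B i j * f x j 0).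
    by apply: Oh_sum => j _; exact: OhZ.
  by exists C, e; split => // x /h; rewrite mxE normr_id.
exists C, e; split => // x xe; apply: norm_le_coord => [|i].
  by rewrite mulr_ge0 // exprn_ge0.
apply: le_trans (hC x xe); apply: le_trans (ler_norm _).
by rewrite (bigD1 i) //= lerDl sumr_ge0.
Qed.

Section FormalIntegral.
Variables (R : realType) (n : nat) (r : regularity) (A : 'M[R]_n.+1).
Variables (f : 'cV[R]_n.+1 -> 'cV[R]_n.+1) (V : set 'cV[R]_n.+1).
Hypothesis sys : system r A f V.
Hypothesis spA : spectrum_condition A.
Hypothesis sing : forall e : R, 0 < e ->
  exists p, [/\ p != 0, `|p| < e & vector_field A f p = 0].
Implicit Types (H : nat -> mpoly n.+1 R).

Definition field_term H (k d : nat) : mpoly n.+1 R :=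
  \sum_(i < n.+1) mderiv i (H k) * field_part A f (d.+1 - k) i.

(** Here the truncated subtraction in [field_term] gives the index 0, and the field has no constant
    part. *)
Lemma field_term_big H k d : (d < k)%N -> field_term H k d = 0.
Proof.
rewrite /field_term => dk; rewrite big1 // => i _.
by rewrite (eqP (_ : d.+1 - k == 0)%N) ?subn_eq0 // (field_part0 sys) mulr0.
Qed.

Lemma field_term_diag H d : field_term H d d = Lie A (H d).
Proof.
rewrite /field_term /Lie; apply: eq_bigr => i _.
by rewrite subSnn (field_part1 sys).
Qed.

Lemma sum_field_term H (k d : nat) : (d < k)%N ->
  \sum_(j < k) field_term H j d = \sum_(j < d.+1) field_term H j d.
Proof.
move=> dk; rewrite -!(big_mkord xpredT (fun j => field_term H j d)).
rewrite (big_cat_nat _ (n := d.+1)) //= [X in _ + X]big_nat_cond.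
rewrite [X in _ + X]big1 ?addr0 // => j /andP[/andP[dj _] _].
exact: field_term_big.
Qed.

Lemma dhomog_field_term H (k d : nat) : H k \is ishomog1 k mdeg -> H 0%N = 0 ->
  (k <= d)%N -> field_term H k d \is ishomog1 d mdeg.
Proof.
move=> hH H0 kd; apply: rpred_sum => i _.
case: k hH kd => [|k] hH kd; first by rewrite H0 linear0 mul0r rpred0.
have -> : d = (k + (d.+1 - k.+1))%N by rewrite subSS subnKC // ltnW.
rewrite [X in field_part _ _ X _](_ : _ = (d.+1 - k.+1)%N); last by rewrite !subSS subnKC // ltnW.
apply: dhomogM; first exact: (dhomog_mderiv i hH).
exact: dhomog_field_part.
Qed.

(** The gradient of H_k is O(|x|^(k-1)), so the field is expanded only through degree d + 1 - k,
    with an error O(|x|^(d+2-k)). *)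
Lemma field_term_Oh H (k d : nat) : H k \is ishomog1 k mdeg -> H 0%N = 0 ->
  (k <= d)%N ->
  Oh d.+1 (fun x => \sum_(i < n.+1) peval (mderiv i (H k)) x * vector_field A f x i 0
    - peval (\sum_(j < d.+1) field_term H k j) x).
Proof.
case: k => [|k] hH H0 kd.
  apply: Oh_eq (@Oh0 _ _ _) => x; rewrite big1 => [|i _]; last by rewrite H0 linear0 peval0 mul0r.
  rewrite big1 ?peval0 ?subrr // => j _.
  by rewrite /field_term big1 // => i _; rewrite H0 linear0 mul0r.
pose N := (d - k.+1)%N.
have dE : d.+1 = (k + N.+2)%N by rewrite /N !addnS -addSn subnKC.
have reidx i : \sum_(j < d.+1) mderiv i (H k.+1) * field_part A f (j.+1 - k.+1) i =
    \sum_(e < N.+2) mderiv i (H k.+1) * field_part A f e i.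
  rewrite -(big_mkord xpredT (fun j => mderiv i (H k.+1) * field_part A f (j.+1 - k.+1) i)).
  rewrite -(big_mkord xpredT (fun e => mderiv i (H k.+1) * field_part A f e i)).
  rewrite (big_cat_nat _ (n := k)) //= ?dE ?leq_addr // [X in X + _]big_nat_cond.
  rewrite [X in X + _]big1 ?add0r => [|j /andP[/andP[_ jk] _]]; last first.
    by rewrite subSS (eqP (_ : j - k == 0)%N) ?subn_eq0 ?(ltnW jk) // (field_part0 sys) mulr0.
  rewrite -{1}[k]add0n big_addn addKn; apply: eq_bigr => j _.
  by rewrite subSS addnK.
have -> : \sum_(j < d.+1) field_term H k.+1 j =
   \sum_(i < n.+1) mderiv i (H k.+1) * \sum_(e < N.+2) field_part A f e i.
  rewrite exchange_big; apply: eq_bigr => i _ /=.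
  by rewrite reidx mulr_sumr.
apply: (@Oh_eq _ _ _ (fun x => \sum_(i < n.+1) peval (mderiv i (H k.+1)) x *
   (vector_field A f x i 0 - peval (\sum_(e < N.+2) field_part A f e i) x))).
  move=> x; rewrite peval_sum -sumrB; apply: eq_bigr => i _.
  by rewrite pevalM mulrBr.
apply: Oh_sum => i _; rewrite dE; apply: OhM; last exact: (field_Oh sys).
exact: Oh_homog (dhomog_mderiv i hH).
Qed.

Lemma obstruction_vanishes H (d : nat) v l S :
  A *m v = 0 -> l *m A = 0 -> l *m v = 1%:M -> 1%:M - v *m l = A *m S ->
  H 0%N = 0 -> (forall k, (k < d)%N -> H k \is ishomog1 k mdeg) ->
  (forall k, (k < d)%N -> \sum_(j < k.+1) field_term H j k = 0) ->
  peval (\sum_(j < d) field_term H j d) v = 0.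
Proof.
move=> Av lA lv vlAS H0 hH eqH; apply/eqP; apply: contraT => Qv.
set Q := \sum_(j < d) _ in Qv.
have hQ : Q \is ishomog1 d mdeg.
  by apply: rpred_sum => j _; apply: dhomog_field_term => //; [exact: hH|exact: ltnW].
pose phi x := \sum_(j < d) \sum_(i < n.+1)
  peval (mderiv i (H j)) x * vector_field A f x i 0.
have phiO : Oh d.+1 (fun x => phi x - peval Q x).
  have -> : Q = \sum_(j < d) \sum_(k < d.+1) field_term H j k.
    rewrite exchange_big big_ord_recr /= big1 ?add0r // => k _.
    by rewrite sum_field_term ?eqH.
  have hO : Oh d.+1 (fun x => \sum_(j < d) (
      \sum_(i < n.+1) peval (mderiv i (H j)) x * vector_field A f x i 0
      - peval (\sum_(k < d.+1) field_term H j k) x)).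
    by apply: Oh_sum => j _; apply: field_term_Oh => //; [exact: hH|exact: ltnW].
  by apply: Oh_eq hO => x; rewrite sumrB -peval_sum.
have [C [e0 [C0 e00 hC]]] := mulmx_Oh (bordered_inv v l S) (system_Oh2 sys).
have [e e_gt0 he] := directional_neq0 hQ Qv C0 phiO.
have [|p [p0 pe Fp]] := sing (e := Num.min e0 e); first by rewrite lt_min e00.
move: pe; rewrite lt_min => /andP[pe0 pe].
have := he p ((l *m p) 0 0) p0 pe.
rewrite (singular_decomposition Av lv vlAS Fp) normrN => /(_ (hC p pe0)).
rewrite /phi big1 ?eqxx // => j _; rewrite big1 // => i _.
by rewrite Fp mxE mulr0.
Qed.

Lemma formal_integral_of_singular_points :
  exists H, formal_first_integral A f H.
Proof.
have [v [l [S [Av lA lv vlAS]]]] := spectrum_splitting spA.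
pose good (H : nat -> mpoly n.+1 R) d G := G \is ishomog1 d mdeg /\
  Lie A G = - \sum_(j < d) field_term H j d.
(* Each part depends on all earlier ones, so the recursion carries their list. Degree 1 is set by
   hand because 0 also solves its equation; from degree 2 on a solution is chosen, its existence
   being shown along with [goodH]. *)
pose step (s : seq (mpoly n.+1 R)) : mpoly n.+1 R :=
  if size s == 0%N then 0 else if size s == 1%N then lpow l 1
  else xget 0 (good (nth 0 s) (size s)).
pose build := fix F k := if k is k'.+1 then rcons (F k') (step (F k')) else [::].
have size_build k : size (build k) = k by elim: k => //= k IH; rewrite size_rcons IH.
pose H d := nth 0 (build d.+1) d.
have HE d : H d = step (build d).
  by rewrite /H /= nth_rcons size_build ltnn eqxx.
have nth_build k d : (d < k)%N -> nth 0 (build k) d = H d.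
  elim: k => // k IH; rewrite ltnS leq_eqVlt => /orP[/eqP -> //|dk].
  by rewrite /= nth_rcons size_build dk IH.
have H0 : H 0%N = 0 by rewrite HE /step size_build eqxx.
have H1 : H 1%N = lpow l 1 by rewrite HE /step size_build.
have goodH d : good H d (H d).
  have [k] := ubnP d; elim: k d => // k IH d; rewrite ltnS => dk.
  have IHd j : (j < d)%N -> good H j (H j).
    by move=> jd; apply: IH; exact: leq_trans jd dk.
  case: d dk IHd => [|[|d]] dk IHd.
  - by split; rewrite H0 ?rpred0 // linear0 big_ord0 oppr0.
  - split; first by rewrite H1 dhomog_lpow.
    rewrite H1 (Lie_lpow1 lA) big_ord_recl big_ord0 addr0 /field_term big1 ?oppr0 //.
    by move=> i _; rewrite H0 linear0 mul0r.
  have goodE G : good (nth 0 (build d.+2)) d.+2 G = good H d.+2 G.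
    rewrite /good (eq_bigr (fun j : 'I_d.+2 => field_term H j d.+2)) // => j _.
    by rewrite /field_term nth_build.
  have hH j : (j < d.+2)%N -> H j \is ishomog1 j mdeg by move=> /IHd [].
  have eqH j : (j < d.+2)%N -> \sum_(i < j.+1) field_term H i j = 0.
    move=> /IHd [_ LH]; rewrite big_ord_recr /= field_term_diag LH.
    exact: subrr.
  have Qv := obstruction_vanishes Av lA lv vlAS H0 hH eqH.
  have [||G hG LG] := @Lie_solve _ _ A v l S spA Av lv vlAS d.+2
    (- \sum_(j < d.+2) field_term H j d.+2).
  - rewrite rpredN; apply: rpred_sum => j _.
    by apply: dhomog_field_term => //; [exact: hH|exact: ltnW].
  - by rewrite -scaleN1r pevalZ Qv mulr0.
  rewrite [X in good _ _ X]HE /step size_build /= -goodE.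
  by apply: (xgetPex 0); exists G; rewrite goodE.
exists H; split => //; first by move=> d; have [] := goodH d.
  exists 1%N; rewrite H1; apply/eqP => l0.
  have := peval_lpow l 1 v; rewrite l0 peval0 lv mxE eqxx expr1 => /esym/eqP.
  by rewrite oner_eq0.
move=> d; have -> : \sum_(k < d.+2) \sum_(i < n.+1)
    mderiv i (H k) * field_part A f (d.+1 - k) i = \sum_(k < d.+2) field_term H k d by [].
rewrite sum_field_term // big_ord_recr /= field_term_diag.
by have [_ ->] := goodH d; exact: subrr.
Qed.

End FormalIntegral.

(** Continuity brings the points of the curve close to 0 and injectivity keeps them different from
    0; the formal construction sees the curve in this form. *)
Lemma curve_singular_points (R : realType) (n : nat) (A : 'M[R]_n) f V :
  has_singular_curve A f V -> forall e : R, 0 < e ->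
  exists p, [/\ p != 0, `|p| < e & vector_field A f p = 0].
Proof.
move=> [eps [gamma [eps0 cg ig g0 sg]]] e e0.
have in0 : 0 \in `]- eps, eps[ by rewrite in_itv /= oppr_lt0 eps0.
have C : \forall t \near (0 : R), `|gamma 0 - gamma t| < e.
  exact: (@cvgr_dist_lt _ _ _ _ _ _ _ (cg 0 in0) _ e0).
have /nbhs_ballP [d d0 hd] := C.
pose t := Num.min d eps / 2.
have m0 : 0 < Num.min d eps by rewrite lt_min d0.
have t0 : 0 < t by rewrite divr_gt0.
have td : t < d by apply: (@lt_le_trans _ _ (Num.min d eps)); [rewrite /t; lra|rewrite ge_min lexx].
have te : t < eps by apply: (@lt_le_trans _ _ (Num.min d eps)); [rewrite /t; lra|rewrite ge_min lexx orbT].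
have int : t \in `]- eps, eps[ by rewrite in_itv /= te andbT; lra.
exists (gamma t); split.
- apply: contraTneq t0 => gt0; rewrite -leNgt le_eqVlt; apply/orP; left.
  by apply/eqP; apply: ig => //; rewrite gt0 g0.
- have := hd t; rewrite -ball_normE /ball_ /= sub0r normrN g0 sub0r normrN.
  by apply; rewrite gtr0_norm.
- by have [] := sg t int.
Qed.

(** * The invariant curve *)

(** Joins completeness with the normed structure on column vectors, for the Banach fixed point
    theorem. *)
HB.instance Definition _ (R : realType) (n : nat) := Complete.on (matrix R n 1).

Section InvariantCurve.
Variables (R : realType) (n : nat) (r : regularity) (A : 'M[R]_n.+1).
Variables (f : 'cV[R]_n.+1 -> 'cV[R]_n.+1) (V : set 'cV[R]_n.+1).
Variables (v : 'cV[R]_n.+1) (l : 'rV[R]_n.+1) (S : 'M[R]_n.+1).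
Hypothesis sys : system r A f V.
Hypotheses (Av : A *m v = 0) (lA : l *m A = 0) (lv : l *m v = 1%:M).
Hypothesis vlAS : 1%:M - v *m l = A *m S.
Implicit Types (x y : 'cV[R]_n.+1).

(** The projection along v is composed in so that K vanishes on v. *)
Let K : 'M[R]_n.+1 := bordered_inv v l S *m (1%:M - v *m l).

Lemma lK : l *m K = 0.
Proof.
rewrite /K mulmxA (l_bordered_inv Av lA lv vlAS) mulmxBr mulmx1 mulmxA lv.
by rewrite mul1mx subrr.
Qed.

Lemma AK : A *m K = 1%:M - v *m l.
Proof.
have : (A + v *m l) *m K = 1%:M - v *m l.
  by rewrite /K mulmxA (mulmx1C (mul_bordered_inv Av lv vlAS)) mul1mx.
by rewrite mulmxDl -[v *m l *m K]mulmxA lK mulmx0 addr0.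
Qed.

(** Apply l and A to the equation: l K = 0 makes t the coordinate along v, and A K = 1 - v l cancels
    every component of f x except the one along v. *)
Lemma fixed_point_field x (t : R) : x = t *: v - K *m f x ->
  (l *m x) 0 0 = t /\ vector_field A f x = (l *m f x) 0 0 *: v.
Proof.
move=> xE; split.
  by rewrite xE mulmxBr mulmxA lK mul0mx subr0 -scalemxAr lv !mxE eqxx mulr1.
rewrite /vector_field {1}xE mulmxBr -scalemxAr Av scaler0 sub0r mulmxA AK.
rewrite mulmxBl mul1mx opprB subrK -mulmxA {1}[l *m f x]mx11_scalar.
by rewrite mul_mx_scalar.
Qed.

Lemma small_lipschitz (e : R) : 0 < e -> exists rho : R, [/\ 0 < rho, rho < e &
  forall x y, `|x| <= rho -> `|y| <= rho ->
    `|K *m f x - K *m f y| <= 2^-1 * `|x - y|].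
Proof.
move=> e0; pose k := \sum_i \sum_j `|K i j|.
have k0 : 0 <= k by apply: sumr_ge0 => i _; apply: sumr_ge0.
have [C [e1 [C0 e10 hC]]] : Oh 1 (fun x => \sum_i \sum_j
    `|partial j (fun x => f x i 0) x|).
  apply: Oh_sum => i _; apply: Oh_sum => j _.
  have [C [e1 [C0 e10 h]]] := system_partial_Oh1 sys i j.
  by exists C, e1; split => // x /h; rewrite normr_id.
have [e2 e20 he2] := open_ball0 (system_open sys) (system_0 sys).
(* The factors come from the number of coordinates in [box_lipschitz], the entries of K and the
   derivatives of f; the 2 produces the contraction factor 1/2. *)
pose D := 2 * n.+1%:R * (k + 1) * (C + 1).
have D0 : 0 < D by rewrite !mulr_gt0 // ltr_wpDl.
pose rho := Num.min (Num.min e e1) (Num.min e2 D^-1) / 2.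
have m0 : 0 < Num.min (Num.min e e1) (Num.min e2 D^-1).
  by rewrite !lt_min e0 e10 e20 invr_gt0.
have rho0 : 0 < rho by rewrite divr_gt0.
have : rho < Num.min (Num.min e e1) (Num.min e2 D^-1) by rewrite /rho; lra.
rewrite !lt_min => /andP[/andP[re re1] /andP[re2 rD]].
exists rho; split => // x y xr yr.
have flip i : `|f x i 0 - f y i 0| <= n.+1%:R * (C * rho) * `|x - y|.
  apply: (@box_lipschitz R n.+1 (fun x => f x i 0) rho) => // z j zr.
  have ze := le_lt_trans zr re1; split.
    apply: (@smooth_on_derivable _ _ V _ z j (system_smooth sys i)).
    by apply: he2; exact: le_lt_trans zr re2.
  have := hC z ze; rewrite expr1 => h.
  apply: (@le_trans _ _ (C * `|z|)); last exact: ler_wpM2l.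
  apply: le_trans h; apply: le_trans (ler_norm _).
  rewrite (bigD1 i) //= (bigD1 j) //= -addrA lerDl.
  by apply: addr_ge0; apply: sumr_ge0 => // i' _; apply: sumr_ge0.
rewrite -mulmxBr; apply: norm_le_coord => [|i]; first by rewrite mulr_ge0 ?invr_ge0.
rewrite mxE; apply: (le_trans (ler_norm_sum _ _ _)).
apply: (@le_trans _ _ (k * (n.+1%:R * (C * rho) * `|x - y|))).
  apply: (@le_trans _ _ (\sum_j `|K i j| * (n.+1%:R * (C * rho) * `|x - y|))).
    apply: ler_sum => j _; rewrite normrM; apply: ler_wpM2l => //.
    by rewrite !mxE; exact: flip.
  rewrite -mulr_suml; apply: ler_wpM2r.
    by rewrite !mulr_ge0 // ltW.
  by rewrite /k [leRHS](bigD1 i) //= lerDl; apply: sumr_ge0 => i' _; apply: sumr_ge0.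
rewrite [k * (_ * `|x - y|)]mulrA; apply: ler_wpM2r => //.
have : rho * D < 1 by rewrite -ltr_pdivlMr // div1r.
have h1 : 0 <= n.+1%:R * rho by rewrite mulr_ge0 // ltW.
have h2 : k * C <= (k + 1) * (C + 1) by nra.
rewrite /D => h3.
have -> : k * (n.+1%:R * (C * rho)) = n.+1%:R * rho * (k * C) by ring.
apply: (@le_trans _ _ (n.+1%:R * rho * ((k + 1) * (C + 1)))); first exact: ler_wpM2l.
have -> : n.+1%:R * rho * ((k + 1) * (C + 1)) =
   2^-1 * (rho * (2 * n.+1%:R * (k + 1) * (C + 1))) by field.
by rewrite -[leRHS]mulr1 ler_pM2l ?invr_gt0 // ltW.
Qed.

(** The uniform contraction factor 1/2 alone gives the Lipschitz dependence on t, without an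
    implicit function theorem. The curve is not claimed to be a trajectory; along it the field is
    parallel to v by [fixed_point_field]. *)
Lemma invariant_curve (e : R) : 0 < e -> exists (eps : R) (X : R -> 'cV[R]_n.+1),
  [/\ 0 < eps, forall t, `|t| < eps -> `|X t| < e,
      X 0 = 0, forall t, `|t| < eps -> X t = t *: v - K *m f (X t)
    & forall s t, `|s| < eps -> `|t| < eps -> `|X s - X t| <= 2 * `|v| * `|s - t|].
Proof.
move=> e0; have [rho [rho0 rhoe hl]] := small_lipschitz e0.
have v1 : 0 < `|v| + 1 by rewrite ltr_wpDl.
(* Then |t v| <= rho/2, and K f contributes at most rho/2 on the ball of radius rho, which is
   therefore mapped into itself. *)
pose eps := rho / (2 * (`|v| + 1)).
have eps0 : 0 < eps by rewrite divr_gt0 // mulr_gt0.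
pose B := [set x : 'cV[R]_n.+1 | `|x| <= rho].
have /choice [X hX] : forall t, exists x, `|t| < eps -> `|x| <= rho /\ x = t *: v - K *m f x.
  move=> t; have [te|_] := ltP `|t| eps; last by exists 0.
  pose T x := t *: v - K *m f x.
  have TB : {homo T : x / B x >-> B x}.
    move=> x; rewrite /B /= => xr; apply: (le_trans (ler_normB _ _)).
    have := hl x 0 xr; rewrite normr0 => /(_ (ltW rho0)).
    rewrite (system_at0 sys) mulmx0 !subr0 normrZ => h.
    have : `|t| * `|v| <= rho / 2.
      move: te; rewrite ltr_pdivlMr ?mulr_gt0 // => te.
      by have : 0 <= `|t| by []; nra.
    by move: xr h; lra.
  have contr : is_contraction (mkfun_fun TB).
    have h12 : (0 : R) <= 2^-1 by rewrite invr_ge0.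
    exists (NngNum h12); split; first by rewrite /= invf_lt1 // ltr1n.
    move=> [x y] [/= xr yr]; rewrite /mkfun /T /=.
    have -> : t *: v - K *m f x - (t *: v - K *m f y) = K *m f y - K *m f x.
      by rewrite opprB addrC addrA subrK.
    by rewrite distrC; exact: hl.
  have clB : closed B.
    apply: (@preimage_closed _ _ (fun x : 'cV[R]_n.+1 => `|x|) [set y | y <= rho]).
      by move=> x _; exact: norm_continuous.
    exact: closed_le.
  have [|x xr xE] := banach_fixed_point contr clB.
    by exists 0; rewrite /B /= normr0 ltW.
  by exists x.
exists eps, X; split => //.
- by move=> t /hX [h _]; exact: le_lt_trans rhoe.
- have [|Xr XE] := hX 0; first by rewrite normr0.
  have := hl (X 0) 0 Xr; rewrite normr0 => /(_ (ltW rho0)).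
  rewrite (system_at0 sys) mulmx0 !subr0 -normrN.
  have {1}-> : - (K *m f (X 0)) = X 0 by rewrite {2}XE scale0r sub0r.
  by move=> h; apply/eqP; rewrite -normr_le0; lra.
- by move=> t /hX [].
move=> s t /hX [sr sE] /hX [tr tE].
have : `|X s - X t| <= `|s - t| * `|v| + 2^-1 * `|X s - X t|.
  rewrite {1}sE {1}tE.
  have -> : s *: v - K *m f (X s) - (t *: v - K *m f (X t)) =
      (s - t) *: v - (K *m f (X s) - K *m f (X t)).
    by rewrite scalerBl !opprD !opprK addrACA.
  by apply: (le_trans (ler_normB _ _)); rewrite normrZ; apply: lerD => //; exact: hl.
by lra.
Qed.

(** The hypothesis isolates what a first integral has to supply: near 0, the field vanishes at the
    points of the curve, where it is already parallel to v. Injectivity holds because l recovers the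
    parameter. *)
Lemma singular_curve (e : R) : 0 < e ->
  (forall x, x != 0 -> `|x| < e -> vector_field A f x = (l *m f x) 0 0 *: v ->
     `|x - (l *m x) 0 0 *: v| <= `|K *m f x| -> vector_field A f x = 0) ->
  has_singular_curve A f V.
Proof.
move=> e0 he; have [e2 e20 he2] := open_ball0 (system_open sys) (system_0 sys).
have [|eps [X [eps0 Xe X0 XE Xl]]] := @invariant_curve (Num.min e e2).
  by rewrite lt_min e0.
have itvE t : (t \in `]- eps, eps[) = (`|t| < eps) by rewrite in_itv /= ltr_norml.
have lX t : `|t| < eps -> (l *m X t) 0 0 = t.
  by move=> te; have [] := fixed_point_field (XE t te).
exists eps, X; split => //.
- move=> t; rewrite itvE => te; apply/(@cvgrPdist_le _ _ _ _ (nbhs_filter t)) => d d0.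
  have D0 : 0 < 2 * `|v| + 1 by rewrite ltr_wpDl // mulr_ge0.
  apply/nbhs_ballP; exists (Num.min (eps - `|t|) (d / (2 * `|v| + 1))) => /=.
    by rewrite lt_min subr_gt0 te divr_gt0.
  move=> s; rewrite -ball_normE /ball_ /= lt_min => /andP[st1 st2].
  have se : `|s| < eps.
    by rewrite -[s](subrK t); apply: (le_lt_trans (ler_normD _ _)); rewrite distrC; lra.
  apply: (le_trans (Xl t s te se)); move: st2; rewrite ltr_pdivlMr // => st2.
  by have : 0 <= `|t - s| by []; nra.
- by move=> s t; rewrite !itvE => /lX {2}<- /lX {2}<- ->.
- move=> t; rewrite itvE => te; have := Xe t te; rewrite lt_min => /andP[Xte Xt2].
  split; first exact: he2.
  have [t0|t0] := eqVneq (X t) 0.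
    by rewrite /vector_field t0 mulmx0 (system_at0 sys) addr0.
  have [lt Ft] := fixed_point_field (XE t te).
  apply: he => //; rewrite lt {1}XE // addrAC subrr sub0r normrN; exact: lexx.
Qed.

End InvariantCurve.

Lemma taylor_partial_Oh (R : realType) (n : nat) (U : set 'cV[R]_n) g (N : nat)
    (i : 'I_n) :
  open U -> U 0 -> smooth_on U g ->
  Oh N.+1 (fun x => partial i g x -
    peval (mderiv i (\sum_(d < N.+2) taylor_part d g)) x).
Proof.
move=> oU U0 sg.
apply: Oh_eq (taylor_Oh N oU U0 (smooth_on_partial i sg)) => x.
congr (_ - peval _ x); apply/mpolyP => m.
have -> : mderiv i (\sum_(d < N.+2) taylor_part d g) =
    \sum_(d < N.+1) hpart (dcoef i (taylor_coef g)) d by exact: mderiv_sum_hpart.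
rewrite (mcoeff_sum_hpart (taylor_coef (partial i g))) mcoeff_sum_hpart.
by rewrite (taylor_coef_partial _ _ oU U0 sg).
Qed.

(** * The lowest part of a first integral *)

Section FirstIntegral.
Variables (R : realType) (n : nat) (r : regularity) (A : 'M[R]_n.+1).
Variables (f : 'cV[R]_n.+1 -> 'cV[R]_n.+1) (V U : set 'cV[R]_n.+1).
Variable H : 'cV[R]_n.+1 -> R.
Hypothesis sys : system r A f V.
Hypotheses (oU : open U) (U0 : U 0) (sH : smooth_on U H) (nfH : nonflat H).
Hypotheses (H0 : H 0 = 0)
  (FH : forall x, U x -> inner (gradient H x) (vector_field A f x) = 0).

Lemma lowest_part : exists k : nat, [/\ (0 < k)%N, taylor_part k H != 0
  & forall i, Oh k (fun x => partial i H x - peval (mderiv i (taylor_part k H)) x)].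
Proof.
have ex : exists k, taylor_part k H != 0.
  have [m Hm] := nfH; exists (mdeg m); apply: contraNneq Hm => h0.
  have := congr1 (mcoeff m) h0.
  by rewrite (mcoeff_hpart (taylor_coef H)) eqxx mcoeff0 => ->.
pose k := ex_minn ex; have kP : taylor_part k H != 0 by rewrite /k; case: ex_minnP.
have kmin d : (d < k)%N -> taylor_part d H = 0.
  rewrite /k; case: ex_minnP => k' _ min dk; apply/eqP; apply: contraLR dk => hd.
  by rewrite -leqNgt min.
have k0 : (0 < k)%N.
  rewrite lt0n; apply: contraNneq kP => ->; apply/eqP/mpolyP => m.
  rewrite (mcoeff_hpart (taylor_coef H)) mcoeff0; case: eqP => // /eqP.
  rewrite mdeg_eq0 => /eqP ->.
  rewrite /taylor_coef; have -> : flatten [seq nseq (mnm0 i) i | i <- enum 'I_n.+1] = [::].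
    by elim: (enum _) => //= i s ->; rewrite mnm0E.
  by rewrite /= H0 mul0r.
exists k; split => // i.
have [N kE] : exists N, k = N.+1 by exists k.-1; rewrite prednK.
have := taylor_partial_Oh N i oU U0 sH; rewrite -kE.
apply: Oh_eq => x; congr (_ - peval (mderiv i _) x).
by rewrite big_ord_recr /= big1 ?add0r // => d _; exact: kmin.
Qed.

(** It is the part of degree k of the first integral equation: every other product of a gradient
    term and a field term is O(|x|^(k+1)). *)
Lemma Lie_lowest_part (k : nat) : (0 < k)%N ->
  (forall i, Oh k (fun x => partial i H x - peval (mderiv i (taylor_part k H)) x)) ->
  Lie A (taylor_part k H) = 0.
Proof.
move=> k0 dO; have hh := dhomog_hpart (taylor_coef H) k.
apply: (peval_homog_Oh_eq0 (dhomog_Lie A hh)).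
have [e e0 he] := open_ball0 oU U0.
apply: (@Oh_ext _ _ _ (fun x => \sum_i (peval (mderiv i (taylor_part k H)) x
   * peval (lin_form A i) x - partial i H x * vector_field A f x i 0)) _ e e0).
  move=> x xe; rewrite sumrB peval_sum.
  have -> : \sum_i partial i H x * vector_field A f x i 0 = 0.
    transitivity (inner (gradient H x) (vector_field A f x)); last exact: FH (he x xe).
    by rewrite /inner; apply: eq_bigr => i _; rewrite [in RHS]mxE.
  by rewrite subr0; apply: eq_bigr => i _; rewrite pevalM.
apply: Oh_sum => i _.
have h1 : Oh k.+1 (fun x => (partial i H x - peval (mderiv i (taylor_part k H)) x)
   * vector_field A f x i 0).
  rewrite -[k.+1]addn1; apply: OhM (dO i) _.
  have hl1 : Oh 1 (peval (lin_form A i)) by apply: Oh_homog; exact: dhomog_lin_form.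
  have h2 := @Oh_le _ _ 1 2 _ isT (field_lin_Oh2 sys i).
  by apply: Oh_eq (OhD h2 hl1) => x /=; rewrite subrK.
have h2 : Oh k.+1 (fun x => peval (mderiv i (taylor_part k H)) x *
   (vector_field A f x i 0 - peval (lin_form A i) x)).
  have -> : k.+1 = (k.-1 + 2)%N by rewrite addn2 prednK.
  apply: OhM (field_lin_Oh2 sys i); apply: Oh_homog; exact: dhomog_mderiv.
by apply: Oh_eq (OhN (OhD h1 h2)) => x /=; ring.
Qed.

(** By [Lie_eq0] the lowest part is nonzero at v; by Euler's identity so is its derivative along v,
    and the estimate near the direction v applies to that form of degree k - 1. *)
Lemma directional_derivative_neq0 v l S (C : R) : spectrum_condition A ->
  A *m v = 0 -> l *m v = 1%:M -> 1%:M - v *m l = A *m S -> 0 <= C ->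
  exists2 e, 0 < e & forall x t, x != 0 -> `|x| < e ->
    `|x - t *: v| <= C * `|x| ^+ 2 -> inner (gradient H x) v != 0.
Proof.
move=> spA Av lv vlAS C0; have [k [k0 h0 dO]] := lowest_part.
have hh := dhomog_hpart (taylor_coef H) k.
have Lh := Lie_lowest_part k0 dO.
have hv : peval (taylor_part k H) v != 0.
  by apply: contra_neq h0; exact: (Lie_eq0 spA vlAS hh Lh).
have dv : peval (dirder v (taylor_part k H)) v != 0.
  by rewrite (peval_euler _ hh) mulf_neq0 // pnatr_eq0 -lt0n.
apply: (directional_neq0 (dhomog_dirder v hh) dv C0); rewrite prednK //.
have hO : Oh k (fun x => \sum_i v i 0 * (partial i H x - peval (mderiv i (taylor_part k H)) x)).
  by apply: Oh_sum => i _; exact: OhZ.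
apply: Oh_eq hO => x; rewrite peval_dirder /inner -sumrB; apply: eq_bigr => i _.
by rewrite mulrBr mxE [_ * v i 0]mulrC.
Qed.

Lemma singular_curve_of_first_integral : spectrum_condition A ->
  has_singular_curve A f V.
Proof.
move=> spA; have [v [l [S [Av lA lv vlAS]]]] := spectrum_splitting spA.
have [C [e1 [C0 e10 hC]]] := mulmx_Oh
  (bordered_inv v l S *m (1%:M - v *m l)) (system_Oh2 sys).
have [e2 e20 he2] := directional_derivative_neq0 spA Av lv vlAS C0.
have [e3 e30 he3] := open_ball0 oU U0.
apply: (@singular_curve _ _ _ _ _ _ _ _ _ sys Av lA lv vlAS (Num.min e1 (Num.min e2 e3))).
  by rewrite !lt_min e10 e20.
move=> x x0; rewrite !lt_min => /andP[xe1 /andP[xe2 xe3]] Fx xv.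
have := FH (he3 x xe3); rewrite Fx => /eqP.
have -> : inner (gradient H x) ((l *m f x) 0 0 *: v) =
    (l *m f x) 0 0 * inner (gradient H x) v.
  by rewrite /inner mulr_sumr; apply: eq_bigr => i _; rewrite [(_ *: v) i 0]mxE mulrCA.
rewrite mulf_eq0 (negPf (he2 x _ x0 xe2 (le_trans xv (hC x xe1)))) orbF.
by move=> /eqP ->; rewrite scale0r.
Qed.

End FirstIntegral.

(** * The example without analytic first integral *)

Section PolynomialSystems.
Variables (R : realType) (n : nat).
Implicit Types (p q : mpoly n R) (x h : 'cV[R]_n).

Lemma peval_translate p x : exists q, forall h, peval p (x + h) = peval q h.
Proof.
elim/mpoly_ring_ind: p => [c|i|p q [p' hp] [q' hq]|p q [p' hp] [q' hq]].
- by exists (mpolyC n c) => h; rewrite /peval !mevalC.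
- exists (mpolyC n (x i 0) + mpolyX R (mnm1 i)) => h.
  by rewrite pevalD !pevalXU mxE /peval mevalC.
- by exists (p' + q') => h; rewrite !pevalD hp hq.
- by exists (p' * q') => h; rewrite !pevalM hp hq.
Qed.

Lemma power_series_cvg_peval p h :
  power_series_cvg (fun m => mcoeff m p) h (peval p h).
Proof.
pose c m := mcoeff m p.
have p_sum N : (mmeasure mdeg p <= N)%N -> \sum_(d < N) hpart c d = p.
  case: N => [|N] pN.
    by rewrite big_ord0; apply/esym/eqP; rewrite -(mmeasure_poly_eq0 mdeg) -leqn0.
  apply/mpolyP => m; rewrite mcoeff_sum_hpart; case: leqP => // mN.
  by apply/esym/memN_msupp_eq0/msize_mdeg_ge; exact: leq_trans pN mN.
have an0 d : (mmeasure mdeg p <= d)%N -> anorm c d = 0.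
  move=> pd; have c0 : hpart c d = 0.
    have := p_sum d.+1 (leqW pd); rewrite big_ord_recr /= (p_sum d pd).
    by move=> /eqP; rewrite -subr_eq0 addrAC subrr add0r => /eqP.
  rewrite anormE big1 // => m md; have := congr1 (mcoeff m) c0.
  by rewrite mcoeff_hpart md mcoeff0 => ->; rewrite normr0.
have gb : geom_bounded (anorm c) (`|h| + 1).
  move=> r r0 _; exists (\sum_(d < mmeasure mdeg p) anorm c d * r ^+ d) => d.
  have t0 k : 0 <= anorm c k * r ^+ k by rewrite mulr_ge0 ?anorm_ge0 // exprn_ge0 // ltW.
  have [dp|pd] := ltnP d (mmeasure mdeg p).
    by rewrite (bigD1 (Ordinal dp)) //= lerDl sumr_ge0.
  by rewrite (an0 d pd) mul0r sumr_ge0.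
have h1 : `|h| < `|h| + 1 by rewrite ltrDl.
have [w hw] := power_series_cvg_exists gb h1.
suff -> : peval p h = w by exact: hw.
case: hw => _ cw; apply: (cvg_unique _ _ cw) => //=.
apply: cvg_near_cst; near=> N; rewrite partial_sumE p_sum //.
by near: N; exact: nbhs_infty_ge.
Unshelve. all: by end_near.
Qed.

Lemma analytic_on_peval (U : set 'cV[R]_n) p : analytic_on U (peval p).
Proof.
move=> x _; have [q hq] := peval_translate p x.
exists (fun m => mcoeff m q), 1; split => // h _.
rewrite hq; exact: power_series_cvg_peval.
Qed.

Lemma mcoeffXUM (j : 'I_n) p (m : multinom n) :
  mcoeff m (mpolyX R (mnm1 j) * p) =
  if m j == 0%N then 0 else mcoeff (mnm_sub m (mnm1 j)) p.
Proof.
have [mj|mj] := eqVneq (m j) 0%N; last first.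
  by rewrite mulrC -{1}(@submK _ (mnm1 j) m) ?lep1mP // addmC mcoeffMX.
rewrite [p]mpolyE mulr_sumr linear_sum big1 // => k _ /=.
rewrite -scalerAr mcoeffZ -mpolyXD mcoeffX.
case: eqVneq => [E|_]; last by rewrite mulr0.
by move: mj; rewrite -E mnmDE mnm1E eqxx.
Qed.

Lemma mcoeffXU_mderiv (j : 'I_n) p (m : multinom n) :
  mcoeff m (mpolyX R (mnm1 j) * mderiv j p) = (m j)%:R * mcoeff m p.
Proof.
rewrite mcoeffXUM; have [->|mj] := eqVneq (m j) 0%N; first by rewrite mul0r.
rewrite mcoeff_mderiv submK ?lep1mP // mulr_natl; congr (_ *+ _).
by rewrite mnmBE mnm1E eqxx subn1 prednK // lt0n.
Qed.

End PolynomialSystems.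

(** * Irrationality and rational approximation of the square root of 2 *)

Section IrrationalRoot.
Variable R : realType.
Local Notation alpha := (Num.sqrt 2 : R).

Lemma sqrt2_gt0 : 0 < alpha.
Proof. by rewrite sqrtr_gt0. Qed.

(** In a^2 = 2 b^2 with a, b positive, the exponents of 2 on the two sides have different
    parities. *)
Lemma sqrt2_irrational (a b : nat) : a%:R = b%:R * alpha -> a = 0%N /\ b = 0%N.
Proof.
move=> E; have : (a ^ 2)%N = (2 * b ^ 2)%N.
  apply/eqP; rewrite -(eqr_nat R) natrM !natrX E exprMn sqr_sqrtr //.
  by rewrite mulrC.
have [->|b0] := posnP b; first by move=> /eqP; rewrite exp0n // muln0 expn_eq0 andbT => /eqP ->.
have [->|a0] := posnP a.
  by move=> /esym/eqP; rewrite exp0n // muln_eq0 expn_eq0 /= andbT eqn0Ngt b0.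
move=> /(congr1 (logn 2)); rewrite lognM ?expn_gt0 ?b0 // !lognX => /(congr1 odd).
by rewrite oddD !oddM /=.
Qed.

Lemma coprime_approx (e : R) : 0 < e -> exists P Q : nat,
  [/\ (0 < P)%N, (0 < Q)%N, coprime P Q, P%:R / Q%:R != alpha
    & `|P%:R / Q%:R - alpha| < e].
Proof.
move=> e0; have h : alpha < alpha + e by rewrite ltrDl.
have [q] := rat_in_itvoo h; rewrite in_itv /= => /andP[q1 q2].
have q0 : 0 < q by rewrite -(ltr0q R); exact: lt_trans sqrt2_gt0 q1.
have n0 : 0 < numq q by rewrite numq_gt0.
exists `|numq q|%N, `|denq q|%N.
have E : `|numq q|%:R / `|denq q|%:R = ratr q :> R.
  by rewrite /ratr !natr_absz (gtr0_norm n0) (gtr0_norm (denq_gt0 q)).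
split.
- by rewrite absz_gt0 gt_eqF.
- by rewrite absz_gt0 denq_neq0.
- exact: coprime_num_den.
- by rewrite E gt_eqF.
- by rewrite E gtr0_norm ?subr_gt0 // ltrBlDl.
Qed.

End IrrationalRoot.

(** * The resonance at points of the axis *)

Section Resonance.
Variable R : realType.
Implicit Types (J : mpoly 4 R) (a b c d : nat).

(* The coordinates of R^4 are (s, y, z, x), in this order. *)
Definition is_ : 'I_4 := @Ordinal 4 0 isT.
Definition iy : 'I_4 := @Ordinal 4 1 isT.
Definition iz : 'I_4 := @Ordinal 4 2 isT.
Definition ix : 'I_4 := @Ordinal 4 3 isT.

Definition var (i : 'I_4) : mpoly 4 R := mpolyX R (mnm1 i).

Definition wpol : mpoly 4 R := 1 - var iy - var iz.

(** The example seen from the point x0 of the axis, with rho = sqrt 2 + x0; at the origin rho = sqrt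
    2. *)
Definition shifted_field (rho : R) (i : 'I_4) : mpoly 4 R :=
  nth 0 [:: var is_ * wpol; var iy * wpol;
            - ((mpolyC 4 rho + var ix) * (var iz * wpol)); var is_] i.

Definition mon4 a b c d : multinom 4 :=
  Multinom [tuple nth 0%N [:: a; b; c; d] i | i < 4].

Lemma mon4E a b c d (i : 'I_4) : mon4 a b c d i = nth 0%N [:: a; b; c; d] i.
Proof. by rewrite mnmE. Qed.

Lemma mdeg_mon4 a b c d : mdeg (mon4 a b c d) = (a + b + c + d)%N.
Proof.
by rewrite mdegE !big_ord_recr big_ord0 /= !mon4E /=.
Qed.

Lemma mon4_sub a b c d (i : 'I_4) : mnm_sub (mon4 a b c d) (mnm1 i) =
  mon4 (a - (i == is_)) (b - (i == iy)) (c - (i == iz)) (d - (i == ix)).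
Proof.
apply/mnmP => j; rewrite mnmBE mnm1E !mon4E.
by case: j => [[|[|[|[|j]]]] hj].
Qed.

Lemma mon4_add a b c d (i : 'I_4) : mnm_add (mon4 a b c d) (mnm1 i) =
  mon4 (a + (i == is_)) (b + (i == iy)) (c + (i == iz)) (d + (i == ix)).
Proof.
apply/mnmP => j; rewrite mnmDE mnm1E !mon4E.
by case: j => [[|[|[|[|j]]]] hj].
Qed.

(** The derivation along the s, y and z components of the field, divided by w. It multiplies s^a y^b
    z^c x^d by a + b - rho c, up to a term of higher degree in x. *)
Definition euler_part (rho : R) J : mpoly 4 R :=
  var is_ * mderiv is_ J + var iy * mderiv iy J
  - rho *: (var iz * mderiv iz J) - var ix * (var iz * mderiv iz J).

Lemma Lie_shifted_field rho J :
  \sum_(i < 4) mderiv i J * shifted_field rho i =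
  wpol * euler_part rho J + var is_ * mderiv ix J.
Proof.
rewrite !big_ord_recl big_ord0 /shifted_field /=.
have -> : lift ord0 (lift ord0 (lift ord0 ord0)) = ix by apply/val_inj.
have -> : lift ord0 (lift ord0 ord0) = iz by apply/val_inj.
have -> : lift ord0 ord0 = iy by apply/val_inj.
have -> : ord0 = is_ by apply/val_inj.
by rewrite /euler_part -mul_mpolyC; ring.
Qed.

Lemma mcoeff_euler_part rho J a b c d :
  mcoeff (mon4 a b c d) (euler_part rho J) =
  (a%:R + b%:R - rho * c%:R) * mcoeff (mon4 a b c d) J
  - (if d is d'.+1 then c%:R * mcoeff (mon4 a b c d') J else 0).
Proof.
rewrite /euler_part !(mcoeffB, mcoeffD, mcoeffZ) !mcoeffXU_mderiv mcoeffXUM.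
rewrite !mon4E /=; case: d => [|d] /=; first by rewrite !subr0; ring.
rewrite mcoeffXU_mderiv mon4_sub /= !subn0 subn1 /= mon4E /=; ring.
Qed.

Lemma mcoeff_wpolM (E : mpoly 4 R) a b c d :
  mcoeff (mon4 a b c d) (wpol * E) = mcoeff (mon4 a b c d) E
  - (if b is b'.+1 then mcoeff (mon4 a b' c d) E else 0)
  - (if c is c'.+1 then mcoeff (mon4 a b c' d) E else 0).
Proof.
rewrite /wpol !mulrBl mul1r !mcoeffB !mcoeffXUM !mon4E /= !mon4_sub /=.
by congr (_ - _ - _); [case: b => //= b|case: c => //= c]; rewrite subn1 !subn0.
Qed.

Lemma mcoeff_varM_mderiv J a b c d :
  mcoeff (mon4 a b c d) (var is_ * mderiv ix J) =
  if a is a'.+1 then d.+1%:R * mcoeff (mon4 a' b c d.+1) J else 0.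
Proof.
rewrite mcoeffXUM mon4E /= mon4_sub /=; case: a => //= a.
by rewrite subn1 !subn0 /= mcoeff_mderiv mon4_add /= !addn0 addn1 mon4E /= mulr_natl.
Qed.

(* The equation reads w E J + s (dJ/dx) = 0 with E = euler_part rho. Dividing by
   w, the coefficient of s y^(P-1) z^Q in s w^-1 (dJ/dx) is a positive multiple
   of dJ/dx(0), while E kills this monomial: 1 + (P - 1) - rho Q = 0. *)
Lemma resonance rho J (P Q N : nat) :
  (0 < P)%N -> (0 < Q)%N -> coprime P Q -> rho = P%:R / Q%:R ->
  (P + Q + 2 <= N)%N ->
  (forall m, (mdeg m <= N)%N ->
     mcoeff m (\sum_(i < 4) mderiv i J * shifted_field rho i) = 0) ->
  mcoeff (mnm1 ix) J = 0.
Proof.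
move=> P0 Q0 PQ rhoE NPQ Z0.
pose e a b c d := mcoeff (mon4 a b c d) (euler_part rho J).
pose j a b c d := mcoeff (mon4 a b c d) J.
have rec a b c d : (a + b + c + d <= N)%N ->
    e a b c d - (if b is b'.+1 then e a b' c d else 0)
    - (if c is c'.+1 then e a b c' d else 0)
    + (if a is a'.+1 then d.+1%:R * j a' b c d.+1 else 0) = 0.
  move=> abcd; have := Z0 (mon4 a b c d); rewrite mdeg_mon4 => /(_ abcd).
  by rewrite Lie_shifted_field mcoeffD mcoeff_wpolM mcoeff_varM_mderiv.
(* For s = 0 the equation reduces to w E J = 0, and w is invertible as a power series. *)
have e0 b c d : (b + c + d <= N)%N -> e 0%N b c d = 0.
  have [k] := ubnP (b + c); elim: k b c => // k IH b c; rewrite ltnS => bck bcd.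
  have := rec 0%N b c d bcd; rewrite addr0.
  have -> : (if b is b'.+1 then e 0%N b' c d else 0) = 0.
    by case: b bck bcd => // b bck bcd; apply: IH => //; exact: ltnW.
  have -> : (if c is c'.+1 then e 0%N b c' d else 0) = 0.
    case: c bck bcd => // c bck bcd; apply: IH; first by rewrite -addnS.
    by apply: leq_trans bcd; rewrite addnS leqnSn.
  by rewrite !subr0.
(* Since P and Q are coprime, b = rho c with b < P and c <= Q happens only for b = c = 0. Elsewhere
   E can be inverted, first on the terms without x and then on those linear in x. *)
have jx b c : (b < P)%N -> (c <= Q)%N -> (b + c)%N != 0%N -> j 0%N b c 1%N = 0.
  move=> bP cQ bc0.
  have den : b%:R - rho * c%:R != 0.
    have Q0' : Q%:R != 0 :> R by rewrite pnatr_eq0 -lt0n.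
    rewrite rhoE subr_eq0; apply/eqP => bE.
    have E : (P * c = b * Q)%N.
      apply/eqP; rewrite -(eqr_nat R) !natrM bE; apply/eqP; field.
      exact: Q0'.
    have Qc : (Q %| c)%N.
      by rewrite -(@Gauss_dvdr Q P) 1?coprime_sym // E dvdn_mull.
    case: (posnP c) bc0 E => [-> |c0 _].
      by rewrite addn0 muln0 => b0 /esym/eqP; rewrite muln_eq0 (negPf b0) eqn0Ngt Q0.
    have -> : c = Q by apply/eqP; rewrite eqn_leq cQ dvdn_leq.
    by move=> /eqP; rewrite eqn_mul2r eqn0Ngt Q0 /= => /eqP E; rewrite E ltnn in bP.
  have bcN d : (d <= 1)%N -> (b + c + d <= N)%N.
    by move: bP cQ NPQ {bc0}; lia.
  have j0 : j 0%N b c 0%N = 0.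
    have := e0 b c 0%N (bcN 0%N isT); rewrite /e mcoeff_euler_part subr0 add0r => /eqP.
    by rewrite mulf_eq0 (negPf den) => /eqP.
  have := e0 b c 1%N (bcN 1%N isT); rewrite /e mcoeff_euler_part -/(j _ _ _ _) -/(j _ _ _ _) j0.
  by rewrite mulr0 subr0 add0r => /eqP; rewrite mulf_eq0 (negPf den) => /eqP.
(* The coefficients of s y^b z^c in E J obey the recursion of -1/w times the x-derivative of J at 0,
   so k is the binomial coefficient of b + c over b; only its positivity is recorded. *)
have e1 b c : (b < P)%N -> (c <= Q)%N ->
    exists2 k : nat, (0 < k)%N & e 1%N b c 0%N = - (k%:R * j 0%N 0%N 0%N 1%N).
  have [s] := ubnP (b + c); elim: s b c => // s IH b c; rewrite ltnS => bcs bP cQ.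
  have bcN : (1 + b + c + 0 <= N)%N.
    by move: bP cQ NPQ {bcs IH}; lia.
  have := rec 1%N b c 0%N bcN; rewrite mul1r.
  have [bc0|bc0] := eqVneq (b + c)%N 0%N.
    move: bc0 => /eqP; rewrite addn_eq0 => /andP[/eqP -> /eqP ->].
    rewrite !subr0 => /eqP; rewrite addr_eq0 => /eqP ->.
    by exists 1%N; rewrite ?mul1r.
  rewrite (jx b c bP cQ bc0) addr0.
  have [kb [eb kb0]] : exists kb : nat,
      (if b is b'.+1 then e 1%N b' c 0%N else 0) = - (kb%:R * j 0%N 0%N 0%N 1%N) /\
      (0 < b -> 0 < kb)%N.
    case: b bcs bP {bcN bc0} => [|b] bcs bP; first by exists 0%N; rewrite mul0r oppr0.
    by have [k k0 ->] := IH b c bcs (ltnW bP) cQ; exists k.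
  have [kc [ec kc0]] : exists kc : nat,
      (if c is c'.+1 then e 1%N b c' 0%N else 0) = - (kc%:R * j 0%N 0%N 0%N 1%N) /\
      (0 < c -> 0 < kc)%N.
    case: c bcs cQ {bcN bc0 eb} => [|c] bcs cQ; first by exists 0%N; rewrite mul0r oppr0.
    by rewrite addnS in bcs; have [k k0 ->] := IH b c bcs bP (ltnW cQ); exists k.
  rewrite eb ec => /eqP; rewrite !opprK -addrA addr_eq0 -mulrDl -natrD => /eqP ->.
  exists (kb + kc)%N => //; move: bc0; rewrite -lt0n !addn_gt0.
  by case/orP => [/kb0 ->|/kc0 ->]; rewrite ?orbT.
have PQ1 : (P.-1 < P)%N by rewrite prednK.
have [k k0] := e1 P.-1 Q PQ1 (leqnn Q).
rewrite /e mcoeff_euler_part subr0 -natrD add1n prednK // rhoE mulfVK; last first.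
  by rewrite pnatr_eq0 -lt0n.
rewrite subrr mul0r => /esym/eqP; rewrite oppr_eq0 mulf_eq0 pnatr_eq0 eqn0Ngt k0 /= => /eqP.
rewrite /j; congr (mcoeff _ _ = _).
by apply/mnmP => i; rewrite mon4E mnm1E; case: i => [[|[|[|[|i]]]] hi].
Qed.

End Resonance.

(** * The example and its hypotheses *)

Section Example.
Variable R : realType.
Local Notation alpha := (Num.sqrt 2 : R).
Implicit Types (x h : 'cV[R]_4).

Definition example_mx : 'M[R]_4 := \matrix_(i, j)
  if i == j then nth 0 [:: 1; 1; - alpha; 0] i else ((i == ix) && (j == is_))%:R.

Definition example_poly (i : 'I_4) : mpoly 4 R :=
  shifted_field alpha i - lin_form example_mx i.

Definition example_rest x : 'cV[R]_4 := \col_i peval (example_poly i) x.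

Lemma mul_example_mx x (i : 'I_4) : (example_mx *m x) i 0 =
  nth 0 [:: x is_ 0; x iy 0; - alpha * x iz 0; x is_ 0] i.
Proof.
rewrite mxE !big_ord_recl big_ord0 !mxE.
have -> : lift ord0 (lift ord0 (lift ord0 ord0)) = ix by apply/val_inj.
have -> : lift ord0 (lift ord0 ord0) = iz by apply/val_inj.
have -> : lift ord0 ord0 = iy by apply/val_inj.
have -> : ord0 = is_ by apply/val_inj.
by case: i => [[|[|[|[|i]]]] hi] //=; rewrite ?mul0r ?mul1r ?addr0 ?add0r.
Qed.

Lemma peval_shifted_field rho x (i : 'I_4) : peval (shifted_field rho i) x =
  nth 0 [:: x is_ 0 * (1 - x iy 0 - x iz 0); x iy 0 * (1 - x iy 0 - x iz 0);
    - ((rho + x ix 0) * (x iz 0 * (1 - x iy 0 - x iz 0))); x is_ 0] i.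
Proof.
have pw : peval (wpol R) x = 1 - x iy 0 - x iz 0.
  by rewrite /wpol /peval !mevalB meval1 !mevalXU.
case: i => [[|[|[|[|i]]]] hi] //=; rewrite /shifted_field /=.
- by rewrite pevalM pevalXU pw.
- by rewrite pevalM pevalXU pw.
- by rewrite /peval mevalN -/(peval _ x) !pevalM pevalD /= !pevalXU pw /peval mevalC.
- by rewrite pevalXU.
Qed.

Lemma example_field x (i : 'I_4) :
  vector_field example_mx example_rest x i 0 = peval (shifted_field alpha i) x.
Proof.
by rewrite /vector_field !mxE /example_poly /peval mevalB -!/(peval _ _)
  peval_lin_form mxE addrC subrK.
Qed.

Lemma example_rest_Oh2 (i : 'I_4) : Oh 2 (peval (example_poly i)).
Proof.
have O1 (j : 'I_4) : Oh 1 (fun x => x j 0).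
  have hO : Oh 1 (peval (var R j)).
    apply: Oh_homog; rewrite dhomogX; exact/eqP/mdeg1.
  by apply: Oh_eq hO => x; rewrite pevalXU.
have O2 : Oh 1 (fun x => - x iy 0 - x iz 0) by apply: OhB => //; exact: OhN.
have O3 : Oh 0 (fun x => - (1 - x iy 0 - x iz 0)).
  by apply: OhN; apply: OhB; [apply: OhB; [exact: Oh_cst|]|]; exact: (@Oh_le _ _ 0 1).
have E x : peval (example_poly i) x = nth 0
    [:: x is_ 0 * (- x iy 0 - x iz 0); x iy 0 * (- x iy 0 - x iz 0);
        - alpha * (x iz 0 * (- x iy 0 - x iz 0))
          + x ix 0 * x iz 0 * - (1 - x iy 0 - x iz 0); 0] i.
  rewrite /example_poly /peval mevalB -!/(peval _ _) peval_lin_form.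
  rewrite mul_example_mx peval_shifted_field.
  by case: i => [[|[|[|[|i]]]] hi] //=; ring.
apply: (@Oh_eq _ _ _ _ _ (fun x => esym (E x))).
case: i {E} => [[|[|[|[|i]]]] hi] //=.
- exact: (OhM (O1 is_) O2).
- exact: (OhM (O1 iy) O2).
- apply: OhD; first exact: OhZ (OhM (O1 iz) O2).
  exact: (OhM (OhM (O1 ix) (O1 iz)) O3).
- exact: Oh0.
Qed.

Lemma example_system : system Comega example_mx example_rest setT.
Proof.
have E i : (fun x => example_rest x i 0) = peval (example_poly i).
  by apply/funext => x; rewrite mxE.
split => //; first exact: openT.
  by move=> i; rewrite E; exact: analytic_on_peval.
by move=> i m m1; rewrite E taylor_coef_peval; exact: (peval_Oh_coef (example_rest_Oh2 i)).
Qed.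

Lemma example_spectrum : spectrum_condition example_mx.
Proof.
exists (fun i => nth 0 [:: 0; 1; 1; - (real_complex R alpha)] i); split => //.
  rewrite char_poly_trig; last first.
    apply/is_trig_mxP => i j ij; rewrite !mxE.
    have -> : i == j = false by apply/eqP => E; rewrite E ltnn in ij.
    by case: (eqVneq j is_) => [E|_]; [rewrite E in ij|rewrite andbF].
  by rewrite !big_ord_recl !big_ord0 !mxE /=; ring.
move=> m m1.
(* The list of eigenvalues starts with 0, so [iy], [iz] and [ix] serve here merely as the indices 1,
   2, 3 of the eigenvalues 1, 1 and - sqrt 2, not as coordinates. *)
have E : \sum_(j < 4 | j != ord0) (m j)%:R * nth 0 [:: 0; 1; 1; - real_complex R alpha] j
   = real_complex R ((m iy + m iz)%N%:R - (m ix)%:R * alpha).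
  rewrite big_mkcond !big_ord_recl big_ord0 /=.
  have -> : lift ord0 (lift ord0 (lift ord0 ord0)) = ix by apply/val_inj.
  have -> : lift ord0 (lift ord0 ord0) = iz by apply/val_inj.
  have -> : lift ord0 ord0 = iy by apply/val_inj.
  rewrite rmorphB rmorphM !rmorph_nat natrD; ring.
rewrite E fmorph_eq0 subr_eq0; apply/eqP => /sqrt2_irrational[/eqP myz mx].
move: m1; rewrite big_mkcond !big_ord_recl big_ord0 /=.
have -> : lift ord0 (lift ord0 (lift ord0 ord0)) = ix by apply/val_inj.
have -> : lift ord0 (lift ord0 ord0) = iz by apply/val_inj.
have -> : lift ord0 ord0 = iy by apply/val_inj.
by move: myz; rewrite addn_eq0 mx => /andP[/eqP -> /eqP ->].
Qed.

Lemma example_axis (t : R) :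
  vector_field example_mx example_rest (t *: delta_mx ix 0) = 0.
Proof.
apply/matrixP => i j; rewrite (ord1 j) example_field peval_shifted_field !mxE /=.
by case: i => [[|[|[|[|i]]]] hi] //=; ring.
Qed.

Lemma example_curve : has_singular_curve example_mx example_rest setT.
Proof.
exists 1, (fun t => t *: delta_mx ix 0); split => //.
- by move=> t _; exact: scalel_continuous.
- move=> s t _ _ /matrixP/(_ ix 0); rewrite !mxE !eqxx !mulr1; exact.
- by rewrite scale0r.
- by move=> t _; split => //; exact: example_axis.
Qed.

End Example.

(** * Nonexistence of an analytic first integral *)

Section NoIntegral.
Variable R : realType.
Local Notation alpha := (Num.sqrt 2 : R).
Local Notation A := (example_mx R).
Local Notation F := (vector_field A (@example_rest R)).

Lemma analytic_on_translate (n : nat) (U : set 'cV[R]_n) (p : 'cV[R]_n) g :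
  analytic_on U g -> analytic_on [set h | U (p + h)] (fun h => g (p + h)).
Proof.
move=> ag h /ag [c [rho [rho0 cg]]]; exists c, rho; split => // k kr.
by rewrite addrA; exact: cg.
Qed.

Lemma open_translate (n : nat) (U : set 'cV[R]_n) (p : 'cV[R]_n) :
  open U -> open [set h | U (p + h)].
Proof.
move=> oU.
have tc (h : 'cV[R]_n) : (fun k : 'cV[R]_n => k + p) @ h --> h + p.
  exact: (cvgD cvg_id (cvg_cst p)).
have -> : [set h | U (p + h)] = (fun k => k + p) @^-1` U.
  by apply/funext => h; rewrite /preimage /= addrC.
by apply: open_comp => // h _; exact: tc.
Qed.

Lemma example_field_shift (x0 : R) h (i : 'I_4) :
  F (x0 *: delta_mx ix 0 + h) i 0 = peval (shifted_field (alpha + x0) i) h.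
Proof.
rewrite example_field !peval_shifted_field !mxE /=.
by case: i => [[|[|[|[|i]]]] hi] //=; ring.
Qed.

(** The resonance involves only finitely many coefficients. A Taylor polynomial of H at the point,
    of degree N + 1 with N = P + Q + 2, satisfies the integral equation through degree N, which is
    enough. *)
Lemma axis_derivative_eq0 (U : set 'cV[R]_4) H (x0 : R) (P Q : nat) :
  open U -> analytic_on U H -> (forall x, U x -> inner (gradient H x) (F x) = 0) ->
  U (x0 *: delta_mx ix 0) -> (0 < P)%N -> (0 < Q)%N -> coprime P Q ->
  alpha + x0 = P%:R / Q%:R -> partial ix H (x0 *: delta_mx ix 0) = 0.
Proof.
set p := x0 *: _ => oU aH FH Up P0 Q0 PQ rhoE.
pose G h := H (p + h); pose W := [set h | U (p + h)].
have oW : open W by exact: open_translate.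
have W0 : W 0 by rewrite /W /= addr0.
have sG : smooth_on W G by exact/analytic_on_smooth/analytic_on_translate.
have dG i h : partial i G h = partial i H (p + h).
  by have /(congr1 (fun f => f h)) := iter_partial_shift [:: i] H p.
have [e e0 he] := open_ball0 oW W0.
pose N := (P + Q + 2)%N.
pose J : mpoly 4 R := \sum_(d < N.+2) taylor_part d G.
have JO i : Oh N.+1 (fun h => partial i G h - peval (mderiv i J) h).
  exact: (taylor_partial_Oh _ _ oW W0 sG).
have Z0 m : (mdeg m <= N)%N ->
    mcoeff m (\sum_(i < 4) mderiv i J * shifted_field (alpha + x0) i) = 0.
  apply: peval_Oh_coef.
  have SO : Oh N.+1 (fun h => \sum_(i < 4)
      (partial i G h - peval (mderiv i J) h) * peval (shifted_field (alpha + x0) i) h).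
    apply: Oh_sum => i _; rewrite -[N.+1]addn0; apply: OhM => //.
    exact/Oh_continuous/continuous_peval.
  apply: Oh_ext e0 _ (OhN SO) => h hh.
  have Eh : \sum_(i < 4) partial i G h * peval (shifted_field (alpha + x0) i) h = 0.
    rewrite -[RHS](FH _ (he h hh)) /inner; apply: eq_bigr => i _.
    by rewrite dG -example_field_shift [gradient _ _ _ _]mxE.
  under eq_bigr do rewrite mulrBl.
  by rewrite sumrB Eh sub0r opprK peval_sum; apply: eq_bigr => i _; rewrite pevalM.
have := resonance P0 Q0 PQ rhoE (leqnn _) Z0 => Jx.
have [C [r [C0 r0 hC]]] := JO ix.
have := hC 0; rewrite normr0 expr0n mulr0 normr_le0 subr_eq0 => /(_ r0)/eqP.
rewrite dG addr0 peval_at0 mcoeff_mderiv add0m Jx mul0rn; exact.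
Qed.

Lemma example_no_integral :
  ~ exists U H, first_integral_on Comega A (@example_rest R) setT U H.
Proof.
move=> [U [H [[oU cU U0 _] aH H0 nc FH]]].
have sH := analytic_on_smooth aH.
have nf : nonflat H by apply: (Cr_nonflat (r := Comega) oU cU U0 aH H0 nc).
have [v [l [S [Av lA lv vlAS]]]] := spectrum_splitting (example_spectrum R).
have vE (i : 'I_4) : i != ix -> v i 0 = 0.
  have /matrixP Avi := Av.
  have h i' := etrans (esym (mul_example_mx v i')) (etrans (Avi i' 0) (mxE _ _ _ _)).
  case: i => [[|[|[|[|i]]]] hi] //= _.
  - by rewrite -[RHS](h is_) /=; congr (v _ _); apply/val_inj.
  - by rewrite -[RHS](h iy) /=; congr (v _ _); apply/val_inj.
  - have /eqP := h iz; rewrite /= mulf_eq0 oppr_eq0 gt_eqF ?sqrt2_gt0 //= => /eqP <-.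
    by congr (v _ _); apply/val_inj.
have vx : v = v ix 0 *: delta_mx ix 0.
  apply/matrixP => i j; rewrite (ord1 j) !mxE andbT; case: eqVneq => [->|ne].
    by rewrite mulr1.
  by rewrite mulr0 vE.
have vx0 : v ix 0 != 0.
  apply: contra_neq (oner_neq0 R) => v0; have /matrixP/(_ 0 0) := lv.
  by rewrite vx v0 scale0r mulmx0 !mxE eqxx => ->.
(* The constant 0 suffices because the points to be tested lie on the line of v itself. *)
have [e e0 he] := directional_derivative_neq0 (example_system R) oU U0 sH nf H0 FH
  (example_spectrum R) Av lv vlAS (lexx 0).
have [e' e'0 he'] := open_ball0 oU U0.
have m0 : 0 < Num.min e e' by rewrite lt_min e0.
have [P [Q [P0 Q0 PQ neq]]] := coprime_approx m0.
rewrite lt_min => /andP[x0e x0e'].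
pose x0 := P%:R / Q%:R - alpha; pose p : 'cV[R]_4 := x0 *: delta_mx ix 0.
have px : `|p| <= `|x0|.
  by rewrite normrZ -[leRHS]mulr1; apply: ler_pM => //; exact: norm_delta_le.
have p0 : p != 0.
  apply/eqP => /matrixP/(_ ix 0); rewrite !mxE !eqxx mulr1 => /eqP.
  by rewrite subr_eq0 (negPf neq).
have := he p (x0 / v ix 0) p0 (le_lt_trans px x0e).
have -> : (x0 / v ix 0) *: v = p by rewrite [X in _ *: X]vx scalerA divfK.
rewrite subrr normr0 mul0r lexx => /(_ isT)/eqP; apply.
rewrite /inner (bigD1 ix) //= big1 ?addr0 => [|i ne]; last by rewrite vE // mulr0.
rewrite mxE (axis_derivative_eq0 oU aH FH _ P0 Q0 PQ) ?mul0r //.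
  by apply: he'; exact: le_lt_trans px x0e'.
by rewrite addrC subrK.
Qed.

End NoIntegral.

Theorem theorem3 (R : realType) :
  (forall (r : regularity) (n : nat) (A : 'M[R]_n.+1)
      (f : 'cV[R]_n.+1 -> 'cV[R]_n.+1) (V : set 'cV[R]_n.+1),
    system r A f V -> spectrum_condition A ->
    ((exists U H, first_integral_on r A f V U H /\ (r = Cinfty -> nonflat H)) ->
      has_singular_curve A f V) /\
    (has_singular_curve A f V ->
      exists H, formal_first_integral A f H)) /\
  (exists (n : nat) (A : 'M[R]_n.+1)
      (f : 'cV[R]_n.+1 -> 'cV[R]_n.+1) (V : set 'cV[R]_n.+1),
    [/\ system Comega A f V, spectrum_condition A, has_singular_curve A f V
      & ~ exists U H, first_integral_on Comega A f V U H]).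
Proof.
split=> [r n A f V sys spA|]; last first.
  exists 3%N, (example_mx R), (@example_rest R), setT; split.
  - exact: example_system.
  - exact: example_spectrum.
  - exact: example_curve.
  - exact: example_no_integral.
split=> [[U [H [[[oU cU U0 _] aH H0 nc FH] nf]]]|curve].
  have nfH := Cr_nonflat oU cU U0 aH H0 nc nf.
  exact: (singular_curve_of_first_integral sys oU U0 (Cr_on_smooth aH) nfH H0 FH spA).
exact: (formal_integral_of_singular_points sys spA (curve_singular_points curve)).
Qed.
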